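(* There are no regular $\Theta$-shrinkers; that is, there do not exist two distinct points $A,B\in\mathbb{R}^2$ and three curves $\gamma_1,\gamma_2,\gamma_3$ in $\mathbb{R}^2$ forming a regular $\Theta$-shrinker with triple junctions $A$ and $B$.
   Context: A shrinking curve is a smooth ($C^2$, hence $C^\infty$) curve $\gamma:I\to\mathbb{R}^2$, $I\subset\mathbb{R}$ an interval, parametrized by arclength $s$, satisfying $k+\langle\gamma\,|\,\nu\rangle=0$ at every point, where $\tau=\gamma_s$ is the unit tangent vector, $\nu$ is the counterclockwise rotation of $\tau$ by $\pi/2$, and $k$ is the curvature, defined by $\gamma_{ss}=k\nu$. A regular $\Theta$-shrinker with triple junctions $A\neq B$ is a triple of shrinking curves $\gamma_i:[\underline{s}_i,\overline{s}_i]\to\mathbb{R}^2$, $i\in\{1,2,3\}$ (closed bounded intervals with $\underline{s}_i<\overline{s}_i$, smooth up to the endpoints), such that: each $\gamma_i$ is injective and has endpoints $A$ and $B$; the three curves intersect each other only at $A$ and $B$; and at each of the two points $A$ and $B$ the three curves meet forming angles of $120$ degrees, i.e. the three unit tangent vectors of the curves at that point, pointing away from the point into the curves, pairwise form angles of $2\pi/3$. *)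

(* Defs.v *)
(* Classical real numbers of Stdlib; the plane is R * R. *)
From Stdlib Require Import Reals.
Open Scope R_scope.

Definition vscale (c : R) (u : R * R) : R * R := (c * fst u, c * snd u).
Definition vopp (u : R * R) : R * R := (- fst u, - snd u).
Definition dot (u v : R * R) : R := fst u * fst v + snd u * snd v.
Definition norm (u : R * R) : R := sqrt (dot u u).
Definition angle (u v : R * R) : R := acos (dot u v / (norm u * norm v)).

(* Counterclockwise rotation by PI / 2. *)
Definition rot (u : R * R) : R * R := (- snd u, fst u).

Definition segment (a b : R) : R -> Prop := fun s => a <= s <= b.

(* Derivatives and continuity are relative to the domain I, hence one-sided at
   the endpoints of a segment; a curve is a function on all of R of which only
   the values on I are constrained. *)
Definition derivative_within (I : R -> Prop) (f : R -> R * R) (s : R) (v : R * R)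
  : Prop :=
  D_in (fun t => fst (f t)) (fun _ => fst v) I s /\
  D_in (fun t => snd (f t)) (fun _ => snd v) I s.

Definition continuous_within (I : R -> Prop) (f : R -> R * R) (s : R) : Prop :=
  continue_in (fun t => fst (f t)) I s /\
  continue_in (fun t => snd (f t)) I s.

Definition C2_on (I : R -> Prop) (f f1 f2 : R -> R * R) : Prop :=
  forall s, I s ->
    derivative_within I f s (f1 s) /\
    derivative_within I f1 s (f2 s) /\
    continuous_within I f2 s.

Definition shrinking_curve (I : R -> Prop) (gamma : R -> R * R) : Prop :=
  exists (tau gamma_ss : R -> R * R) (k : R -> R),
    C2_on I gamma tau gamma_ss /\
    forall s, I s ->
      norm (tau s) = 1 /\
      gamma_ss s = vscale (k s) (rot (tau s)) /\
      k s + dot (gamma s) (rot (tau s)) = 0.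

(* v is the tangent vector of gamma at its endpoint P, pointing into the curve:
   it is the arclength derivative at the initial point, and its opposite at the
   final point. *)
Definition inward_tangent (a b : R) (gamma : R -> R * R) (P v : R * R) : Prop :=
  (gamma a = P /\ derivative_within (segment a b) gamma a v) \/
  (gamma b = P /\ derivative_within (segment a b) gamma b (vopp v)).

Inductive index : Set := i1 | i2 | i3.

Definition triple_junction (a b : index -> R) (gamma : index -> R -> R * R)
  (P : R * R) : Prop :=
  exists v : index -> R * R,
    (forall i, inward_tangent (a i) (b i) (gamma i) P (v i)) /\
    (forall i j, i <> j -> angle (v i) (v j) = 2 * PI / 3).

(* No orientation is imposed: each curve may run from A to B or from B to A. *)
Record regular_Theta_shrinker (A B : R * R) (a b : index -> R)
  (gamma : index -> R -> R * R) : Prop := {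
  theta_nontrivial : forall i, a i < b i;
  theta_shrinking : forall i, shrinking_curve (segment (a i) (b i)) (gamma i);
  theta_injective : forall i s t,
    segment (a i) (b i) s -> segment (a i) (b i) t ->
    gamma i s = gamma i t -> s = t;
  theta_endpoints : forall i,
    (gamma i (a i) = A /\ gamma i (b i) = B) \/
    (gamma i (a i) = B /\ gamma i (b i) = A);
  theta_intersection : forall i j s t, i <> j ->
    segment (a i) (b i) s -> segment (a j) (b j) t ->
    gamma i s = gamma j t -> gamma i s = A \/ gamma i s = B;
  theta_junction_A : triple_junction a b gamma A;
  theta_junction_B : triple_junction a b gamma B
}.

(* Main.v *)
(* For a unit speed shrinking curve put k = gamma x tau and g = <gamma, tau>; then
   k_s = k g and g_s = 1 - k^2, so k e^(-|gamma|^2/2) is constant: either the curve lies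
   on a line through the origin or k never vanishes and the polar angle phi is monotone.
   In the second case, with rho = |gamma|^2 and z = g / k, the curve solves the system
   rho' = 2 rho z, z' = (1 + z^2)(1 - rho) in the variable phi, the tangent angle is
   theta = phi - atan z up to a constant, and rho - ln rho + ln (1 + z^2) is conserved.

   At a triple junction the three curvatures sum to 0.  If none vanishes, two curves,
   1 and 2, leave A on the same side, and each of them closes up with the third one to
   a simple loop winding once around the origin.  Hence 1 and 2 sweep the same polar
   angle, one of them, say 1, stays inside 2, and the 120 degree conditions give
   theta-length(2) = theta-length(1) + 4 pi / 3.  On the other hand curve 2 leaves A at
   an angle of less than 60 degrees to the outward radius, and from such a point the
   radius reaches its next maximum within a theta-length smaller than 2 pi / 3; the same
   holds backwards from B.  So curve 2 must have a minimum of the radius between two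
   maxima, and this is excluded by comparison with curve 1, which lies inside and has a
   higher energy, hence a shorter period.  If one curvature vanishes, that curve is a
   segment through the origin, and the other two sweep an angle pi each; the same two
   estimates apply.

   Both estimates rest on y = z / 3 + (kappa - 1) / z, where kappa = 1 / k^2: it is the
   logarithmic derivative of k^(1/3) k_theta, decreases from +oo to -oo between a minimum
   and the next maximum of the radius, and satisfies dy/dtheta = - (2 + y^2 + 2/9 z^2),
   where z increases with the energy for fixed y. *)
From Stdlib Require Import Reals ZArith Lra Lia Psatz IndefiniteDescription Ranalysis5.
From Coquelicot Require Import Coquelicot.
Require Import Defs.
Open Scope R_scope.

(** * Calculus on an interval *)

(** In the variable theta the curves satisfy k'' + k = 1 / k, with z = k' / k and energy k'^2 + k^2
    - ln (k^2). For w = k^alpha k' this gives w'' / w = (3 alpha - 1) kappa - (3 alpha + 1) +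
    (alpha^2 - alpha) z^2. The exponent alpha = 1/3 removes kappa and leaves w'' = - (2 + 2/9 z^2)
    w, whose Riccati variable is y = w' / w. The frequency sqrt 2 alone bounds a half period only by
    pi / sqrt 2 = 2.22, a value that nearly round curves approach, while 2 pi / 3 = 2.09 is
    required. So the 60 degree condition must enter quantitatively. If y is at most 7 at the start,
    enough of the half period is already over. If y is larger, z >= tan (pi / 6) forces a high
    energy, which keeps z away from 0 during the descent and raises the frequency. In the other
    direction, z stays below its value on the curve kappa = 0, the limit of infinite energy, whose
    half period is pi / 2. Between zeros of z the increments of theta and of the polar angle agree,
    so half periods can be measured in either. *)

Lemma continuous_cont_pt (f : R -> R) (x : R) : continuous f x -> continuity_pt f x.
Proof. intros H. now apply continuity_pt_filterlim. Qed.

Lemma MVT_open (f df : R -> R) (a b : R) :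
  a < b ->
  (forall x, a <= x <= b -> continuous f x) ->
  (forall x, a < x < b -> is_derive f x (df x)) ->
  exists c, a < c < b /\ f b - f a = df c * (b - a).
Proof.
intros Hab Hc Hd.
assert (Hpr : forall c, a < c < b -> derivable_pt f c).
{ intros c Hcc. exists (df c). now apply is_derive_Reals, Hd. }
assert (Hid : forall c, a < c < b -> derivable_pt id c).
{ intros c _. apply derivable_pt_id. }
destruct (MVT f id a b Hpr Hid Hab) as [c [Hcc He]].
- intros c Hcc. now apply continuous_cont_pt, Hc.
- intros c Hcc. apply derivable_continuous_pt, derivable_pt_id.
- exists c. split; [exact Hcc|].
  rewrite (derive_pt_eq_0 f c (df c) (Hpr c Hcc)) in He by (now apply is_derive_Reals, Hd).
  rewrite (derive_pt_eq_0 id c 1 (Hid c Hcc)) in He by apply derivable_pt_lim_id.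
  unfold id in He. lra.
Qed.

Lemma derive_nonneg_le (f df : R -> R) (a b : R) :
  a <= b ->
  (forall x, a <= x <= b -> continuous f x) ->
  (forall x, a < x < b -> is_derive f x (df x)) ->
  (forall x, a < x < b -> 0 <= df x) ->
  f a <= f b.
Proof.
intros [Hab|<-] Hc Hd Hp; [|lra].
destruct (MVT_open f df a b Hab Hc Hd) as [c [Hcc He]].
specialize (Hp c Hcc). nra.
Qed.

Lemma derive_pos_lt (f df : R -> R) (a b : R) :
  a < b ->
  (forall x, a <= x <= b -> continuous f x) ->
  (forall x, a < x < b -> is_derive f x (df x)) ->
  (forall x, a < x < b -> 0 < df x) ->
  f a < f b.
Proof.
intros Hab Hc Hd Hp.
destruct (MVT_open f df a b Hab Hc Hd) as [c [Hcc He]].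
specialize (Hp c Hcc). nra.
Qed.

Lemma derive_zero_eq (f : R -> R) (a b : R) :
  a <= b ->
  (forall x, a <= x <= b -> continuous f x) ->
  (forall x, a < x < b -> is_derive f x 0) ->
  f a = f b.
Proof.
intros [Hab|<-] Hc Hd; [|reflexivity].
destruct (MVT_open f (fun _ => 0) a b Hab Hc Hd) as [c [Hcc He]]. lra.
Qed.

Lemma continuous_pos_near (f : R -> R) (x : R) :
  continuous f x -> 0 < f x ->
  exists d, 0 < d /\ forall y, Rabs (y - x) < d -> 0 < f y.
Proof.
intros Hc Hp.
assert (H := Hc (fun y => 0 < y)).
destruct H as [d Hd].
- exists (mkposreal _ Hp). intros y Hy.
  unfold ball in Hy; simpl in Hy. unfold AbsRing_ball, abs, minus, plus, opp in Hy. simpl in Hy.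
  apply Rabs_lt_between in Hy. lra.
- exists d. split; [apply cond_pos|]. intros y Hy. now apply Hd.
Qed.

(** The zero is the supremum of the points up to which [f] stays positive. *)
Lemma first_zero (f : R -> R) (a b : R) :
  a < b -> (forall x, a <= x <= b -> continuous f x) ->
  0 < f a -> f b <= 0 ->
  exists c, a < c <= b /\ f c = 0 /\ forall x, a <= x < c -> 0 < f x.
Proof.
intros Hab Hc Ha Hb.
set (S := fun x => a <= x <= b /\ forall t, a <= t <= x -> 0 < f t).
destruct (completeness S) as [c [Hub Hlub]].
{ exists b. intros x [Hx _]. lra. }
{ exists a. split; [lra|]. intros t Ht. replace t with a by lra. exact Ha. }
assert (Hac : a <= c). { apply Hub. split; [lra|]. intros t Ht. replace t with a by lra. exact Ha. }
assert (Hcb : c <= b). { apply Hlub. intros x [Hx _]. lra. }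
assert (Hbelow : forall x, a <= x < c -> 0 < f x).
{ intros x Hx. destruct (Rlt_or_le 0 (f x)) as [|Hn]; [assumption|exfalso].
  assert (c <= x); [|lra]. apply Hlub. intros y [Hy Hy2].
  destruct (Rle_or_lt y x) as [|Hlt]; [assumption|].
  specialize (Hy2 x). lra. }
assert (Hnp : f c <= 0).
{ destruct (Rle_or_lt (f c) 0) as [|Hp]; [assumption|exfalso].
  destruct (Req_dec c b) as [->|Hne]; [lra|].
  destruct (continuous_pos_near f c (Hc c (conj Hac Hcb)) Hp) as [d [Hd Hnear]].
  set (e := Rmin (c + d / 2) b).
  assert (He : c < e <= b). { unfold e. split; [apply Rmin_glb_lt; lra|apply Rmin_r]. }
  assert (He2 : e <= c + d / 2) by apply Rmin_l.
  assert (e <= c); [|lra]. apply Hub. split; [lra|].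
  intros t Ht. destruct (Rlt_or_le t c); [apply Hbelow; lra|].
  apply Hnear. rewrite Rabs_pos_eq; lra. }
assert (Hnn : 0 <= f c).
{ destruct (Rle_or_lt 0 (f c)) as [|Hp]; [assumption|exfalso].
  destruct (continuous_pos_near (fun x => - f x) c) as [d [Hd Hnear]].
  - apply (continuous_opp f). apply Hc. lra.
  - lra.
  - destruct (Req_dec a c) as [<-|Hne]; [lra|].
    set (e := Rmax (c - d / 2) a).
    assert (a <= e < c). { unfold e. split; [apply Rmax_r|apply Rmax_lub_lt; lra]. }
    assert (c - d / 2 <= e) by apply Rmax_l.
    specialize (Hbelow e). specialize (Hnear e). rewrite Rabs_left in Hnear by lra. lra. }
exists c. split; [|split; [lra|exact Hbelow]].
split; [|exact Hcb]. destruct (Req_dec a c) as [<-|Hne]; lra.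
Qed.

Lemma last_zero (f : R -> R) (a b : R) :
  a < b -> (forall x, a <= x <= b -> continuous f x) ->
  f a <= 0 -> 0 < f b ->
  exists c, a <= c < b /\ f c = 0 /\ forall x, c < x <= b -> 0 < f x.
Proof.
intros Hab Hc Ha Hb.
destruct (first_zero (fun x => f (- x)) (- b) (- a)) as [c [Hc1 [Hc2 Hc3]]].
- lra.
- intros x Hx. apply (continuous_comp Ropp f).
  + apply (continuous_opp (fun x : R => x)), continuous_id.
  + apply Hc. lra.
- rewrite Ropp_involutive. exact Hb.
- rewrite Ropp_involutive. exact Ha.
- exists (- c). split; [lra|]. split; [exact Hc2|].
  intros x Hx. rewrite <- (Ropp_involutive x). apply Hc3. lra.
Qed.

Lemma IVT_value (f : R -> R) (v a b : R) :
  a <= b -> (forall x, a <= x <= b -> continuous f x) ->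
  f a <= v <= f b \/ f b <= v <= f a -> exists c, a <= c <= b /\ f c = v.
Proof.
intros Hab Hc Hv.
destruct (Req_dec (f a) v) as [|Ha]; [exists a; split; [lra|assumption]|].
destruct (Req_dec a b) as [<-|Hne]; [lra|].
destruct Hv as [Hv|Hv].
- destruct (first_zero (fun x => v - f x) a b) as [c [Hc1 [Hc2 _]]]; try lra.
  + intros x Hx. apply (continuous_minus (fun _ => v) f); [apply continuous_const|now apply Hc].
  + exists c. split; lra.
- destruct (first_zero (fun x => f x - v) a b) as [c [Hc1 [Hc2 _]]]; try lra.
  + intros x Hx. apply (continuous_minus f (fun _ => v)); [now apply Hc|apply continuous_const].
  + exists c. split; lra.
Qed.

Lemma derive_pos_local (f : R -> R) (x d : R) :
  is_derive f x d -> f x = 0 -> 0 < d ->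
  exists e, 0 < e /\ (forall y, x < y < x + e -> 0 < f y) /\ (forall y, x - e < y < x -> f y < 0).
Proof.
intros Hd H0 Hp. apply is_derive_Reals in Hd.
destruct (Hd (d / 2)) as [e He]; [lra|].
exists e. split; [apply cond_pos|].
assert (Hq : forall y, y <> x -> Rabs (y - x) < e -> 0 < f y / (y - x)).
{ intros y Hy Hy2. specialize (He (y - x)). rewrite H0 in He.
  replace (x + (y - x)) with y in He by lra.
  rewrite Rminus_0_r in He.
  assert (Hab := He ltac:(lra) Hy2). apply Rabs_lt_between in Hab. lra. }
split; intros y Hy.
- assert (H := Hq y ltac:(lra)). rewrite Rabs_pos_eq in H by lra.
  specialize (H ltac:(lra)).
  replace (f y) with (f y / (y - x) * (y - x)) by (field; lra).
  apply Rmult_lt_0_compat; lra.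
- assert (H := Hq y ltac:(lra)). rewrite Rabs_left in H by lra.
  specialize (H ltac:(lra)).
  replace (f y) with (f y / (y - x) * (y - x)) by (field; lra).
  nra.
Qed.

Lemma continuous_div (f g : R -> R) (x : R) :
  continuous f x -> continuous g x -> g x <> 0 -> continuous (fun t => f t / g t) x.
Proof.
intros Hf Hg H0. apply (continuous_mult f (fun t => / g t)); [exact Hf|].
now apply continuous_Rinv_comp.
Qed.

Lemma continuous_ln_comp (f : R -> R) (x : R) :
  continuous f x -> 0 < f x -> continuous (fun t => ln (f t)) x.
Proof.
intros Hf H0. apply (continuous_comp f ln); [exact Hf|].
apply (ex_derive_continuous (V := R_NormedModule)). exists (/ f x).
now apply is_derive_Reals, derivable_pt_lim_ln.
Qed.

Lemma continuous_atan_comp (f : R -> R) (x : R) :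
  continuous f x -> continuous (fun t => atan (f t)) x.
Proof.
intros Hf. apply (continuous_comp f atan); [exact Hf|].
apply (ex_derive_continuous (V := R_NormedModule)). exists (/ (1 + f x ^ 2)).
apply is_derive_Reals, derivable_pt_lim_atan.
Qed.

Lemma continuous_cos_comp (f : R -> R) (x : R) :
  continuous f x -> continuous (fun t => cos (f t)) x.
Proof. intros Hf. apply (continuous_comp f cos); [exact Hf|apply continuous_cos]. Qed.

Lemma continuous_sin_comp (f : R -> R) (x : R) :
  continuous f x -> continuous (fun t => sin (f t)) x.
Proof. intros Hf. apply (continuous_comp f sin); [exact Hf|apply continuous_sin]. Qed.

Ltac cont_step :=
  match goal with
  | |- continuous (fun _ => ?c) _ => apply continuous_const
  | |- continuous (fun t => t) _ => apply continuous_id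
  | |- continuous (fun t => @?f t + @?g t) _ => apply (continuous_plus f g)
  | |- continuous (fun t => @?f t - @?g t) _ => apply (continuous_minus f g)
  | |- continuous (fun t => @?f t * @?g t) _ => apply (continuous_mult f g)
  | |- continuous (fun t => @?f t / @?g t) _ => apply (continuous_div f g)
  | |- continuous (fun t => / @?g t) _ => apply (continuous_Rinv_comp g)
  | |- continuous (fun t => - @?f t) _ => apply (continuous_opp f)
  | |- continuous (fun t => (@?f t) ^ S ?n) _ => apply (continuous_mult f (fun t => f t ^ n))
  | |- continuous (fun t => (@?f t) ^ 0) _ => apply continuous_const
  | |- continuous (fun t => ln (@?f t)) _ => apply (continuous_ln_comp f)
  | |- continuous (fun t => atan (@?f t)) _ => apply (continuous_atan_comp f)
  | |- continuous (fun t => cos (@?f t)) _ => apply (continuous_cos_comp f)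
  | |- continuous (fun t => sin (@?f t)) _ => apply (continuous_sin_comp f)
  end.
Ltac cont := repeat (first [assumption | cont_step]).

(* Rewrites the eta-expanded [Derive] left by [auto_derive]. *)
Ltac derive_with H :=
  match type of H with
  | is_derive ?f ?x ?d =>
    replace (Derive (fun t : R => f t) x) with d by (symmetry; apply is_derive_unique; exact H)
  end.

(** Retraction of the line onto a segment. Composition with it extends functions continuously to all
    of R, as the records [arc] and [shrinker] ask, without changing derivatives at interior
    points. *)
Definition clamp (a b x : R) := Rmax a (Rmin x b).

Lemma clamp_in a b x : a <= b -> a <= clamp a b x <= b.
Proof.
intros H. unfold clamp. split; [apply Rmax_l|]. apply Rmax_lub; [exact H|apply Rmin_r].
Qed.

Lemma clamp_id a b x : a <= x <= b -> clamp a b x = x.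
Proof.
intros H. unfold clamp. rewrite Rmin_left, Rmax_right; lra.
Qed.

Lemma clamp_lip a b x y : Rabs (clamp a b x - clamp a b y) <= Rabs (x - y).
Proof.
unfold clamp, Rmax, Rmin. repeat destruct Rle_dec; unfold Rabs; repeat destruct Rcase_abs; lra.
Qed.

(** The preimage is chosen at the clamped value, so that [g] is defined and continuous on all of R
    and stays in the segment even outside the range of [f]. *)
Lemma inverse_function (f df : R -> R) (a b : R) :
  a < b ->
  (forall x, a <= x <= b -> continuous f x) ->
  (forall x, a < x < b -> is_derive f x (df x)) ->
  (forall x, a < x < b -> 0 < df x) ->
  exists g : R -> R,
    (forall y, continuous g y) /\
    (forall y, a <= g y <= b) /\
    (forall y, f a <= y <= f b -> f (g y) = y) /\
    (forall x, a <= x <= b -> g (f x) = x) /\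
    (forall y, f a < y < f b -> is_derive g y (/ df (g y))).
Proof.
intros Hab Hc Hd Hp.
assert (Hinc : forall x y, a <= x -> x < y -> y <= b -> f x < f y).
{ intros x y Hx Hxy Hy. apply (derive_pos_lt f df); [exact Hxy|intros; apply Hc; lra|..].
  - intros; apply Hd; lra.
  - intros; apply Hp; lra. }
assert (Hfab := Hinc a b ltac:(lra) Hab ltac:(lra)).
assert (Hsel : forall y, exists x, a <= x <= b /\ f x = clamp (f a) (f b) y).
{ intros y. apply IVT_value; [lra|exact Hc|]. left. apply clamp_in. lra. }
destruct (functional_choice _ Hsel) as [g Hg].
assert (Hgf : forall x, a <= x <= b -> g (f x) = x).
{ intros x Hx. destruct (Hg (f x)) as [Hgx Heq].
  assert (f a <= f x). { destruct (Req_dec a x) as [<-|]; [lra|]. left. apply Hinc; lra. }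
  assert (f x <= f b). { destruct (Req_dec x b) as [->|]; [lra|]. left. apply Hinc; lra. }
  rewrite clamp_id in Heq by lra.
  destruct (Rtotal_order (g (f x)) x) as [Hlt|[He|Hlt]]; [|exact He|].
  - specialize (Hinc (g (f x)) x). lra.
  - specialize (Hinc x (g (f x))). lra. }
assert (Hgc : forall y, continuous g y).
{ intros y. apply continuity_pt_filterlim. intros e He.
  destruct (Hg y) as [Hgy Heq].
  assert (H1 : exists d, 0 < d /\ forall y', Rabs (y' - y) < d -> g y' < g y + e).
  { destruct (Rle_or_lt (g y + e) b) as [Hle|Hgt].
    - exists (f (g y + e) - f (g y)). assert (Hi := Hinc (g y) (g y + e) ltac:(lra) ltac:(lra) Hle).
      split; [lra|]. intros y' Hy'. destruct (Hg y') as [Hgy' Heq'].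
      destruct (Rlt_or_le (g y') (g y + e)) as [|Hge]; [assumption|exfalso].
      assert (f (g y + e) <= f (g y')).
      { destruct Hge as [Hge| <-]; [left; apply Hinc; lra|lra]. }
      assert (Hl := clamp_lip (f a) (f b) y' y). rewrite <- Heq, <- Heq' in Hl.
      rewrite Rabs_pos_eq in Hl by lra. lra.
    - exists 1. split; [lra|]. intros y' _. destruct (Hg y'). lra. }
  assert (H2 : exists d, 0 < d /\ forall y', Rabs (y' - y) < d -> g y - e < g y').
  { destruct (Rle_or_lt a (g y - e)) as [Hle|Hgt].
    - exists (f (g y) - f (g y - e)). assert (Hi := Hinc (g y - e) (g y) Hle ltac:(lra) ltac:(lra)).
      split; [lra|]. intros y' Hy'. destruct (Hg y') as [Hgy' Heq'].
      destruct (Rlt_or_le (g y - e) (g y')) as [|Hge]; [assumption|exfalso].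
      assert (f (g y') <= f (g y - e)).
      { destruct Hge as [Hge| ->]; [left; apply Hinc; lra|lra]. }
      assert (Hl := clamp_lip (f a) (f b) y' y). rewrite <- Heq, <- Heq' in Hl.
      rewrite Rabs_left in Hl by lra. lra.
    - exists 1. split; [lra|]. intros y' _. destruct (Hg y'). lra. }
  destruct H1 as [d1 [Hd1 H1]], H2 as [d2 [Hd2 H2]].
  exists (Rmin d1 d2). split; [apply Rmin_glb_lt; assumption|].
  intros y' [_ Hy']. simpl in *. unfold R_dist in *.
  assert (Hm1 := Rmin_l d1 d2). assert (Hm2 := Rmin_r d1 d2).
  specialize (H1 y' ltac:(lra)). specialize (H2 y' ltac:(lra)).
  apply Rabs_def1; lra. }
assert (Hfg : forall y, f a <= y <= f b -> f (g y) = y).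
{ intros y Hy. destruct (Hg y) as [_ Heq]. rewrite clamp_id in Heq by exact Hy. exact Heq. }
assert (Hgab : forall y, a <= g y <= b) by (intros y; apply Hg).
exists g. split; [exact Hgc|]. split; [exact Hgab|]. split; [exact Hfg|]. split; [exact Hgf|].
intros y Hy.
assert (Hgi : forall y1 y2, f a <= y1 -> y1 < y2 -> y2 <= f b -> g y1 < g y2).
{ intros y1 y2 H1 H12 H2. assert (Hr1 := Hgab y1). assert (He1 := Hfg y1 ltac:(lra)). assert (Hr2 := Hgab y2). assert (He2 := Hfg y2 ltac:(lra)).
  destruct (Rlt_or_le (g y1) (g y2)) as [Hlt|[Hgt|Heq]]; [assumption|exfalso|exfalso].
  - specialize (Hinc (g y2) (g y1)). lra.
  - rewrite Heq in He2. lra. }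
assert (Hga : g (f a) = a) by (apply Hgf; lra). assert (Hgb : g (f b) = b) by (apply Hgf; lra).
set (lb := (f a + y) / 2). set (ub := (y + f b) / 2).
assert (Hlb := Hgi (f a) lb). assert (Hlb2 := Hgi lb y). assert (Hub := Hgi y ub). assert (Hub2 := Hgi ub (f b)).
assert (Hin : a < g lb /\ g lb < g y /\ g y < g ub /\ g ub < b) by (unfold lb, ub in *; lra).
assert (Prf : forall x, g lb <= x <= g ub -> derivable_pt f x).
{ intros x Hx. exists (df x). apply is_derive_Reals, Hd. lra. }
assert (Prg : continuity_pt g y) by (apply continuity_pt_filterlim, Hgc).
assert (Pri : g lb <= g y <= g ub) by lra.
assert (Hdp : derive_pt f (g y) (Prf (g y) Pri) = df (g y)).
{ apply derive_pt_eq_0, is_derive_Reals, Hd. lra. }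
apply is_derive_Reals.
replace (/ df (g y)) with (1 / derive_pt f (g y) (Prf (g y) Pri)) by (rewrite Hdp; unfold Rdiv; ring).
apply derivable_pt_lim_recip_interv with lb ub.
- exact Prg.
- unfold lb, ub. lra.
- unfold lb, ub. lra.
- intros x Hx. unfold comp, id. apply Hfg. unfold lb, ub in Hx. lra.
- rewrite Hdp. assert (0 < df (g y)) by (apply Hp; lra). lra.
Qed.

Lemma ge_at_left_end (f : R -> R) (c p e : R) :
  p < e -> continuous f p -> (forall x, p < x < e -> c <= f x) -> c <= f p.
Proof.
intros Hpe Hc H. destruct (Rle_or_lt c (f p)) as [|Hlt]; [assumption|exfalso].
destruct (continuous_pos_near (fun t => c - f t) p) as [d [Hd Hn]].
- cont.
- lra.
- set (t := Rmin (p + d / 2) ((p + e) / 2)).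
  assert (p < t) by (apply Rmin_glb_lt; lra).
  assert (t <= p + d / 2) by apply Rmin_l. assert (t <= (p + e) / 2) by apply Rmin_r.
  specialize (H t ltac:(lra)). specialize (Hn t). rewrite Rabs_pos_eq in Hn by lra. specialize (Hn ltac:(lra)). lra.
Qed.

(** * Shrinking curves in polar coordinates *)

(* An arc with k > 0 in terms of the polar angle: rho = |gamma|^2, z = g / k. *)
Record arc (a b : R) (rho z : R -> R) : Prop := {
  arc_lt : a < b;
  arc_crho : forall x, continuous rho x;
  arc_cz : forall x, continuous z x;
  arc_pos : forall x, a <= x <= b -> 0 < rho x;
  arc_drho : forall x, a < x < b -> is_derive rho x (2 * rho x * z x);
  arc_dz : forall x, a < x < b -> is_derive z x ((1 + z x ^ 2) * (1 - rho x)) }.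

Lemma is_derive_opp_arg (f : R -> R) (x d : R) :
  is_derive f (- x) d -> is_derive (fun t => f (- t)) x (- d).
Proof.
intros H. evar_last.
- apply (is_derive_comp f Ropp x); [exact H|].
  apply (is_derive_opp (fun t : R => t)), is_derive_id.
- unfold scal, opp, one; simpl. unfold mult; simpl. ring.
Qed.

(** Reflection in the horizontal axis combined with reversal of direction: the polar angle and z
    change sign, k stays positive. It turns statements about the approach to a maximum of the radius
    into statements about the departure from it. *)
Lemma arc_opp a b rho z :
  arc a b rho z -> arc (- b) (- a) (fun x => rho (- x)) (fun x => - z (- x)).
Proof.
intros [H1 H2 H3 H4 H5 H6].
assert (Hc : forall f : R -> R, (forall x : R, continuous f x) -> forall x : R, continuous (fun t => f (- t)) x).
{ intros f Hf x. apply (continuous_comp Ropp f); [|apply Hf].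
  apply (continuous_opp (fun t : R => t)), continuous_id. }
split.
- lra.
- now apply Hc.
- intros x. apply (continuous_opp (fun t => z (- t))). now apply Hc.
- intros x Hx. apply H4. lra.
- intros x Hx. specialize (H5 (- x) ltac:(lra)).
  evar_last; [apply is_derive_opp_arg, H5|ring].
- intros x Hx. specialize (H6 (- x) ltac:(lra)).
  evar_last; [apply (is_derive_opp (fun t => z (- t))), is_derive_opp_arg, H6|].
  unfold opp; simpl. ring.
Qed.

(* The tangent angle, up to a constant. *)
Definition theta (z : R -> R) (x : R) := x - atan (z x).

Definition energy (rho z : R -> R) (x : R) := rho x - ln (rho x) + ln (1 + z x ^ 2).

Lemma one_plus_sq_pos (x : R) : 0 < 1 + x ^ 2.
Proof. nra. Qed.

Lemma is_derive_atan_comp f x d :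
  is_derive f x d -> is_derive (fun t => atan (f t)) x (d / (1 + f x ^ 2)).
Proof.
intros H. evar_last.
- apply (is_derive_comp atan f x); [|exact H].
  apply is_derive_Reals, derivable_pt_lim_atan.
- unfold scal; simpl; unfold mult; simpl. field. generalize (one_plus_sq_pos (f x)). intros; nra.
Qed.

Lemma is_derive_div_const (f : R -> R) (x d c : R) :
  is_derive f x d -> is_derive (fun t => f t / c) x (d / c).
Proof.
intros H. apply (is_derive_ext (fun t => scal (/ c) (f t))).
- intros t. unfold scal; simpl. unfold mult; simpl. unfold Rdiv. ring.
- evar_last; [apply (is_derive_scal f x (/ c) d H)|].
  unfold Rdiv. ring.
Qed.

(** In arclength theta_s = k and phi_s = k / rho. *)
Lemma theta_derive a b rho z x :
  arc a b rho z -> a < x < b -> is_derive (theta z) x (rho x).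
Proof.
intros H Hx. unfold theta. evar_last.
- apply (is_derive_minus (fun t => t) (fun t => atan (z t))).
  + apply is_derive_id.
  + apply is_derive_atan_comp, (arc_dz _ _ _ _ H x Hx).
- unfold minus, plus, opp, one; simpl. field. generalize (one_plus_sq_pos (z x)). intros; nra.
Qed.

Lemma theta_continuous a b rho z x : arc a b rho z -> continuous (theta z) x.
Proof.
intros H. unfold theta. pose proof (arc_cz _ _ _ _ H x). cont.
Qed.

Lemma theta_lt a b rho z x y :
  arc a b rho z -> a <= x -> x < y -> y <= b -> theta z x < theta z y.
Proof.
intros H Hx Hxy Hy. apply (derive_pos_lt _ rho); [exact Hxy|..].
- intros t _. eapply theta_continuous, H.
- intros t Ht. apply (theta_derive a b); [exact H|lra].
- intros t Ht. apply (arc_pos _ _ _ _ H). lra.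
Qed.

Lemma energy_const a b rho z x y :
  arc a b rho z -> a <= x <= b -> a <= y <= b -> energy rho z x = energy rho z y.
Proof.
assert (Hle : forall x y, arc a b rho z -> a <= x -> x <= y -> y <= b -> energy rho z x = energy rho z y).
{ clear x y. intros x y H Hx Hxy Hy. apply derive_zero_eq; [exact Hxy|..].
  - intros t Ht. unfold energy.
    pose proof (arc_cz _ _ _ _ H t). pose proof (arc_crho _ _ _ _ H t).
    assert (0 < rho t) by (apply (arc_pos _ _ _ _ H); lra).
    pose proof (one_plus_sq_pos (z t)). cont.
  - intros t Ht. unfold energy.
    assert (Hr : 0 < rho t) by (apply (arc_pos _ _ _ _ H); lra).
    assert (Hd1 : is_derive rho t (2 * rho t * z t)) by (apply (arc_drho _ _ _ _ H); lra).
    assert (Hd2 : is_derive z t ((1 + z t ^ 2) * (1 - rho t))) by (apply (arc_dz _ _ _ _ H); lra).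
    pose proof (one_plus_sq_pos (z t)).
    auto_derive.
    + repeat split; try (eexists; eassumption); try assumption; nra.
    + derive_with Hd1. derive_with Hd2. field. nra. }
intros H Hx Hy. destruct (Rle_or_lt x y).
- apply Hle; tauto || lra.
- symmetry. apply Hle; tauto || lra.
Qed.

Lemma ln_le_sub1 x : 0 < x -> ln x <= x - 1.
Proof.
intros Hx. generalize (exp_ineq1_le (ln x)). rewrite exp_ln by assumption. lra.
Qed.

Lemma ln_lt_sub1 x : 0 < x -> x <> 1 -> ln x < x - 1.
Proof.
intros Hx Hne.
assert (ln x <> 0). { intros H. apply Hne. rewrite <- (exp_ln x), H by assumption. apply exp_0. }
generalize (exp_ineq1 (ln x)). rewrite exp_ln by assumption. intros Hi. specialize (Hi H). lra.
Qed.

Lemma ln_1psq_nonneg x : 0 <= ln (1 + x ^ 2).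
Proof.
destruct (Req_dec x 0) as [->|Hx].
- replace (1 + 0 ^ 2) with 1 by ring. rewrite ln_1. lra.
- rewrite <- ln_1. left. apply ln_increasing; [lra|]. assert (0 < x ^ 2) by (apply pow2_gt_0; assumption). lra.
Qed.

Lemma ln_1psq_pos x : x <> 0 -> 0 < ln (1 + x ^ 2).
Proof.
intros Hx. rewrite <- ln_1. apply ln_increasing; [lra|]. assert (0 < x ^ 2) by (apply pow2_gt_0; assumption). lra.
Qed.

Lemma energy_at_zero rho z x : z x = 0 -> energy rho z x = rho x - ln (rho x).
Proof.
intros Hz. unfold energy. rewrite Hz. replace (1 + 0 ^ 2) with 1 by ring. rewrite ln_1. ring.
Qed.

Lemma energy_ge rho z x : rho x - ln (rho x) <= energy rho z x.
Proof. unfold energy. generalize (ln_1psq_nonneg (z x)). lra. Qed.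

(** At a zero of z the energy is [r - ln r], with minimum at [r = 1]. Minima of the radius lie on
    this decreasing branch, maxima on the increasing one of [sub_ln_incr]. *)
Lemma sub_ln_decr r s : 0 < r -> r < s -> s <= 1 -> s - ln s < r - ln r.
Proof.
intros Hr Hrs Hs. assert (H := ln_lt_sub1 (r / s)).
assert (0 < r / s) by (apply Rdiv_lt_0_compat; lra).
assert (r / s < 1) by (apply (Rdiv_lt_1 r s); lra).
rewrite ln_div in H by lra. specialize (H H0 ltac:(lra)).
assert (r / s - 1 <= r - s); [|lra].
replace (r / s - 1) with ((r - s) * / s) by (field; lra).
assert (1 <= / s). { rewrite <- Rinv_1. apply Rinv_le_contravar; lra. }
nra.
Qed.

Lemma sub_ln_incr r s : 1 <= r -> r < s -> r - ln r < s - ln s.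
Proof.
intros Hr Hrs. assert (H := ln_lt_sub1 (s / r)).
assert (1 < s / r). { apply (Rmult_lt_reg_r r); [lra|]. replace (s / r * r) with s by (field; lra). lra. }
rewrite ln_div in H by lra. specialize (H ltac:(lra) ltac:(lra)).
assert (s / r - 1 <= s - r); [|lra].
replace (s / r - 1) with ((s - r) * / r) by (field; lra).
assert (/ r <= 1). { rewrite <- Rinv_1. apply Rinv_le_contravar; lra. }
nra.
Qed.

(** The state [z = 0], [rho = 1] is the unit circle. It is the strict minimum of the conserved
    energy, so an arc passing through it never leaves it. *)
Lemma arc_no_rest a b rho z x y :
  arc a b rho z -> a <= x <= b -> a <= y <= b -> z x = 0 -> rho x = 1 -> z y = 0.
Proof.
intros H Hx Hy Hz Hr.
assert (He := energy_const _ _ _ _ _ _ H Hx Hy).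
rewrite energy_at_zero in He by assumption. rewrite Hr, ln_1 in He.
destruct (Req_dec (z y) 0) as [|Hne]; [assumption|exfalso].
assert (Hp := ln_1psq_pos _ Hne). unfold energy in He.
assert (Hl := ln_le_sub1 _ (arc_pos _ _ _ _ H y Hy)). lra.
Qed.

(* A zero of z reached from z > 0 is a strict maximum of rho. *)
Lemma rho_gt1_at_max a b rho z p q :
  arc a b rho z -> a <= p -> p < q -> q < b -> (forall x, p <= x < q -> 0 < z x) -> z q = 0 ->
  1 < rho q.
Proof.
intros H Hp Hpq Hq Hpos Hz.
destruct (Rlt_or_le 1 (rho q)) as [|Hle]; [assumption|exfalso].
destruct (Req_dec (rho q) 1) as [He|Hne].
- specialize (Hpos p ltac:(lra)).
  assert (z p = 0) by (apply (arc_no_rest a b rho z q p); try assumption; lra). lra.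
(* If [rho q < 1], then z' = 1 - rho is positive at [q], and z would be negative just before [q]. *)
- destruct (derive_pos_local z q _ (arc_dz _ _ _ _ H q ltac:(lra)) Hz) as [e [He [_ Hn]]].
  + rewrite Hz. lra.
  + set (y := Rmax p (q - e / 2)).
    assert (p <= y < q) by (unfold y; split; [apply Rmax_l|apply Rmax_lub_lt; lra]).
    assert (q - e / 2 <= y) by apply Rmax_r.
    specialize (Hpos y ltac:(lra)). specialize (Hn y ltac:(lra)). lra.
Qed.

Lemma rho_lt1_at_min a b rho z p q :
  arc a b rho z -> a < p -> p < q -> q <= b -> (forall x, p < x <= q -> 0 < z x) -> z p = 0 ->
  rho p < 1.
Proof.
intros H Hp Hpq Hq Hpos Hz.
destruct (Rlt_or_le (rho p) 1) as [|Hle]; [assumption|exfalso].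
destruct (Req_dec (rho p) 1) as [He|Hne].
- specialize (Hpos q ltac:(lra)).
  assert (z q = 0) by (apply (arc_no_rest a b rho z p q); try assumption; lra). lra.
- assert (Hd := arc_dz _ _ _ _ H p ltac:(lra)). apply is_derive_opp in Hd.
  destruct (derive_pos_local (fun x => - z x) p _ Hd) as [e [He [Hn _]]].
  + rewrite Hz. ring.
  + unfold opp; simpl. rewrite Hz. lra.
  + set (y := Rmin q (p + e / 2)).
    assert (p < y <= q) by (unfold y; split; [apply Rmin_glb_lt; lra|apply Rmin_l]).
    assert (y <= p + e / 2) by apply Rmin_r.
    specialize (Hpos y ltac:(lra)). specialize (Hn y ltac:(lra)). simpl in Hn. lra.
Qed.

(** * The descent of y to a maximum of the radius *)

(* [kap] is 1 / k^2, and [yv] is the logarithmic derivative of k^(1/3) k_theta. *)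
Definition kap (rho z : R -> R) (x : R) := (1 + z x ^ 2) / rho x.
Definition yv (rho z : R -> R) (x : R) := z x / 3 + (kap rho z x - 1) / z x.
(* The energy in the coordinates (y, z). *)
Definition Hyz (y z : R) := (1 + z ^ 2) / (1 + y * z - z ^ 2 / 3) + ln (1 + y * z - z ^ 2 / 3).

Lemma yv_kap rho z x : z x <> 0 -> 1 + yv rho z x * z x - z x ^ 2 / 3 = kap rho z x.
Proof. intros H. unfold yv. field. exact H. Qed.

Lemma energy_Hyz rho z x : 0 < rho x -> z x <> 0 -> energy rho z x = Hyz (yv rho z x) (z x).
Proof.
intros Hr Hz. unfold Hyz. rewrite yv_kap by assumption. unfold kap, energy.
pose proof (one_plus_sq_pos (z x)).
rewrite ln_div by assumption. field. split; nra.
Qed.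

Lemma yv_continuous a b rho z x :
  arc a b rho z -> a <= x <= b -> z x <> 0 -> continuous (yv rho z) x.
Proof.
intros H Hx Hz. unfold yv, kap.
pose proof (arc_cz _ _ _ _ H x). pose proof (arc_crho _ _ _ _ H x).
assert (0 < rho x) by (apply (arc_pos _ _ _ _ H); lra).
cont; lra.
Qed.

(** Riccati form of w'' = - (2 + 2/9 z^2) w for w = k^(1/3) k_theta. The terms in [kap] cancel, and
    the factor [rho] converts from theta to the polar angle. *)
Lemma yv_derive a b rho z x :
  arc a b rho z -> a < x < b -> z x <> 0 ->
  is_derive (yv rho z) x (- rho x * (2 + yv rho z x ^ 2 + 2 / 9 * z x ^ 2)).
Proof.
intros H Hx Hz.
assert (Hr : 0 < rho x) by (apply (arc_pos _ _ _ _ H); lra).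
assert (Hd1 := arc_drho _ _ _ _ H x Hx). assert (Hd2 := arc_dz _ _ _ _ H x Hx).
unfold yv, kap. auto_derive.
- repeat split; try (eexists; eassumption); try assumption; lra.
- derive_with Hd1. derive_with Hd2. field. split; lra.
Qed.

Lemma yv_lt a b rho z s t :
  arc a b rho z -> a <= s -> s < t -> t <= b -> (forall x, s <= x <= t -> 0 < z x) ->
  yv rho z t < yv rho z s.
Proof.
intros H Hs Hst Ht Hz.
enough (- yv rho z s < - yv rho z t) by lra.
apply (derive_pos_lt (fun x => - yv rho z x)
  (fun x => - (- rho x * (2 + yv rho z x ^ 2 + 2 / 9 * z x ^ 2)))); [exact Hst|..].
- intros x Hx. apply (continuous_opp (yv rho z)), (yv_continuous a b); [exact H|lra|].
  specialize (Hz x ltac:(lra)). lra.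
- intros x Hx. apply (is_derive_opp (yv rho z)), (yv_derive a b); [exact H|lra|].
  specialize (Hz x ltac:(lra)). lra.
- intros x Hx. assert (Hr : 0 < rho x) by (apply (arc_pos _ _ _ _ H); lra). nra.
Qed.

Lemma yv_decr a b rho z s t :
  arc a b rho z -> a <= s -> s <= t -> t <= b -> (forall x, s <= x <= t -> 0 < z x) ->
  yv rho z t <= yv rho z s.
Proof.
intros H Hs [Hst|<-] Ht Hz; [|lra]. left. now apply (yv_lt a b).
Qed.

(** At [q] the product of [yv] and z tends to 1 / rho - 1 < 0, while z tends to 0 from above. *)
Lemma yv_to_minf a b rho z p q M :
  arc a b rho z -> a <= p -> p < q -> q <= b -> (forall x, p <= x < q -> 0 < z x) -> z q = 0 ->
  1 < rho q -> exists x0, p < x0 < q /\ forall x, x0 <= x < q -> yv rho z x < M.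
Proof.
intros H Hp Hpq Hq Hz Hzq Hr.
set (f := fun x => M * z x - (z x ^ 2 / 3 + (kap rho z x - 1))).
destruct (continuous_pos_near f q) as [d [Hd Hf]].
- unfold f, kap. pose proof (arc_cz _ _ _ _ H q). pose proof (arc_crho _ _ _ _ H q).
  cont; lra.
- unfold f, kap. rewrite Hzq.
  assert (/ rho q < 1). { rewrite <- Rinv_1. apply Rinv_lt_contravar; lra. }
  unfold Rdiv. nra.
- exists (Rmax ((p + q) / 2) (q - d / 2)).
  assert (Hl := Rmax_l ((p + q) / 2) (q - d / 2)).
  assert (Hl2 := Rmax_r ((p + q) / 2) (q - d / 2)).
  split; [split; [lra|apply Rmax_lub_lt; lra]|].
  intros x Hx. assert (Hzx := Hz x ltac:(lra)).
  assert (Hfx : 0 < f x). { apply Hf. rewrite Rabs_left; lra. }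
  apply (Rmult_lt_reg_r (z x)); [exact Hzx|].
  replace (yv rho z x * z x) with (z x ^ 2 / 3 + (kap rho z x - 1)) by (unfold yv; field; lra).
  unfold f in Hfx. lra.
Qed.

Lemma yv_to_pinf a b rho z p q M :
  arc a b rho z -> a <= p -> p < q -> q <= b -> (forall x, p < x <= q -> 0 < z x) -> z p = 0 ->
  rho p < 1 -> exists x0, p < x0 < q /\ forall x, p < x <= x0 -> M < yv rho z x.
Proof.
intros H Hp Hpq Hq Hz Hzp Hr.
assert (Hr0 : 0 < rho p) by (apply (arc_pos _ _ _ _ H); lra).
set (f := fun x => (z x ^ 2 / 3 + (kap rho z x - 1)) - M * z x).
destruct (continuous_pos_near f p) as [d [Hd Hf]].
- unfold f, kap. pose proof (arc_cz _ _ _ _ H p). pose proof (arc_crho _ _ _ _ H p).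
  cont; lra.
- unfold f, kap. rewrite Hzp.
  assert (1 < / rho p). { rewrite <- Rinv_1. apply Rinv_lt_contravar; lra. }
  unfold Rdiv. nra.
- exists (Rmin ((p + q) / 2) (p + d / 2)).
  assert (Hl := Rmin_l ((p + q) / 2) (p + d / 2)).
  assert (Hl2 := Rmin_r ((p + q) / 2) (p + d / 2)).
  split; [split; [apply Rmin_glb_lt; lra|lra]|].
  intros x Hx. assert (Hzx := Hz x ltac:(lra)).
  assert (Hfx : 0 < f x). { apply Hf. rewrite Rabs_pos_eq; lra. }
  apply (Rmult_lt_reg_r (z x)); [exact Hzx|].
  replace (yv rho z x * z x) with (z x ^ 2 / 3 + (kap rho z x - 1)) by (unfold yv; field; lra).
  unfold f in Hfx. lra.
Qed.

(* Upper bound for [atan (sqrt m * d) / sqrt m], from 1 / (1 + t) <= 1 - t + t^2. *)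
Definition atan_poly (m d : R) := d - m * d ^ 3 / 3 + m ^ 2 * d ^ 5 / 5.

Lemma atan_poly_le m d1 d2 : 0 < m -> d1 <= d2 -> atan_poly m d1 <= atan_poly m d2.
Proof.
intros Hm Hd.
apply (derive_nonneg_le (atan_poly m) (fun d => 1 - m * d ^ 2 + m ^ 2 * d ^ 4)); [exact Hd|..].
- intros x _. unfold atan_poly. cont; lra.
- intros x _. unfold atan_poly. auto_derive; [exact I|field].
- intros x _. replace (1 - m * x ^ 2 + m ^ 2 * x ^ 4) with ((1 - m * x ^ 2 / 2) ^ 2 + 3 / 4 * (m * x ^ 2) ^ 2) by field.
  nra.
Qed.

Section descent.
Variables (a b p q : R) (rho z : R -> R).
Hypothesis Harc : arc a b rho z.
Hypothesis Hap : a <= p.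
Hypothesis Hpq : p < q.
Hypothesis Hqb : q < b.
Hypothesis Hz : forall x, p <= x < q -> 0 < z x.
Hypothesis Hzq : z q = 0.

Let Hrq : 1 < rho q.
Proof. exact (rho_gt1_at_max a b rho z p q Harc Hap Hpq Hqb Hz Hzq). Qed.

(* From any point with y <= Y, the maximum at q is at theta-distance at most c. *)
Definition theta_left_le (Y c : R) : Prop :=
  forall x, p <= x < q -> yv rho z x <= Y -> theta z q - theta z x <= c.

(** Comparison with dy/dtheta = - (m + y^2), whose solution takes the time (atan (y / sqrt m) - atan
    (Y / sqrt m)) / sqrt m. The subtraction formula merges the two arctangents into one with
    argument sqrt m * (y - Y) / (m + y Y), and [atan_poly] replaces it by a polynomial, so that
    numerical instances are rational. *)
Lemma cell_time (s t m Y : R) :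
  p <= s -> s < t -> t < q -> 0 < m -> 0 <= Y -> yv rho z t = Y ->
  (forall x, s <= x <= t -> m <= 2 + 2 / 9 * z x ^ 2) ->
  theta z t - theta z s <= atan_poly m ((yv rho z s - Y) / (m + yv rho z s * Y)).
Proof.
intros Hs Hst Ht Hm HY HYt Hmz.
assert (HYx : forall x, s <= x <= t -> Y <= yv rho z x).
{ intros x Hx. rewrite <- HYt. apply (yv_decr a b); try assumption; try lra.
  intros; apply Hz; lra. }
set (F := fun x => - (theta z x + atan_poly m ((yv rho z x - Y) / (m + yv rho z x * Y)))).
assert (HF : F s <= F t).
{ apply (derive_nonneg_le F (fun x => rho x *
   ((1 - m * ((yv rho z x - Y) / (m + yv rho z x * Y)) ^ 2
    + m ^ 2 * ((yv rho z x - Y) / (m + yv rho z x * Y)) ^ 4)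
     * ((m + Y ^ 2) / (m + yv rho z x * Y) ^ 2) * (2 + yv rho z x ^ 2 + 2 / 9 * z x ^ 2) - 1))).
  - lra.
  - intros x Hx. unfold F, atan_poly.
    pose proof (theta_continuous _ _ _ _ x Harc) as H1.
    assert (H2 : continuous (yv rho z) x).
    { apply (yv_continuous a b); [exact Harc|lra|]. specialize (Hz x ltac:(lra)). lra. }
    specialize (HYx x ltac:(lra)).
    assert (m + yv rho z x * Y <> 0) by nra.
    cont; lra.
  - intros x Hx.
    assert (H1 : is_derive (theta z) x (rho x)) by (apply (theta_derive a b); [exact Harc|lra]).
    assert (H2 : is_derive (yv rho z) x (- rho x * (2 + yv rho z x ^ 2 + 2 / 9 * z x ^ 2))).
    { apply (yv_derive a b); [exact Harc|lra|]. specialize (Hz x ltac:(lra)). lra. }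
    specialize (HYx x ltac:(lra)).
    assert (m + yv rho z x * Y <> 0) by nra.
    unfold F, atan_poly. auto_derive.
    + repeat split; try (eexists; eassumption); assumption.
    + derive_with H1. derive_with H2. field. assumption.
  - intros x Hx. specialize (HYx x ltac:(lra)). specialize (Hmz x ltac:(lra)).
    assert (Hr : 0 < rho x) by (apply (arc_pos _ _ _ _ Harc); lra).
    set (y := yv rho z x) in *. set (A := m + y * Y).
    assert (HA : 0 < A) by (unfold A; nra).
    apply Rmult_le_pos; [lra|].
    set (X := m * ((y - Y) / A) ^ 2).
    assert (HX : 0 <= X). { unfold X. apply Rmult_le_pos; [lra|apply pow2_ge_0]. }
    replace (m ^ 2 * ((y - Y) / A) ^ 4) with (X ^ 2) by (unfold X; ring).
    assert (HW : 1 + X <= (m + Y ^ 2) / A ^ 2 * (2 + y ^ 2 + 2 / 9 * z x ^ 2)).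
    { replace (1 + X) with ((m + Y ^ 2) / A ^ 2 * (m + y ^ 2)).
      - apply Rmult_le_compat_l; [|lra]. apply Rdiv_le_0_compat; nra.
      - unfold X, A. field. unfold A in HA. lra. }
    set (W := (m + Y ^ 2) / A ^ 2 * (2 + y ^ 2 + 2 / 9 * z x ^ 2)) in *.
    replace ((1 - X + X ^ 2) * ((m + Y ^ 2) / A ^ 2) * (2 + y ^ 2 + 2 / 9 * z x ^ 2))
      with ((1 - X + X ^ 2) * W) by (unfold W; ring).
    (* Since [W] is at least [1 + X], the goal follows from (1 - X + X^2) (1 + X) = 1 + X^3 >= 1. *)
    assert (0 < 1 - X + X ^ 2) by nra.
    assert (0 <= X ^ 3) by (apply pow_le; lra).
    nra. }
unfold F in HF. rewrite HYt in HF.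
replace (atan_poly m ((Y - Y) / (m + Y * Y))) with 0 in HF.
- lra.
- unfold atan_poly. rewrite Rminus_diag. unfold Rdiv. ring.
Qed.

Lemma hit_level (s Y : R) :
  p <= s < q -> Y < yv rho z s -> exists t, s < t < q /\ yv rho z t = Y.
Proof.
intros Hs HY.
destruct (yv_to_minf a b rho z s q Y) as [x0 [Hx0 Hlt]]; try assumption; try lra.
{ intros x Hx. apply Hz. lra. }
destruct (first_zero (fun x => yv rho z x - Y) s x0) as [t [Ht1 [Ht2 _]]].
- lra.
- intros x Hx. apply (continuous_minus (yv rho z) (fun _ => Y)); [|apply continuous_const].
  apply (yv_continuous a b); [exact Harc|lra|]. specialize (Hz x ltac:(lra)). lra.
- lra.
- specialize (Hlt x0 ltac:(lra)). lra.
- exists t. split; lra.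
Qed.

Lemma theta_left_step (Y Y' c m : R) :
  0 <= Y' -> Y' < Y -> 0 < m ->
  (forall x, p <= x < q -> Y' <= yv rho z x <= Y -> m <= 2 + 2 / 9 * z x ^ 2) ->
  theta_left_le Y' c -> theta_left_le Y (c + atan_poly m ((Y - Y') / (m + Y * Y'))).
Proof.
intros HY' HYY Hm Hmz Hc x Hx HxY.
assert (Hp0 : forall y, Y' <= y <= Y ->
  0 <= (y - Y') / (m + y * Y') <= (Y - Y') / (m + Y * Y')).
{ intros y Hy. assert (0 < m + y * Y') by nra. assert (0 < m + Y * Y') by nra. split.
  - apply Rdiv_le_0_compat; lra.
  - apply (Rmult_le_reg_r ((m + y * Y') * (m + Y * Y'))); [nra|].
    replace ((y - Y') / (m + y * Y') * ((m + y * Y') * (m + Y * Y'))) with ((y - Y') * (m + Y * Y')) by (field; lra).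
    replace ((Y - Y') / (m + Y * Y') * ((m + y * Y') * (m + Y * Y'))) with ((Y - Y') * (m + y * Y')) by (field; lra).
    nra. }
destruct (Rle_or_lt (yv rho z x) Y') as [Hle|Hlt].
- specialize (Hc x Hx Hle).
  assert (H := atan_poly_le m _ _ Hm (Rle_trans _ _ _ (proj1 (Hp0 Y ltac:(lra))) (proj2 (Hp0 Y ltac:(lra))))).
  assert (atan_poly m 0 = 0) by (unfold atan_poly; field). lra.
- destruct (hit_level x Y' Hx Hlt) as [t [Ht HYt]].
  assert (H := cell_time x t m Y' ltac:(lra) ltac:(lra) ltac:(lra) Hm HY' HYt).
  assert (Hmz' : forall s, x <= s <= t -> m <= 2 + 2 / 9 * z s ^ 2).
  { intros s Hs. apply Hmz; [lra|]. split.
    - rewrite <- HYt. apply (yv_decr a b); try assumption; try lra. intros; apply Hz; lra.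
    - apply Rle_trans with (yv rho z x); [|exact HxY].
      apply (yv_decr a b); try assumption; try lra. intros; apply Hz; lra. }
  specialize (H Hmz'). specialize (Hc t ltac:(lra) ltac:(lra)).
  assert (H2 := atan_poly_le m _ _ Hm (proj2 (Hp0 (yv rho z x) ltac:(lra)))). lra.
Qed.

(** For an initial y without upper bound: [(Y - Y') / (m + Y * Y')] stays below [/ Y'] whatever [Y]
    is. *)
Lemma theta_left_last (Y' c m : R) :
  0 < Y' -> 0 < m <= 2 -> theta_left_le Y' c ->
  forall x, p <= x < q -> theta z q - theta z x <= c + atan_poly m (/ Y').
Proof.
intros HY' Hm Hc x Hx.
destruct (Rle_or_lt (yv rho z x) Y') as [Hle|Hlt].
- specialize (Hc x Hx Hle).
  assert (H := atan_poly_le m 0 (/ Y') (proj1 Hm)).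
  assert (0 < / Y') by now apply Rinv_0_lt_compat.
  assert (atan_poly m 0 = 0) by (unfold atan_poly; field). lra.
- set (Y := yv rho z x) in *.
  assert (H := theta_left_step Y Y' c m ltac:(lra) ltac:(lra) ltac:(lra)).
  assert (Hm' : forall s, p <= s < q -> Y' <= yv rho z s <= Y -> m <= 2 + 2 / 9 * z s ^ 2) by (intros; nra).
  specialize (H Hm' Hc x Hx (Rle_refl _)).
  assert (HD : (Y - Y') / (m + Y * Y') <= / Y').
  { assert (0 < m + Y * Y') by nra.
    apply (Rmult_le_reg_r ((m + Y * Y') * Y')); [nra|].
    replace ((Y - Y') / (m + Y * Y') * ((m + Y * Y') * Y')) with ((Y - Y') * Y') by (field; lra).
    replace (/ Y' * ((m + Y * Y') * Y')) with (m + Y * Y') by (field; lra). nra. }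
  assert (H2 := atan_poly_le m _ _ (proj1 Hm) HD). lra.
Qed.

(** Uses only dy/dtheta <= - (2 + y^2) while y runs down from [Y] to -oo, with the exact arctangent.
    The estimate holds first before [q], where z > 0 makes y meaningful, and reaches [q] by
    continuity of theta. *)
Lemma theta_left_base (Y : R) :
  theta_left_le Y ((PI / 2 + atan (Y / sqrt 2)) / sqrt 2).
Proof.
intros x Hx HY.
assert (Hs2 : 0 < sqrt 2) by (apply sqrt_lt_R0; lra).
assert (Hss : sqrt 2 * sqrt 2 = 2) by (apply sqrt_sqrt; lra).
set (F := fun t => - (theta z t + atan (yv rho z t / sqrt 2) / sqrt 2)).
assert (Hbd : forall t, x <= t < q -> theta z t <= theta z x + (PI / 2 + atan (Y / sqrt 2)) / sqrt 2).
{ intros t Ht.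
  assert (HF : F x <= F t).
  { apply (derive_nonneg_le F (fun s => rho s * ((2 + yv rho z s ^ 2 + 2 / 9 * z s ^ 2) / (2 + yv rho z s ^ 2) - 1))).
    - lra.
    - intros s Hs. unfold F.
      pose proof (theta_continuous _ _ _ _ s Harc) as H1.
      assert (H2 : continuous (yv rho z) s).
      { apply (yv_continuous a b); [exact Harc|lra|]. specialize (Hz s ltac:(lra)). lra. }
      cont; lra.
    - intros s Hs. unfold F.
      assert (H1 : is_derive (theta z) s (rho s)) by (apply (theta_derive a b); [exact Harc|lra]).
      assert (H2 : is_derive (yv rho z) s (- rho s * (2 + yv rho z s ^ 2 + 2 / 9 * z s ^ 2))).
      { apply (yv_derive a b); [exact Harc|lra|]. specialize (Hz s ltac:(lra)). lra. }
      evar_last.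
      + apply (is_derive_opp (fun t => theta z t + atan (yv rho z t / sqrt 2) / sqrt 2)).
        apply (is_derive_plus (theta z) (fun t => atan (yv rho z t / sqrt 2) / sqrt 2)); [exact H1|].
        apply (is_derive_div_const (fun t => atan (yv rho z t / sqrt 2))).
        apply (is_derive_atan_comp (fun t => yv rho z t / sqrt 2)).
        apply (is_derive_div_const (yv rho z)). exact H2.
      + unfold opp, plus, scal; simpl. unfold mult; simpl.
        set (y := yv rho z s).
        replace (y / sqrt 2 * (y / sqrt 2 * 1)) with (y ^ 2 / (sqrt 2 * sqrt 2)) by (field; lra).
        rewrite Hss.
        match goal with |- ?L = _ => replace L with
          (- (rho s + - rho s * (2 + y ^ 2 + 2 / 9 * z s ^ 2) / (1 + y ^ 2 / 2) / (sqrt 2 * sqrt 2))) end.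
        * rewrite Hss. field. nra.
        * field. split; nra.
    - intros s Hs. assert (Hr : 0 < rho s) by (apply (arc_pos _ _ _ _ Harc); lra).
      apply Rmult_le_pos; [lra|].
      replace ((2 + yv rho z s ^ 2 + 2 / 9 * z s ^ 2) / (2 + yv rho z s ^ 2) - 1)
        with (2 / 9 * z s ^ 2 / (2 + yv rho z s ^ 2)) by (field; nra).
      apply Rdiv_le_0_compat; nra. }
  unfold F in HF.
  assert (Hat : - (PI / 2) < atan (yv rho z t / sqrt 2)) by (generalize (atan_bound (yv rho z t / sqrt 2)); lra).
  assert (Hat2 : atan (yv rho z x / sqrt 2) <= atan (Y / sqrt 2)).
  { destruct (Req_dec (yv rho z x) Y) as [->|Hne]; [lra|].
    left. apply atan_increasing. apply Rmult_lt_compat_r; [now apply Rinv_0_lt_compat|lra]. }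
  assert (atan (yv rho z x / sqrt 2) / sqrt 2 - atan (yv rho z t / sqrt 2) / sqrt 2
    <= (PI / 2 + atan (Y / sqrt 2)) / sqrt 2); [|lra].
  unfold Rdiv at 1 3 6. rewrite <- Rmult_minus_distr_r.
  apply Rmult_le_compat_r; [|lra]. left. now apply Rinv_0_lt_compat. }
destruct (Rle_or_lt (theta z q - theta z x) ((PI / 2 + atan (Y / sqrt 2)) / sqrt 2)) as [|Hgt]; [assumption|exfalso].
destruct (continuous_pos_near (fun t => theta z t - (theta z x + (PI / 2 + atan (Y / sqrt 2)) / sqrt 2)) q) as [d [Hd Hn]].
- pose proof (theta_continuous _ _ _ _ q Harc) as H1. cont.
- simpl. lra.
- set (t := Rmax x (q - d / 2)).
  assert (x <= t < q) by (unfold t; split; [apply Rmax_l|apply Rmax_lub_lt; lra]).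
  assert (q - d / 2 <= t) by apply Rmax_r.
  specialize (Hn t). simpl in Hn. rewrite Rabs_left in Hn by lra. specialize (Hbd t ltac:(lra)). lra.
Qed.

End descent.

(** * The numerical barrier *)

(** The diagonal Pade approximant (2 + u) / (2 - u) bounds the exponential from above: the
    difference of the two sides has derivative u^2 / (4 - u^2). *)
Lemma ln_pade u : 0 <= u < 2 -> u <= ln ((2 + u) / (2 - u)).
Proof.
intros Hu. rewrite ln_div by lra.
enough (ln (2 + 0) - ln (2 - 0) - 0 <= ln (2 + u) - ln (2 - u) - u).
{ rewrite (Rplus_0_r 2), (Rminus_0_r 2) in H. lra. }
apply (derive_nonneg_le (fun t => ln (2 + t) - ln (2 - t) - t) (fun t => / (2 + t) + / (2 - t) - 1)); [lra|..].
- intros x Hx. cont; lra.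
- intros x Hx. auto_derive; [lra|field; lra].
- intros x Hx. replace (/ (2 + x) + / (2 - x) - 1) with (x ^ 2 / ((2 + x) * (2 - x))) by (field; lra).
  apply Rdiv_le_0_compat; nra.
Qed.

(* [((32 + v) / (32 - v)) ^ 16] is a rational upper bound of [exp v]. *)
Lemma ln_sub_ge v x y :
  0 <= v < 32 -> 0 < x -> x * ((32 + v) / (32 - v)) ^ 16 <= y -> v <= ln y - ln x.
Proof.
intros Hv Hx Hxy.
assert (H := ln_pade (v / 16) ltac:(lra)).
replace ((2 + v / 16) / (2 - v / 16)) with ((32 + v) / (32 - v)) in H by (field; lra).
assert (Hw : 0 < (32 + v) / (32 - v)) by (apply Rdiv_lt_0_compat; lra).
assert (Hp := pow_lt _ 16 Hw).
assert (ln (x * ((32 + v) / (32 - v)) ^ 16) <= ln y).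
{ apply ln_le; [nra|exact Hxy]. }
rewrite ln_mult, ln_pow in H0 by assumption. simpl INR in H0. lra.
Qed.

Lemma div_plus_ln_decr c k k' : 0 < k -> k <= k' -> k' <= c -> c / k' + ln k' <= c / k + ln k.
Proof.
intros Hk Hkk Hc.
assert (H := ln_le_sub1 (k' / k) ltac:(apply Rdiv_lt_0_compat; lra)).
rewrite ln_div in H by lra.
assert (k' / k - 1 <= c / k - c / k'); [|lra].
apply (Rmult_le_reg_r (k * k')); [nra|].
replace ((k' / k - 1) * (k * k')) with ((k' - k) * k') by (field; lra).
replace ((c / k - c / k') * (k * k')) with ((k' - k) * c) by (field; lra). nra.
Qed.

Lemma div_plus_ln_incr c k k' : 0 < c -> c <= k -> k <= k' -> c / k + ln k <= c / k' + ln k'.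
Proof.
intros Hc0 Hc Hkk.
assert (H := ln_le_sub1 (k / k') ltac:(apply Rdiv_lt_0_compat; lra)).
rewrite ln_div in H by lra.
assert (c / k - c / k' <= 1 - k / k'); [|lra].
apply (Rmult_le_reg_r (k * k')); [nra|].
replace ((1 - k / k') * (k * k')) with ((k' - k) * k) by (field; lra).
replace ((c / k - c / k') * (k * k')) with ((k' - k) * c) by (field; lra). nra.
Qed.

(** For fixed [z] the energy is c / kappa + ln kappa with c = 1 + z^2 and kappa affine in [y]. It
    decreases until kappa = c, that is rho = 1, and increases afterwards. *)
Lemma Hyz_quasiconvex y1 y y2 z E :
  0 <= z -> y1 <= y <= y2 -> 0 < 1 + y1 * z - z ^ 2 / 3 ->
  Hyz y1 z <= E -> Hyz y2 z <= E -> Hyz y z <= E.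
Proof.
intros Hz Hy Hk. unfold Hyz. intros H1 H2.
set (k1 := 1 + y1 * z - z ^ 2 / 3) in *. set (k2 := 1 + y2 * z - z ^ 2 / 3) in *.
set (k := 1 + y * z - z ^ 2 / 3) in *.
assert (k1 <= k) by (unfold k, k1; nra). assert (k <= k2) by (unfold k, k2; nra).
pose proof (one_plus_sq_pos z).
destruct (Rle_or_lt k (1 + z ^ 2)).
- assert (Hd := div_plus_ln_decr (1 + z ^ 2) k1 k). lra.
- assert (Hd := div_plus_ln_incr (1 + z ^ 2) k k2). lra.
Qed.

Lemma Hyz_incr_y y1 y2 z :
  0 <= z -> 4 / 3 * z <= y1 -> y1 <= y2 -> Hyz y1 z <= Hyz y2 z.
Proof.
intros Hz H1 H2. unfold Hyz. apply div_plus_ln_incr; nra.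
Qed.

(** For fixed [y], kappa is concave in z and equals 1 at z = 0. *)
Lemma kappa_pos_below y w z :
  0 <= w <= z -> 0 < 1 + y * z - z ^ 2 / 3 -> 0 < 1 + y * w - w ^ 2 / 3.
Proof.
intros Hw Hk.
destruct (Rle_or_lt 0 (y - z / 3)).
- assert (0 <= y - w / 3) by lra. nra.
- assert (w * (y - z / 3) >= z * (y - z / 3)) by nra. nra.
Qed.

(** The derivative in z at fixed y is z (2 + y^2 + 2/9 z^2) / kappa^2, and [kappa_pos_below] carries
    the positivity of kappa from the upper end to the whole interval. *)
Lemma Hyz_lt_z y w z :
  0 <= w < z -> 0 < 1 + y * z - z ^ 2 / 3 -> Hyz y w < Hyz y z.
Proof.
intros Hw Hk.
apply (derive_pos_lt (Hyz y) (fun t => t * (2 + y ^ 2 + 2 / 9 * t ^ 2) / (1 + y * t - t ^ 2 / 3) ^ 2)).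
- lra.
- intros t Ht. unfold Hyz.
  assert (0 < 1 + y * t - t ^ 2 / 3) by (apply (kappa_pos_below y t z); [lra|exact Hk]).
  cont; lra.
- intros t Ht. unfold Hyz.
  assert (0 < 1 + y * t - t ^ 2 / 3) by (apply (kappa_pos_below y t z); [lra|exact Hk]).
  auto_derive; [split; [lra|split; [lra|exact I]]|]. field. lra.
- intros t Ht.
  assert (0 < 1 + y * t - t ^ 2 / 3) by (apply (kappa_pos_below y t z); [lra|exact Hk]).
  apply Rdiv_lt_0_compat; [|apply pow_lt; lra]. nra.
Qed.

(** The rational number [v] separates the difference of the fractions in [Hyz] from the difference
    of the logarithms, so that only rational inequalities remain to be checked. *)
Lemma Hyz_le_cert v y z y0 z0 :
  0 <= v < 32 -> 0 < 1 + y * z - z ^ 2 / 3 ->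
  (1 + z ^ 2) / (1 + y * z - z ^ 2 / 3) - (1 + z0 ^ 2) / (1 + y0 * z0 - z0 ^ 2 / 3) <= v ->
  (1 + y * z - z ^ 2 / 3) * ((32 + v) / (32 - v)) ^ 16 <= 1 + y0 * z0 - z0 ^ 2 / 3 ->
  Hyz y z <= Hyz y0 z0.
Proof.
intros Hv Hk H1 H2. assert (H := ln_sub_ge v _ _ Hv Hk H2). unfold Hyz. lra.
Qed.

(* Since the energy increases with z, it bounds z from below on a band y1 <= y <= y2;
   only the two edges of the band have to be tested. *)
Lemma barrier a b rho z x y1 y2 zeta E :
  arc a b rho z -> a <= x <= b -> 0 < z x -> E <= energy rho z x ->
  0 <= zeta -> y1 <= yv rho z x <= y2 -> 0 < 1 + y1 * zeta - zeta ^ 2 / 3 ->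
  Hyz y1 zeta <= E -> Hyz y2 zeta <= E -> zeta <= z x.
Proof.
intros H Hx Hzx HE Hze Hy Hk H1 H2.
destruct (Rle_or_lt zeta (z x)) as [|Hlt]; [assumption|exfalso].
assert (HQ := Hyz_quasiconvex _ _ _ _ _ Hze Hy Hk H1 H2).
assert (Hr := arc_pos _ _ _ _ H x Hx).
rewrite energy_Hyz in HE by (assumption || lra).
assert (Hm := Hyz_lt_z (yv rho z x) (z x) zeta ltac:(lra)).
assert (0 < 1 + yv rho z x * zeta - zeta ^ 2 / 3) by nra.
specialize (Hm H0). lra.
Qed.

Section key.
Variables (a b p q : R) (rho z : R -> R).
Hypothesis Harc : arc a b rho z.
Hypothesis Hap : a <= p.
Hypothesis Hpq : p < q.
Hypothesis Hqb : q < b.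
Hypothesis Hz : forall x, p <= x < q -> 0 < z x.
Hypothesis Hzq : z q = 0.
(* 577 / 1000 is slightly less than tan (PI / 6) *)
Hypothesis Hz0 : 577 / 1000 <= z p.

Notation tleft := (theta_left_le p q rho z).

(* 0.353555 is slightly more than sqrt 2 / 4. *)
Lemma tleft_base0 : tleft 0 (PI * 0.353555).
Proof.
intros x Hx Hy.
assert (H := theta_left_base a b p q rho z Harc Hap Hqb Hz 0 x Hx Hy).
unfold Rdiv at 3 in H. rewrite Rmult_0_l, atan_0, Rplus_0_r in H.
assert (Hs : 0 < sqrt 2) by (apply sqrt_lt_R0; lra).
assert (Hss : sqrt 2 * sqrt 2 = 2) by (apply sqrt_sqrt; lra).
assert (sqrt 2 < 1.41422) by nra.
replace (PI / 2 / sqrt 2) with (PI * (sqrt 2 / 4)) in H.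
- pose proof PI_RGT_0. nra.
- apply (Rmult_eq_reg_r (sqrt 2)); [|lra].
  replace (PI * (sqrt 2 / 4) * sqrt 2) with (PI * (sqrt 2 * sqrt 2) / 4) by field.
  rewrite Hss. field. lra.
Qed.

(** The corner [y0], [577 / 1000] has the least energy among the admissible starts: [Hyz] increases
    in y at z = 577/1000, because 4/3 * 0.577 < 1 <= [y0], and then in z. *)
Lemma energy_lower y0 x :
  1 <= y0 -> y0 <= yv rho z p -> p <= x <= q -> Hyz y0 (577 / 1000) <= energy rho z x.
Proof.
intros Hy0 Hy Hx.
assert (Hr : 0 < rho p) by (apply (arc_pos _ _ _ _ Harc); lra).
rewrite (energy_const _ _ _ _ x p Harc) by lra.
rewrite energy_Hyz by lra.
apply Rle_trans with (Hyz (yv rho z p) (577 / 1000)).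
- apply Hyz_incr_y; lra.
- destruct (Req_dec (z p) (577 / 1000)) as [->|Hne]; [lra|].
  left. apply Hyz_lt_z; [lra|]. rewrite yv_kap by lra. unfold kap.
  apply Rdiv_lt_0_compat; [apply one_plus_sq_pos|exact Hr].
Qed.

Lemma tleft_barrier y0 zeta Y Y' c d :
  1 <= y0 <= yv rho z p -> 0 <= zeta -> 0 <= Y' -> Y' < Y ->
  0 < 1 + Y' * zeta - zeta ^ 2 / 3 ->
  Hyz Y' zeta <= Hyz y0 (577 / 1000) -> Hyz Y zeta <= Hyz y0 (577 / 1000) ->
  tleft Y' c ->
  c + atan_poly (2 + 2 / 9 * zeta ^ 2) ((Y - Y') / (2 + 2 / 9 * zeta ^ 2 + Y * Y')) <= d ->
  tleft Y d.
Proof.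
intros Hy0 Hze HY' HYY Hk H1 H2 Hc Hd x Hx Hy.
apply Rle_trans with (2 := Hd).
apply (theta_left_step a b p q rho z Harc Hap Hpq Hqb Hz Hzq Y Y' c (2 + 2 / 9 * zeta ^ 2)); try assumption.
- nra.
- intros s Hs Hys.
  assert (zeta <= z s).
  { apply (barrier a b rho z s Y' Y zeta (Hyz y0 (577 / 1000))); try assumption.
    - lra.
    - now apply Hz.
    - apply energy_lower; lra. }
  nra.
Qed.

Lemma tleft_plain Y Y' c d :
  0 <= Y' -> Y' < Y -> tleft Y' c ->
  c + atan_poly 2 ((Y - Y') / (2 + Y * Y')) <= d ->
  tleft Y d.
Proof.
intros HY' HYY Hc Hd x Hx Hy. apply Rle_trans with (2 := Hd).
apply (theta_left_step a b p q rho z Harc Hap Hpq Hqb Hz Hzq Y Y' c 2); try assumption.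
- lra.
- intros; nra.
Qed.


Lemma atan_ge_cubic x : 0 <= x -> x - x ^ 3 / 3 <= atan x.
Proof.
intros Hx.
enough (atan 0 - (0 - 0 ^ 3 / 3) <= atan x - (x - x ^ 3 / 3)) by (rewrite atan_0 in H; lra).
apply (derive_nonneg_le (fun t => atan t - (t - t ^ 3 / 3)) (fun t => / (1 + t ^ 2) - (1 - t ^ 2))); [exact Hx|..].
- intros t _. cont. lra.
- intros t _. auto_derive; [exact I|field]. nra.
- intros t _. replace (/ (1 + t ^ 2) - (1 - t ^ 2)) with (t ^ 4 / (1 + t ^ 2)) by (field; nra).
  apply Rdiv_le_0_compat; nra.
Qed.

Lemma PI_bounds : 3.14 < PI < 3.2.
Proof.
generalize (PI_2_3_7_ineq 1). unfold tg_alt, PI_2_3_7_tg, Ratan_seq. simpl. lra.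
Qed.

(** [y0] bounds the initial y from below and thereby the energy; [zeta] is the barrier for z on the
    band with lower edge [lo]; [v1] and [v2] are the separating numbers of [Hyz_le_cert] at the
    lower and at the upper edge. *)
Ltac barrier_step y0 zeta lo v1 v2 :=
  eapply (tleft_barrier y0 zeta _ lo);
  [lra|lra|lra|lra|lra|apply (Hyz_le_cert v1); lra|apply (Hyz_le_cert v2); lra|eassumption|unfold atan_poly; lra].
Ltac plain_step lo :=
  eapply (tleft_plain _ lo); [lra|lra|eassumption|unfold atan_poly; lra].

(* Descent through successive bands of y, for each range of the initial value of y.
   The levels and the barriers zeta were optimized numerically; the sharp value of the
   theta-length is about 2.03, against the required 2 pi / 3 = 2.094. *)
Lemma tleft_7_11 : 7 <= yv rho z p -> tleft 11 (PI * 0.353555 + (1957 / 2000)).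
Proof.
intros Hy0. assert (H := tleft_base0).
assert (Hb : tleft 0 (PI * 0.353555 + 0)) by (now rewrite Rplus_0_r). clear H.
assert (H0 : tleft (4 / 5) (PI * 0.353555 + (343 / 1000))) by barrier_step 7 (4 / 5) 0 (363 / 200) (22 / 25).
assert (H1 : tleft (12 / 5) (PI * 0.353555 + (173 / 250))) by barrier_step 7 (27 / 25) (4 / 5) (1199 / 1000) (203 / 500).
(* Little time is spent at large y, so the frequency sqrt 2 is good enough for the top band. *)
plain_step (12 / 5).
Qed.

Lemma tleft_11_16 : 11 <= yv rho z p -> tleft 16 (PI * 0.353555 + (981 / 1000)).
Proof.
intros Hy0. assert (H := tleft_base0).
assert (Hb : tleft 0 (PI * 0.353555 + 0)) by (now rewrite Rplus_0_r). clear H.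
assert (H0 : tleft (3 / 10) (PI * 0.353555 + (273 / 2000))) by barrier_step 11 (89 / 100) 0 (2251 / 1000) (1603 / 1000).
assert (H1 : tleft (7 / 10) (PI * 0.353555 + (297 / 1000))) by barrier_step 11 (26 / 25) (3 / 10) (501 / 250) (1339 / 1000).
assert (H2 : tleft (6 / 5) (PI * 0.353555 + (903 / 2000))) by barrier_step 11 (123 / 100) (7 / 10) (1669 / 1000) (1091 / 1000).
assert (H3 : tleft 3 (PI * 0.353555 + (1463 / 2000))) by barrier_step 11 (139 / 100) (6 / 5) (253 / 200) (58 / 125).
plain_step 3.
Qed.

Lemma tleft_16_24 : 16 <= yv rho z p -> tleft 24 (PI * 0.353555 + (1963 / 2000)).
Proof.
intros Hy0. assert (H := tleft_base0).
assert (Hb : tleft 0 (PI * 0.353555 + 0)) by (now rewrite Rplus_0_r). clear H.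
assert (H0 : tleft (3 / 10) (PI * 0.353555 + (269 / 2000))) by barrier_step 16 (24 / 25) 0 (1321 / 500) (457 / 250).
assert (H1 : tleft (3 / 5) (PI * 0.353555 + (51 / 200))) by barrier_step 16 (57 / 50) (3 / 10) (2399 / 1000) (1707 / 1000).
assert (H2 : tleft (9 / 10) (PI * 0.353555 + (357 / 1000))) by barrier_step 16 (131 / 100) (3 / 5) (1053 / 500) (1559 / 1000).
assert (H3 : tleft (7 / 5) (PI * 0.353555 + (489 / 1000))) by barrier_step 16 (73 / 50) (9 / 10) (911 / 500) (1211 / 1000).
assert (H4 : tleft (15 / 4) (PI * 0.353555 + (96 / 125))) by barrier_step 16 (83 / 50) (7 / 5) (143 / 100) (58 / 125).
plain_step (15 / 4).
Qed.

Lemma tleft_24_40 : 24 <= yv rho z p -> tleft 40 (PI * 0.353555 + (1957 / 2000)).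
Proof.
intros Hy0. assert (H := tleft_base0).
assert (Hb : tleft 0 (PI * 0.353555 + 0)) by (now rewrite Rplus_0_r). clear H.
assert (H0 : tleft (3 / 10) (PI * 0.353555 + (53 / 400))) by barrier_step 24 (103 / 100) 0 (1549 / 500) (2067 / 1000).
assert (H1 : tleft (7 / 10) (PI * 0.353555 + (287 / 1000))) by barrier_step 24 (123 / 100) (3 / 10) (352 / 125) (881 / 500).
assert (H2 : tleft (11 / 10) (PI * 0.353555 + (51 / 125))) by barrier_step 24 (3 / 2) (7 / 10) (241 / 100) (1621 / 1000).
assert (H3 : tleft (17 / 10) (PI * 0.353555 + (1077 / 2000))) by barrier_step 24 (87 / 50) (11 / 10) (81 / 40) (319 / 250).
assert (H4 : tleft (19 / 4) (PI * 0.353555 + (1597 / 2000))) by barrier_step 24 (101 / 50) (17 / 10) (1563 / 1000) (23 / 50).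
plain_step (19 / 4).
Qed.

(** Here the initial y has no upper bound. The bands stop at [27 / 4], and the stretch above is left
    to [theta_left_last]. *)
Lemma tleft_40 : 40 <= yv rho z p -> tleft (27 / 4) (PI * 0.353555 + (104 / 125)).
Proof.
intros Hy0. assert (H := tleft_base0).
assert (Hb : tleft 0 (PI * 0.353555 + 0)) by (now rewrite Rplus_0_r). clear H.
assert (H0 : tleft (2 / 5) (PI * 0.353555 + (69 / 400))) by barrier_step 40 (11 / 10) 0 (3649 / 1000) (2077 / 1000).
assert (H1 : tleft (4 / 5) (PI * 0.353555 + (63 / 200))) by barrier_step 40 (141 / 100) (2 / 5) (163 / 50) (248 / 125).
assert (H2 : tleft (13 / 10) (PI * 0.353555 + (56 / 125))) by barrier_step 40 (173 / 100) (4 / 5) (113 / 40) (859 / 500).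
assert (H3 : tleft 2 (PI * 0.353555 + (143 / 250))) by barrier_step 40 (21 / 10) (13 / 10) (2339 / 1000) (279 / 200).
barrier_step 40 (251 / 100) 2 (1807 / 1000) (203 / 500).
Qed.

End key.

(** About 2.080 against 2.094: up to the level 7 no information on the energy is needed. *)
Lemma base_7_lt : (PI / 2 + atan (7 / sqrt 2)) / sqrt 2 < 2 * PI / 3.
Proof.
assert (Hs : 0 < sqrt 2) by (apply sqrt_lt_R0; lra).
assert (Hss : sqrt 2 * sqrt 2 = 2) by (apply sqrt_sqrt; lra).
assert (Hs1 : 1.4142 < sqrt 2) by nra. assert (Hs2 : sqrt 2 < 1.4143) by nra.
assert (Hat := atan_inv (7 / sqrt 2) ltac:(apply Rdiv_lt_0_compat; lra)).
replace (/ (7 / sqrt 2)) with (sqrt 2 / 7) in Hat by (field; lra).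
assert (Hg := atan_ge_cubic (sqrt 2 / 7) ltac:(lra)).
replace ((sqrt 2 / 7) ^ 3) with (sqrt 2 * (sqrt 2 * sqrt 2) / 343) in Hg by field.
rewrite Hss in Hg.
pose proof PI_bounds.
replace ((PI / 2 + atan (7 / sqrt 2)) / sqrt 2) with ((PI / 2 + atan (7 / sqrt 2)) * sqrt 2 / (sqrt 2 * sqrt 2)) by (field; lra).
rewrite Hss.
assert (PI / 2 + atan (7 / sqrt 2) <= PI - 0.199) by lra.
assert (0 < PI / 2 + atan (7 / sqrt 2)).
{ generalize (atan_bound (7 / sqrt 2)). lra. }
nra.
Qed.

Lemma theta_to_max_lt a b p q rho z :
  arc a b rho z -> a <= p -> p < q -> q < b ->
  (forall x, p <= x < q -> 0 < z x) -> z q = 0 -> 577 / 1000 <= z p ->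
  theta z q - theta z p < 2 * PI / 3.
Proof.
intros Harc Hap Hpq Hqb Hz Hzq Hz0.
assert (Hpp : p <= p < q) by lra. pose proof PI_bounds as HPI.
destruct (Rle_or_lt (yv rho z p) 7) as [H7|H7].
{ apply Rle_lt_trans with (2 := base_7_lt).
  eapply theta_left_base; eassumption. }
(* 0.9816 lies below (2/3 - 0.353555) * 3.14, and 3.14 is the lower bound for [PI] in use. *)
assert (Hfin : forall Y c, theta_left_le p q rho z Y (PI * 0.353555 + c) -> c <= 0.9816 -> yv rho z p <= Y ->
  theta z q - theta z p < 2 * PI / 3).
{ intros Y c Hb Hc HY. specialize (Hb p Hpp HY). lra. }
destruct (Rle_or_lt (yv rho z p) 11) as [H11|H11].
{ apply (Hfin 11 (1957 / 2000)); try lra. eapply tleft_7_11; try eassumption; lra. }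
destruct (Rle_or_lt (yv rho z p) 16) as [H16|H16].
{ apply (Hfin 16 (981 / 1000)); try lra. eapply tleft_11_16; try eassumption; lra. }
destruct (Rle_or_lt (yv rho z p) 24) as [H24|H24].
{ apply (Hfin 24 (1963 / 2000)); try lra. eapply tleft_16_24; try eassumption; lra. }
destruct (Rle_or_lt (yv rho z p) 40) as [H40|H40].
{ apply (Hfin 40 (1957 / 2000)); try lra. eapply tleft_24_40; try eassumption; lra. }
assert (Hb : theta_left_le p q rho z (27 / 4) (PI * 0.353555 + 104 / 125)) by (eapply tleft_40; try eassumption; lra).
assert (H := theta_left_last a b p q rho z Harc Hap Hpq Hqb Hz Hzq (27 / 4) _ 2 ltac:(lra) ltac:(lra) Hb p Hpp).
unfold atan_poly in H. lra.
Qed.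

(** * Lower bounds and comparison for half periods *)

(* Along the limiting trajectory of infinite energy, [yv = cot t / 3 - tan t],
   and [fly y] is the corresponding angle t. *)
Definition fly (y : R) := PI / 2 - atan ((- y + sqrt (y ^ 2 + 4 / 3)) / 2).

Lemma fly_root y : let x := (- y + sqrt (y ^ 2 + 4 / 3)) / 2 in 0 < x /\ x ^ 2 + y * x = 1 / 3.
Proof.
intros x. unfold x.
assert (Hs := sqrt_sqrt (y ^ 2 + 4 / 3) ltac:(nra)).
assert (Hp : 0 < sqrt (y ^ 2 + 4 / 3)) by (apply sqrt_lt_R0; nra).
split; [|nra]. nra.
Qed.

Lemma atan_le_id x : 0 <= x -> atan x <= x.
Proof.
intros Hx. enough (0 - atan 0 <= x - atan x) by (rewrite atan_0 in H; lra).
apply (derive_nonneg_le (fun t => t - atan t) (fun t => 1 - / (1 + t ^ 2))); [exact Hx|..].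
- intros t _. cont.
- intros t _. auto_derive; [exact I|field]. nra.
- intros t _. replace (1 - / (1 + t ^ 2)) with (t ^ 2 / (1 + t ^ 2)) by (field; nra).
  apply Rdiv_le_0_compat; nra.
Qed.

Lemma fly_le y e : 0 < e -> y < - / e -> fly y <= e.
Proof.
intros He Hy. destruct (fly_root y) as [Hx Hr]. unfold fly.
set (x := (- y + sqrt (y ^ 2 + 4 / 3)) / 2) in *.
assert (Hie : 0 < / e) by now apply Rinv_0_lt_compat.
assert (Hxe : / e < x). { nra. }
assert (Hat := atan_inv x Hx).
assert (Hix : / x < e). { rewrite <- (Rinv_inv e). apply Rinv_lt_contravar; [nra|exact Hxe]. }
assert (H := atan_le_id (/ x) ltac:(left; now apply Rinv_0_lt_compat)). lra.
Qed.

Lemma fly_gt y z : 0 < z -> 0 < 1 + y * z - z ^ 2 / 3 -> atan z < fly y.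
Proof.
intros Hz Hk. destruct (fly_root y) as [Hx Hr]. unfold fly.
set (x := (- y + sqrt (y ^ 2 + 4 / 3)) / 2) in *.
assert (Hat := atan_inv z Hz).
enough (atan x < atan (/ z)) by lra.
apply atan_increasing.
assert (Hiz : 0 < / z) by now apply Rinv_0_lt_compat.
assert (Hq : 1 / 3 < (/ z) ^ 2 + y * / z).
{ apply (Rmult_lt_reg_r (z ^ 2)); [nra|].
  replace (((/ z) ^ 2 + y * / z) * z ^ 2) with (1 + y * z) by (field; lra). lra. }
assert (0 < x + y) by nra. nra.
Qed.

(** With z = [/ x] the denominator equals 2 + y^2 + 2/9 z^2, so [fly] measures the theta-length
    along kappa = 0. *)
Lemma fly_derive y : let x := (- y + sqrt (y ^ 2 + 4 / 3)) / 2 in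
  is_derive fly y (/ (4 / 3 + x ^ 2 + / x ^ 2 / 3)).
Proof.
intros x. destruct (fly_root y) as [Hx Hr]. fold x in Hx, Hr.
assert (Hs := sqrt_sqrt (y ^ 2 + 4 / 3) ltac:(nra)).
assert (Hp : 0 < sqrt (y ^ 2 + 4 / 3)) by (apply sqrt_lt_R0; nra).
unfold fly. auto_derive.
- nra.
- replace (y * (y * 1) + 4 / 3) with (y ^ 2 + 4 / 3) by field.
  replace ((- y + sqrt (y ^ 2 + 4 / 3)) * / 2) with x by reflexivity.
  assert (Hsx : sqrt (y ^ 2 + 4 / 3) = 2 * x + y) by (unfold x; field).
  rewrite Hsx.
  assert (Hy : y = / (3 * x) - x). { apply (Rmult_eq_reg_r x); [|lra]. replace ((/ (3 * x) - x) * x) with (1 / 3 - x ^ 2) by (field; lra). lra. }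
  rewrite Hy. field. repeat split; nra.
Qed.

(** The sum of theta and [fly] of y is nondecreasing: z lies below the root of kappa = 0, so y falls
    no faster than on the limiting trajectory. At [q], y tends to -oo and [fly] to 0. *)
Lemma fly_le_theta_left a b p q rho z :
  arc a b rho z -> a <= p -> p < q -> q < b ->
  (forall x, p <= x < q -> 0 < z x) -> z q = 0 ->
  fly (yv rho z p) <= theta z q - theta z p.
Proof.
intros H Hp Hpq Hq Hz Hzq.
assert (Hrq := rho_gt1_at_max a b rho z p q H Hp Hpq Hq Hz Hzq).
set (J := fun x => theta z x + fly (yv rho z x)).
assert (HJ : forall t, p <= t < q -> J p <= J t).
{ intros t Ht.
  set (X := fun x => (- yv rho z x + sqrt (yv rho z x ^ 2 + 4 / 3)) / 2).
  assert (HJd : forall x, p <= x <= t -> continuous (yv rho z) x).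
  { intros x Hx. apply (yv_continuous a b); [exact H|lra|]. specialize (Hz x ltac:(lra)). lra. }
  apply (derive_nonneg_le J (fun x => rho x +
     - rho x * (2 + yv rho z x ^ 2 + 2 / 9 * z x ^ 2) * / (4 / 3 + X x ^ 2 + / X x ^ 2 / 3))); [lra|..].
  - intros x Hx. unfold J. apply (continuous_plus (theta z) (fun s => fly (yv rho z s))).
    + apply (theta_continuous a b rho z x H).
    + apply (continuous_comp (yv rho z) fly); [now apply HJd|].
      apply (ex_derive_continuous (V := R_NormedModule)). eexists. apply fly_derive.
  - intros x Hx. unfold J. apply (is_derive_plus (theta z) (fun s => fly (yv rho z s))).
    + apply (theta_derive a b); [exact H|lra].
    + apply (is_derive_comp fly (yv rho z)); [apply fly_derive|].
      apply (yv_derive a b); [exact H|lra|]. specialize (Hz x ltac:(lra)). lra.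
  - intros x Hx. assert (Hr : 0 < rho x) by (apply (arc_pos _ _ _ _ H); lra).
    assert (Hzx := Hz x ltac:(lra)).
    destruct (fly_root (yv rho z x)) as [HX HXr]. fold (X x) in HX, HXr.
    assert (Hk := yv_kap rho z x ltac:(lra)).
    assert (Hkp : 0 < kap rho z x) by (apply Rdiv_lt_0_compat; [apply one_plus_sq_pos|exact Hr]).
    set (y := yv rho z x) in *. set (w := X x) in *.
    assert (Hwz : w * z x < 1).
    { assert (0 < y + w) by nra. destruct (Rlt_or_le (w * z x) 1) as [|Hge]; [assumption|exfalso].
      assert (w ^ 2 * (1 + y * z x - z x ^ 2 / 3) <= 0); [|rewrite Hk in H1; nra].
      replace (w ^ 2 * (1 + y * z x - z x ^ 2 / 3)) with (w ^ 2 + (w * z x) * (y * w) - (w * z x) ^ 2 / 3) by field.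
      replace (y * w) with (1 / 3 - w ^ 2) by lra.
      set (u := w * z x) in *. nra. }
    assert (Hq2 : 2 + y ^ 2 + 2 / 9 * z x ^ 2 <= 4 / 3 + w ^ 2 + / w ^ 2 / 3).
    { assert (Hy : y = / (3 * w) - w).
      { apply (Rmult_eq_reg_r w); [|lra]. replace ((/ (3 * w) - w) * w) with (1 / 3 - w ^ 2) by (field; lra). lra. }
      assert (Hzw : z x <= / w).
      { apply (Rmult_le_reg_r w); [lra|]. rewrite Rinv_l by lra. lra. }
      assert (z x ^ 2 <= (/ w) ^ 2) by (apply pow_incr; lra).
      replace (2 + y ^ 2 + 2 / 9 * z x ^ 2) with (4 / 3 + w ^ 2 + (/ w) ^ 2 / 9 + 2 / 9 * z x ^ 2) by (rewrite Hy; field; lra).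
      replace (/ w ^ 2 / 3) with ((/ w) ^ 2 / 3) by (field; lra). lra. }
    set (D := 4 / 3 + w ^ 2 + / w ^ 2 / 3) in *.
    assert (0 < D) by nra.
    replace (rho x + - rho x * (2 + y ^ 2 + 2 / 9 * z x ^ 2) * / D)
      with (rho x * (D - (2 + y ^ 2 + 2 / 9 * z x ^ 2)) / D) by (field; lra).
    apply Rdiv_le_0_compat; [|assumption]. apply Rmult_le_pos; lra. }
apply le_epsilon. intros e He.
destruct (yv_to_minf a b rho z p q (- / e) H Hp Hpq (Rlt_le _ _ Hq) Hz Hzq Hrq) as [x0 [Hx0 Hlt]].
assert (Hf := fly_le (yv rho z x0) e He (Hlt x0 ltac:(lra))).
assert (HJx := HJ x0 ltac:(lra)). unfold J in HJx.
assert (Ht := theta_lt a b rho z x0 q H ltac:(lra) ltac:(lra) ltac:(lra)). lra.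
Qed.

(** At the minimum [p], y tends to +oo and [fly] to [PI / 2]; since z vanishes at both ends, the
    theta-length is [q - p]. *)
Lemma half_period_ge a b p q rho z :
  arc a b rho z -> a < p -> p < q -> q < b ->
  (forall x, p < x < q -> 0 < z x) -> z p = 0 -> z q = 0 ->
  PI / 2 <= q - p.
Proof.
intros H Hp Hpq Hq Hz Hzp Hzq.
assert (Hrp : rho p < 1).
{ apply (rho_lt1_at_min a b rho z p ((p + q) / 2)); try assumption; try lra. intros; apply Hz; lra. }
apply le_epsilon. intros e He.
destruct (yv_to_pinf a b rho z p ((p + q) / 2) (/ e) H) as [x0 [Hx0 Hgt]]; try assumption; try lra.
{ intros; apply Hz; lra. }
specialize (Hgt x0 ltac:(lra)).
assert (Hie : 0 < / e) by now apply Rinv_0_lt_compat.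
assert (Hf := fly_le_theta_left a b x0 q rho z H ltac:(lra) ltac:(lra) Hq ltac:(intros; apply Hz; lra) Hzq).
assert (Ht := theta_lt a b rho z p x0 H ltac:(lra) ltac:(lra) ltac:(lra)).
assert (Hd : theta z q - theta z p = q - p) by (unfold theta; rewrite Hzp, Hzq; ring).
enough (PI / 2 - e <= fly (yv rho z x0)) by lra.
destruct (fly_root (yv rho z x0)) as [HX HXr]. unfold fly.
set (x := (- yv rho z x0 + sqrt (yv rho z x0 ^ 2 + 4 / 3)) / 2) in *.
assert (Hxe : x <= e).
{ assert (/ e * x <= 1) by nra.
  apply (Rmult_le_reg_l (/ e)); [exact Hie|]. rewrite Rinv_l by lra. lra. }
assert (Ha := atan_le_id x). lra.
Qed.

(* Monotonicity of the half period in the energy: at equal y the arc with the higher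
   energy has the larger z, hence y decreases faster along it.  The part of its half
   period after e1 is bounded below by the limiting trajectory. *)
Lemma compare_half_period a1 b1 rho1 z1 p1 e1 a2 b2 rho2 z2 p2 q2 :
  arc a1 b1 rho1 z1 -> a1 < p1 -> p1 < e1 -> e1 <= b1 ->
  z1 p1 = 0 -> (forall x, p1 < x <= e1 -> 0 < z1 x) ->
  arc a2 b2 rho2 z2 -> a2 < p2 -> p2 < q2 -> q2 < b2 ->
  z2 p2 = 0 -> (forall x, p2 < x < q2 -> 0 < z2 x) -> z2 q2 = 0 ->
  energy rho2 z2 p2 < energy rho1 z1 p1 ->
  e1 - p1 <= q2 - p2.
Proof.
intros H1 Hp1 Hpe1 He1 Hz1p Hz1 H2 Hp2 Hpq2 Hq2 Hz2p Hz2 Hz2q HE.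
assert (Hr2p : rho2 p2 < 1).
{ apply (rho_lt1_at_min a2 b2 rho2 z2 p2 ((p2 + q2) / 2)); try assumption; try lra. intros; apply Hz2; lra. }
assert (Hr2q : 1 < rho2 q2).
{ apply (rho_gt1_at_max a2 b2 rho2 z2 ((p2 + q2) / 2) q2); try assumption; try lra. intros; apply Hz2; lra. }
assert (Hy2c : forall x, p2 < x < q2 -> continuous (yv rho2 z2) x).
{ intros x Hx. apply (yv_continuous a2 b2); [exact H2|lra|]. specialize (Hz2 x Hx). lra. }
assert (Hhit : forall y, exists t, p2 < t < q2 /\ yv rho2 z2 t = y).
{ intros y.
  destruct (yv_to_pinf a2 b2 rho2 z2 p2 ((p2 + q2) / 2) y H2) as [s [Hs Hsy]]; try assumption; try lra.
  { intros; apply Hz2; lra. }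
  destruct (yv_to_minf a2 b2 rho2 z2 s q2 y H2) as [t [Ht Hty]]; try assumption; try lra.
  { intros; apply Hz2; lra. }
  destruct (IVT_value (yv rho2 z2) y s t) as [c [Hc Hcy]]; try lra.
  - intros; apply Hy2c; lra.
  - specialize (Hsy s ltac:(lra)). specialize (Hty t ltac:(lra)). lra.
  - exists c. split; [lra|exact Hcy]. }
destruct (Hhit (yv rho1 z1 e1)) as [te [Hte Hye]].
(* The start [x] stays to the right of [p1], since y is infinite at [p1]; continuity of theta closes
   the gap afterwards. *)
assert (Hmain : forall x, p1 < x < e1 -> theta z1 e1 - theta z1 x <= theta z2 te - theta z2 p2).
{ intros x Hx. destruct (Hhit (yv rho1 z1 x)) as [tx [Htx Hyx]].
  assert (Hy1d : forall s, x <= s <= e1 -> continuous (yv rho1 z1) s).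
  { intros s Hs. apply (yv_continuous a1 b1); [exact H1|lra|]. specialize (Hz1 s ltac:(lra)). lra. }
  assert (Hyle : forall s, x <= s <= e1 -> yv rho1 z1 e1 <= yv rho1 z1 s <= yv rho1 z1 x).
  { intros s Hs. split; apply (yv_decr a1 b1); try assumption; try lra; intros; apply Hz1; lra. }
  assert (Htt : tx < te).
  { destruct (Rlt_or_le tx te) as [|Hge]; [assumption|exfalso].
    assert (Hd : yv rho2 z2 tx <= yv rho2 z2 te) by
      (apply (yv_decr a2 b2); try assumption; try lra; intros; apply Hz2; lra).
    assert (Hs : yv rho1 z1 e1 < yv rho1 z1 x); [|lra].
    apply (yv_lt a1 b1); try assumption; try lra. intros; apply Hz1; lra. }
  destruct (inverse_function (fun t => - yv rho2 z2 t)
    (fun t => - (- rho2 t * (2 + yv rho2 z2 t ^ 2 + 2 / 9 * z2 t ^ 2))) tx te) as [g [Hgc [Hgab [Hgf [Hgi Hgd]]]]].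
  - exact Htt.
  - intros t Ht. apply (continuous_opp (yv rho2 z2)), Hy2c. lra.
  - intros t Ht. apply (is_derive_opp (yv rho2 z2)), (yv_derive a2 b2); [exact H2|lra|].
    specialize (Hz2 t ltac:(lra)). lra.
  - intros t Ht. assert (Hr : 0 < rho2 t) by (apply (arc_pos _ _ _ _ H2); lra). nra.
  - simpl in Hgf, Hgi, Hgd. rewrite Hyx, Hye in Hgf, Hgd.
    (* [m s] is the point of arc 2 that has the same y as arc 1 has at [s]; the minus signs make y
       increasing so that it can be inverted. *)
    set (m := fun s => g (- yv rho1 z1 s)).
    assert (Hm : forall s, x <= s <= e1 -> tx <= m s <= te /\ yv rho2 z2 (m s) = yv rho1 z1 s).
    { intros s Hs. split; [apply Hgab|].
      assert (Hb := Hgf (- yv rho1 z1 s)). specialize (Hyle s Hs). unfold m. lra. }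
    assert (Hmx : m x = tx) by (unfold m; rewrite <- Hyx; apply Hgi; lra).
    assert (Hme : m e1 = te) by (unfold m; rewrite <- Hye; apply Hgi; lra).
    assert (HG : theta z2 (m x) - theta z1 x <= theta z2 (m e1) - theta z1 e1).
    { apply (derive_nonneg_le (fun s => theta z2 (m s) - theta z1 s)
        (fun s => rho1 s * ((2 + yv rho1 z1 s ^ 2 + 2 / 9 * z1 s ^ 2) / (2 + yv rho1 z1 s ^ 2 + 2 / 9 * z2 (m s) ^ 2) - 1))); [lra|..].
      - intros s Hs. apply (continuous_minus (fun s => theta z2 (m s)) (theta z1)).
        + apply (continuous_comp m (theta z2)); [|apply (theta_continuous a2 b2 rho2 z2 _ H2)].
          apply (continuous_comp (fun s => - yv rho1 z1 s) g); [|apply Hgc].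
          apply (continuous_opp (yv rho1 z1)), Hy1d. lra.
        + apply (theta_continuous a1 b1 rho1 z1 _ H1).
      - intros s Hs. destruct (Hm s ltac:(lra)) as [Hms Hmy].
        assert (Hr1 : 0 < rho1 s) by (apply (arc_pos _ _ _ _ H1); lra).
        assert (Hr2 : 0 < rho2 (m s)) by (apply (arc_pos _ _ _ _ H2); lra).
        assert (Hy1' := yv_derive a1 b1 rho1 z1 s H1 ltac:(lra) ltac:(specialize (Hz1 s ltac:(lra)); lra)).
        assert (Hylt : yv rho1 z1 e1 < yv rho1 z1 s < yv rho1 z1 x).
        { split; apply (yv_lt a1 b1); try assumption; try lra; intros; apply Hz1; lra. }
        evar_last.
        + apply (is_derive_minus (fun s => theta z2 (m s)) (theta z1)).
          * apply (is_derive_comp (theta z2) m); [apply (theta_derive a2 b2); [exact H2|lra]|].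
            apply (is_derive_comp g (fun s => - yv rho1 z1 s)).
            -- apply Hgd. lra.
            -- apply (is_derive_opp (yv rho1 z1)), Hy1'.
          * apply (theta_derive a1 b1); [exact H1|lra].
        + unfold minus, plus, opp, scal; simpl. unfold mult; simpl. fold (m s). rewrite Hmy.
          field. split; nra.
      - intros s Hs. destruct (Hm s ltac:(lra)) as [Hms Hmy].
        assert (Hr1 : 0 < rho1 s) by (apply (arc_pos _ _ _ _ H1); lra).
        assert (Hr2 : 0 < rho2 (m s)) by (apply (arc_pos _ _ _ _ H2); lra).
        assert (Hzs := Hz1 s ltac:(lra)). assert (Hzm := Hz2 (m s) ltac:(lra)).
        assert (Hle : z2 (m s) <= z1 s).
        { rewrite (energy_const _ _ _ _ p1 s H1), (energy_const _ _ _ _ p2 (m s) H2) in HE by lra.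
          rewrite (energy_Hyz rho1 z1 s), (energy_Hyz rho2 z2 (m s)), Hmy in HE by lra.
          destruct (Rle_or_lt (z2 (m s)) (z1 s)) as [|Hlt]; [assumption|exfalso].
          assert (Hk := yv_kap rho2 z2 (m s) ltac:(lra)). rewrite Hmy in Hk.
          assert (Hl := Hyz_lt_z (yv rho1 z1 s) (z1 s) (z2 (m s)) ltac:(lra)).
          rewrite Hk in Hl. specialize (Hl ltac:(apply Rdiv_lt_0_compat; [apply one_plus_sq_pos|exact Hr2])). lra. }
        apply Rmult_le_pos; [lra|].
        set (B := 2 + yv rho1 z1 s ^ 2 + 2 / 9 * z2 (m s) ^ 2).
        assert (HB : 0 < B) by (unfold B; nra).
        replace ((2 + yv rho1 z1 s ^ 2 + 2 / 9 * z1 s ^ 2) / B - 1) with (2 / 9 * (z1 s ^ 2 - z2 (m s) ^ 2) / B)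
          by (unfold B; field; unfold B in HB; lra).
        apply Rdiv_le_0_compat; [nra|exact HB]. }
    rewrite Hmx, Hme in HG.
    assert (Ht := theta_lt a2 b2 rho2 z2 p2 tx H2 ltac:(lra) ltac:(lra) ltac:(lra)). lra. }
assert (Hp : theta z1 e1 - theta z1 p1 <= theta z2 te - theta z2 p2).
{ enough (- (theta z2 te - theta z2 p2) + theta z1 e1 <= theta z1 p1) by lra.
  apply (ge_at_left_end (theta z1) _ p1 e1 Hpe1 (theta_continuous a1 b1 rho1 z1 _ H1)).
  intros x Hx. specialize (Hmain x Hx). lra. }
(* The polar angle [e1 - p1] exceeds the theta-length of arc 1 by [atan (z1 e1)]. This excess is
   below [fly] at the common level of y, hence below the theta-length that arc 2 still has to run
   from [te] to [q2]. *)
assert (Hf := fly_le_theta_left a2 b2 te q2 rho2 z2 H2 ltac:(lra) ltac:(lra) Hq2 ltac:(intros; apply Hz2; lra) Hz2q).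
rewrite Hye in Hf.
assert (Hze := Hz1 e1 ltac:(lra)).
assert (Hg : atan (z1 e1) < fly (yv rho1 z1 e1)).
{ apply fly_gt; [exact Hze|]. rewrite yv_kap by lra.
  apply Rdiv_lt_0_compat; [apply one_plus_sq_pos|apply (arc_pos _ _ _ _ H1); lra]. }
unfold theta in *. rewrite Hz1p, Hz2p, Hz2q, atan_0 in *. lra.
Qed.

(** * Impossible configurations of arcs *)

Lemma atan_ge_PI6 x : PI / 6 <= atan x -> 577 / 1000 <= x.
Proof.
intros H. destruct (Rle_or_lt (577 / 1000) x) as [|Hlt]; [assumption|exfalso].
assert (Hs : 0 < sqrt 3) by (apply sqrt_lt_R0; lra).
assert (Hss : sqrt 3 * sqrt 3 = 3) by (apply sqrt_sqrt; lra).
assert (x < tan (PI / 6)).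
{ rewrite tan_PI6. apply Rlt_trans with (1 := Hlt).
  apply (Rmult_lt_reg_r (sqrt 3)); [exact Hs|].
  replace (1 / sqrt 3 * sqrt 3) with 1 by (field; lra). nra. }
apply atan_increasing in H0. rewrite atan_tan in H0; [lra|]. pose proof PI_RGT_0. lra.
Qed.

Lemma energy_opp rho z x : energy (fun t => rho (- t)) (fun t => - z (- t)) x = energy rho z (- x).
Proof. unfold energy. replace ((- z (- x)) ^ 2) with (z (- x) ^ 2) by ring. reflexivity. Qed.

Lemma theta_opp z x : theta (fun t => - z (- t)) x = - theta z (- x).
Proof. unfold theta. rewrite atan_opp. ring. Qed.

Lemma theta_from_max_lt a b p q rho z :
  arc a b rho z -> a < p -> p < q -> q <= b ->
  (forall x, p < x <= q -> z x < 0) -> z p = 0 -> z q <= - (577 / 1000) ->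
  theta z q - theta z p < 2 * PI / 3.
Proof.
intros H Hp Hpq Hq Hz Hzp Hzq.
assert (Hr := theta_to_max_lt (- b) (- a) (- q) (- p) _ _ (arc_opp a b rho z H)).
simpl in Hr. rewrite !theta_opp, !Ropp_involutive, Hzp in Hr.
enough (- theta z p - - theta z q < 2 * PI / 3) by lra.
apply Hr; try lra.
intros x Hx. specialize (Hz (- x) ltac:(lra)). lra.
Qed.

(** At a zero of z one has z' = 1 - rho. The product form treats maxima, minima and both sides of
    [m] at once. *)
Lemma arc_zero_sign a b rho z m :
  arc a b rho z -> a < m < b -> z m = 0 -> rho m <> 1 ->
  exists e, 0 < e /\ forall x, Rabs (x - m) < e -> x <> m -> 0 < z x * (x - m) * (1 - rho m).
Proof.
intros H Hm Hz Hr.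
assert (Hd := arc_dz _ _ _ _ H m Hm). rewrite Hz in Hd.
replace ((1 + 0 ^ 2) * (1 - rho m)) with (1 - rho m) in Hd by ring.
assert (Hd' : is_derive (fun x => (1 - rho m) * z x) m ((1 - rho m) * (1 - rho m))).
{ apply (is_derive_scal z m (1 - rho m)). exact Hd. }
destruct (derive_pos_local _ _ _ Hd') as [e [He [H1 H2]]].
- rewrite Hz. ring.
- destruct (Rdichotomy _ _ Hr); nra.
- exists e. split; [exact He|]. intros x Hx Hne.
  apply Rabs_def2 in Hx. destruct (Rdichotomy _ _ Hne) as [Hl|Hl].
  + specialize (H2 x ltac:(lra)). simpl in H2. nra.
  + specialize (H1 x ltac:(lra)). simpl in H1. nra.
Qed.

Lemma pos_of_triple_prod u v w : 0 < u * v * w -> 0 < v * w -> 0 < u.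
Proof. intros H1 H2. rewrite Rmult_assoc in H1. nra. Qed.

Lemma neg_of_triple_prod u v w : 0 < u * v * w -> v * w < 0 -> u < 0.
Proof. intros H1 H2. rewrite Rmult_assoc in H1. nra. Qed.

Lemma arc_rho_ne1 a b rho z m x :
  arc a b rho z -> a <= m <= b -> a <= x <= b -> z m = 0 -> z x <> 0 -> rho m <> 1.
Proof.
intros H Hm Hx Hz Hzx Hr. apply Hzx. now apply (arc_no_rest a b rho z m x).
Qed.

(** The first zero [F] of z and the last one [G] are maxima of the radius. The stretches before [F]
    and after [G] have theta-length less than 2 pi / 3 each, so [F] and [G] are distinct and a
    minimum lies between them. *)
Lemma arc_max_min_max a b rho z :
  arc a b rho z -> PI / 6 <= atan (z a) -> atan (z b) <= - (PI / 6) ->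
  4 * PI / 3 <= theta z b - theta z a ->
  exists x m q, a < x < m /\ m < q < b /\ z x = 0 /\ z m = 0 /\ z q = 0 /\
    (forall t, x < t < m -> z t < 0) /\ (forall t, m < t < q -> 0 < z t).
Proof.
intros H Ha Hb Hth.
assert (Hza := atan_ge_PI6 _ Ha).
assert (Hzb : z b <= - (577 / 1000)).
{ assert (Hb' : PI / 6 <= atan (- z b)) by (rewrite atan_opp; lra). apply atan_ge_PI6 in Hb'. lra. }
assert (Hab := arc_lt _ _ _ _ H).
assert (Hc : forall t, continuous z t) by apply (arc_cz _ _ _ _ H).
assert (Hco : forall t, continuous (fun u => - z u) t) by (intros t; apply (continuous_opp z), Hc).
assert (Hne : forall t, a <= t <= b -> z t = 0 -> rho t <> 1).
{ intros t Ht Hzt. apply (arc_rho_ne1 a b rho z t a); try assumption; lra. }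
destruct (first_zero z a b) as [F [HF [HzF HzFp]]]; try lra; [intros; apply Hc|].
assert (HFb : F < b). { destruct (proj2 HF) as [|He]; [assumption|rewrite He in HzF; lra]. }
destruct (last_zero (fun t => - z t) a b) as [G [HG [HzG HzGp]]]; try lra; [intros; apply Hco|].
simpl in HzG, HzGp.
assert (HGa : a < G). { destruct (proj1 HG) as [|He]; [assumption|rewrite <- He in HzG; lra]. }
assert (HT1 := theta_to_max_lt a b a F rho z H ltac:(lra) ltac:(lra) HFb HzFp HzF Hza).
assert (HT2 := theta_from_max_lt a b G b rho z H HGa ltac:(lra) ltac:(lra) ltac:(intros t Ht; specialize (HzGp t Ht); lra) ltac:(lra) Hzb).
assert (HFG : F < G).
{ destruct (Rlt_or_le F G) as [|[Hlt|He]]; [assumption|exfalso|exfalso].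
  - assert (Hl := theta_lt a b rho z G F H ltac:(lra) Hlt ltac:(lra)). lra.
  - subst. lra. }
assert (HrF := rho_gt1_at_max a b rho z a F H ltac:(lra) ltac:(lra) HFb HzFp HzF).
assert (HrG : 1 < rho G).
{ assert (Hr := rho_gt1_at_max (- b) (- a) _ _ (- b) (- G) (arc_opp a b rho z H)).
  simpl in Hr. rewrite !Ropp_involutive in Hr. apply Hr; try lra.
  intros t Ht. apply HzGp. lra. }
destruct (arc_zero_sign a b rho z G H ltac:(lra) ltac:(lra) ltac:(lra)) as [e [He HeG]].
set (t1 := Rmax ((F + G) / 2) (G - e / 2)).
assert (Ht1 : F < t1 < G).
{ unfold t1. split; [apply Rlt_le_trans with ((F + G) / 2); [lra|apply Rmax_l]|apply Rmax_lub_lt; lra]. }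
assert (Ht1e : G - e / 2 <= t1) by apply Rmax_r.
assert (Hz1 : 0 < z t1).
{ specialize (HeG t1). rewrite Rabs_left in HeG by lra. specialize (HeG ltac:(lra) ltac:(lra)).
  apply (pos_of_triple_prod _ _ _ HeG). nra. }
destruct (last_zero z F t1) as [m [Hm [Hzm Hzmp]]]; try lra; [intros; apply Hc|].
destruct (first_zero z t1 G) as [q [Hq [Hzq Hzqp]]]; try lra; [intros; apply Hc|].
assert (Hmq : forall t, m < t < q -> 0 < z t).
{ intros t Ht. destruct (Rle_or_lt t t1); [apply Hzmp; lra|apply Hzqp; lra]. }
assert (Hrm := rho_lt1_at_min a b rho z m t1 H ltac:(lra) ltac:(lra) ltac:(lra) Hzmp Hzm).
(* [m] is a minimum with [rho m < 1], whereas [rho F > 1]. *)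
assert (HFm : F < m). { destruct (proj1 Hm) as [|HeF]; [assumption|rewrite HeF in HrF; lra]. }
destruct (arc_zero_sign a b rho z m H ltac:(lra) Hzm ltac:(lra)) as [e' [He' Hem]].
set (t2 := Rmax ((F + m) / 2) (m - e' / 2)).
assert (Ht2 : F < t2 < m).
{ unfold t2. split; [apply Rlt_le_trans with ((F + m) / 2); [lra|apply Rmax_l]|apply Rmax_lub_lt; lra]. }
assert (Ht2e : m - e' / 2 <= t2) by apply Rmax_r.
assert (Hz2 : forall t, t2 <= t < m -> z t < 0).
{ intros t Ht. specialize (Hem t). rewrite Rabs_left in Hem by lra. specialize (Hem ltac:(lra) ltac:(lra)).
  apply (neg_of_triple_prod _ _ _ Hem). nra. }
destruct (last_zero (fun t => - z t) F t2) as [x [Hx [Hzx Hzxp]]].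
- lra.
- intros; apply Hco.
- lra.
- specialize (Hz2 t2 ltac:(lra)). lra.
- simpl in Hzx, Hzxp. exists x, m, q. repeat split; try lra.
  + intros t Ht. destruct (Rle_or_lt t t2); [specialize (Hzxp t); lra|apply Hz2; lra].
  + exact Hmq.
Qed.

(** The theta-length is PI + 2 * PI / 6 = 4 PI / 3. This puts two complete half periods, each at
    least [PI / 2], strictly inside an interval of length [PI]. *)
Lemma no_arc_across_segment a rho z :
  arc a (a + PI) rho z -> atan (z a) = PI / 6 -> atan (z (a + PI)) = - (PI / 6) -> False.
Proof.
intros H Ha Hb.
destruct (arc_max_min_max a (a + PI) rho z H) as [x [m [q [Hx [Hq [Hzx [Hzm [Hzq [Hxm Hmq]]]]]]]]]; try lra.
{ unfold theta. lra. }
assert (H1 := half_period_ge a (a + PI) m q rho z H ltac:(lra) ltac:(lra) ltac:(lra) Hmq Hzm Hzq).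
assert (H2 := half_period_ge _ _ (- m) (- x) _ _ (arc_opp _ _ _ _ H)).
simpl in H2. rewrite !Ropp_involutive, Hzx, Hzm in H2.
specialize (H2 ltac:(lra) ltac:(lra) ltac:(lra)).
assert (PI / 2 <= - x - - m); [|lra].
apply H2; try lra. intros t Ht. specialize (Hxm (- t) ltac:(lra)). lra.
Qed.

(** Arc 1 has the higher energy, because it lies inside at the minimum [m] of arc 2, where
    [r - ln r] decreases. The cases place [m] relative to the first zero [d] and the last zero [c]
    of [z1]. If [m] is not strictly between them, the radius of arc 1 is monotone over a polar angle
    longer than a half period of arc 2. *)
Lemma no_nested_arcs a b rho1 z1 rho2 z2 :
  arc a b rho1 z1 -> arc a b rho2 z2 ->
  (forall t, a < t < b -> rho1 t < rho2 t) ->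
  z1 a < 0 -> 0 < z1 b ->
  PI / 6 <= atan (z2 a) -> atan (z2 b) <= - (PI / 6) ->
  4 * PI / 3 <= theta z2 b - theta z2 a -> False.
Proof.
intros H1 H2 Hlt Hz1a Hz1b Ha Hb Hth.
destruct (arc_max_min_max a b rho2 z2 H2 Ha Hb Hth) as [x [m [q [Hx [Hq [Hzx [Hzm [Hzq [Hxm Hmq]]]]]]]]].
assert (Hc : forall t, continuous z1 t) by apply (arc_cz _ _ _ _ H1).
assert (Hr2m : rho2 m < 1).
{ apply (rho_lt1_at_min a b rho2 z2 m ((m + q) / 2)); try assumption; try lra. intros; apply Hmq; lra. }
assert (HE : energy rho2 z2 m < energy rho1 z1 m).
{ rewrite energy_at_zero by assumption.
  apply Rlt_le_trans with (rho1 m - ln (rho1 m)); [|apply energy_ge].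
  apply sub_ln_decr; [apply (arc_pos _ _ _ _ H1); lra|apply Hlt; lra|lra]. }
destruct (last_zero z1 a b) as [c [Hcc [Hzc Hzcp]]]; try lra; [intros; apply Hc|].
assert (Hac : a < c). { destruct (proj1 Hcc) as [|He]; [assumption|rewrite <- He in Hzc; lra]. }
destruct (first_zero (fun t => - z1 t) a b) as [d [Hdd [Hzd Hzdp]]]; try lra.
{ intros; apply (continuous_opp z1), Hc. }
simpl in Hzd, Hzdp.
assert (Hdb : d < b). { destruct (proj2 Hdd) as [|He]; [assumption|rewrite He in Hzd; lra]. }
destruct (Rle_or_lt c m) as [Hcm|Hcm].
{ assert (Hcmp := compare_half_period a b rho1 z1 c b a b rho2 z2 m q H1 Hac ltac:(lra) ltac:(lra) Hzc Hzcp
    H2 ltac:(lra) ltac:(lra) ltac:(lra) Hzm Hmq Hzq).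
  rewrite (energy_const _ _ _ _ c m H1) in Hcmp by lra. specialize (Hcmp HE). lra. }
destruct (Rle_or_lt m d) as [Hmd|Hmd].
{ assert (Hcmp := compare_half_period
    (- b) (- a) (fun t => rho1 (- t)) (fun t => - z1 (- t)) (- d) (- a)
    (- b) (- a) (fun t => rho2 (- t)) (fun t => - z2 (- t)) (- m) (- x)).
  rewrite !energy_opp, !Ropp_involutive, (energy_const _ _ _ _ d m H1) in Hcmp by lra.
  assert (- a - - d <= - x - - m); [|lra].
  apply Hcmp; try lra.
  - now apply arc_opp.
  - intros t Ht. apply Hzdp. lra.
  - now apply arc_opp.
  - intros t Ht. specialize (Hxm (- t) ltac:(lra)). lra. }
(* [rho1] has minima at d < m < c, hence a maximum in between; as the energy of arc 1
   is the higher one, this maximum exceeds all values of [rho2]. *)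
assert (Hrd : rho1 d < 1).
{ destruct (Rlt_or_le (rho1 d) 1) as [|Hge]; [assumption|exfalso].
  assert (Hned := arc_rho_ne1 a b rho1 z1 d a H1 ltac:(lra) ltac:(lra) ltac:(lra) ltac:(lra)).
  destruct (arc_zero_sign a b rho1 z1 d H1 ltac:(lra) ltac:(lra) Hned) as [e [He Hed]].
  set (t := Rmax ((a + d) / 2) (d - e / 2)).
  assert (Ht : a < t < d).
  { unfold t. split; [apply Rlt_le_trans with ((a + d) / 2); [lra|apply Rmax_l]|apply Rmax_lub_lt; lra]. }
  assert (Hte : d - e / 2 <= t) by apply Rmax_r.
  specialize (Hed t). rewrite Rabs_left in Hed by lra. specialize (Hed ltac:(lra) ltac:(lra)).
  specialize (Hzdp t ltac:(lra)).
  assert (0 < z1 t); [|lra]. apply (pos_of_triple_prod _ _ _ Hed).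
  destruct Hge as [Hge|Hge]; [nra|lra]. }
destruct (arc_zero_sign a b rho1 z1 d H1 ltac:(lra) ltac:(lra) ltac:(lra)) as [e [He Hed]].
set (t := Rmin ((d + c) / 2) (d + e / 2)).
assert (Ht : d < t < c).
{ unfold t. split; [apply Rmin_glb_lt; lra|apply Rle_lt_trans with ((d + c) / 2); [apply Rmin_l|lra]]. }
assert (Hte : t <= d + e / 2) by apply Rmin_r.
specialize (Hed t). rewrite Rabs_pos_eq in Hed by lra. specialize (Hed ltac:(lra) ltac:(lra)).
assert (Hzt : 0 < z1 t) by (apply (pos_of_triple_prod _ _ _ Hed); nra).
destruct (first_zero z1 t c) as [w [Hw [Hzw Hzwp]]]; try lra; [intros; apply Hc|].
assert (Hrw := rho_gt1_at_max a b rho1 z1 t w H1 ltac:(lra) ltac:(lra) ltac:(lra) Hzwp Hzw).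
assert (HEw := energy_at_zero rho1 z1 w Hzw).
rewrite (energy_const _ _ _ _ w m H1) in HEw by lra.
assert (HE2 := energy_ge rho2 z2 w). rewrite (energy_const _ _ _ _ w m H2) in HE2 by lra.
assert (Hi := sub_ln_incr (rho1 w) (rho2 w) ltac:(lra) (Hlt w ltac:(lra))). lra.
Qed.

(** * From curves to polar arcs *)

Record curve := Curve { len : R; px : R -> R; py : R -> R; tx : R -> R; ty : R -> R }.

(* [kk] is the curvature by the shrinker equation k = - <gamma, nu>. *)
Definition kk (c : curve) (s : R) := px c s * ty c s - py c s * tx c s.
Definition gg (c : curve) (s : R) := px c s * tx c s + py c s * ty c s.
Definition rr (c : curve) (s : R) := px c s ^ 2 + py c s ^ 2.

Record shrinker (c : curve) : Prop := {
  len_pos : 0 < len c;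
  px_cont : forall s, continuous (px c) s;
  py_cont : forall s, continuous (py c) s;
  tx_cont : forall s, continuous (tx c) s;
  ty_cont : forall s, continuous (ty c) s;
  px_der : forall s, 0 < s < len c -> is_derive (px c) s (tx c s);
  py_der : forall s, 0 < s < len c -> is_derive (py c) s (ty c s);
  tx_der : forall s, 0 < s < len c -> is_derive (tx c) s (- kk c s * ty c s);
  ty_der : forall s, 0 < s < len c -> is_derive (ty c) s (kk c s * tx c s);
  t_unit : forall s, 0 <= s <= len c -> tx c s ^ 2 + ty c s ^ 2 = 1 }.

Definition rev (c : curve) : curve :=
  Curve (len c) (fun s => px c (len c - s)) (fun s => py c (len c - s))
    (fun s => - tx c (len c - s)) (fun s => - ty c (len c - s)).

Lemma kk_rev c s : kk (rev c) s = - kk c (len c - s).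
Proof. unfold kk. simpl. ring. Qed.

Lemma is_derive_reflect (f : R -> R) (l x d : R) :
  is_derive f (l - x) d -> is_derive (fun t => f (l - t)) x (- d).
Proof.
intros H. evar_last.
- apply (is_derive_comp f (fun t => l - t) x); [exact H|].
  apply (is_derive_minus (fun _ => l) (fun t => t)); [apply is_derive_const|apply is_derive_id].
- unfold scal, minus, plus, opp, zero, one; simpl. unfold mult; simpl. ring.
Qed.

Lemma continuous_reflect (f : R -> R) (l x : R) :
  (forall s, continuous f s) -> continuous (fun t => f (l - t)) x.
Proof.
intros H. apply (continuous_comp (fun t => l - t) f); [cont|apply H].
Qed.

Lemma shrinker_rev c : shrinker c -> shrinker (rev c).
Proof.
intros [H1 H2 H3 H4 H5 H6 H7 H8 H9 H10]. split; simpl.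
- exact H1.
- intros s. now apply continuous_reflect.
- intros s. now apply continuous_reflect.
- intros s. apply (continuous_opp (fun t => tx c (len c - t))). now apply continuous_reflect.
- intros s. apply (continuous_opp (fun t => ty c (len c - t))). now apply continuous_reflect.
- intros s Hs. apply is_derive_reflect, H6. lra.
- intros s Hs. apply is_derive_reflect, H7. lra.
- intros s Hs. rewrite kk_rev. evar_last.
  + apply (is_derive_opp (fun t => tx c (len c - t))), is_derive_reflect, H8. lra.
  + unfold opp; simpl. ring.
- intros s Hs. rewrite kk_rev. evar_last.
  + apply (is_derive_opp (fun t => ty c (len c - t))), is_derive_reflect, H9. lra.
  + unfold opp; simpl. ring.
- intros s Hs. assert (Hu := H10 (len c - s) ltac:(lra)). lra.
Qed.

Section one_curve.
Variable c : curve.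
Hypothesis Hc : shrinker c.

Lemma kk_cont s : continuous (kk c) s.
Proof.
unfold kk. pose proof (px_cont c Hc s). pose proof (py_cont c Hc s).
pose proof (tx_cont c Hc s). pose proof (ty_cont c Hc s). cont.
Qed.

Lemma gg_cont s : continuous (gg c) s.
Proof.
unfold gg. pose proof (px_cont c Hc s). pose proof (py_cont c Hc s).
pose proof (tx_cont c Hc s). pose proof (ty_cont c Hc s). cont.
Qed.

Lemma rr_cont s : continuous (rr c) s.
Proof.
unfold rr. pose proof (px_cont c Hc s). pose proof (py_cont c Hc s). cont.
Qed.

Ltac curve_derivs Hs :=
  pose proof (px_der c Hc _ Hs) as Hdx; pose proof (py_der c Hc _ Hs) as Hdy;
  pose proof (tx_der c Hc _ Hs) as Hdu; pose proof (ty_der c Hc _ Hs) as Hdv.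

Lemma kk_der s : 0 < s < len c -> is_derive (kk c) s (kk c s * gg c s).
Proof.
intros Hs. curve_derivs Hs. unfold kk at 1. auto_derive.
- repeat split; eexists; eassumption.
- derive_with Hdx. derive_with Hdy. derive_with Hdu. derive_with Hdv. unfold gg. ring.
Qed.

Lemma gg_der s : 0 < s < len c -> is_derive (gg c) s (1 - kk c s ^ 2).
Proof.
intros Hs. curve_derivs Hs. unfold gg. auto_derive.
- repeat split; eexists; eassumption.
- derive_with Hdx. derive_with Hdy. derive_with Hdu. derive_with Hdv.
  transitivity (tx c s ^ 2 + ty c s ^ 2 - kk c s ^ 2); [unfold kk; ring|].
  rewrite (t_unit c Hc s) by lra. reflexivity.
Qed.

Lemma rr_der s : 0 < s < len c -> is_derive (rr c) s (2 * gg c s).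
Proof.
intros Hs. curve_derivs Hs. unfold rr. auto_derive.
- repeat split; eexists; eassumption.
- derive_with Hdx. derive_with Hdy. unfold gg. ring.
Qed.

Lemma rr_eq s : 0 <= s <= len c -> rr c s = kk c s ^ 2 + gg c s ^ 2.
Proof.
intros Hs. unfold rr. replace (px c s ^ 2 + py c s ^ 2) with ((px c s ^ 2 + py c s ^ 2) * (tx c s ^ 2 + ty c s ^ 2)).
- unfold kk, gg. ring.
- rewrite (t_unit c Hc s Hs). ring.
Qed.

Lemma kk_exp_const s t :
  0 <= s <= len c -> 0 <= t <= len c ->
  kk c s * exp (- rr c s / 2) = kk c t * exp (- rr c t / 2).
Proof.
assert (H0 : forall s, 0 <= s <= len c -> kk c 0 * exp (- rr c 0 / 2) = kk c s * exp (- rr c s / 2)).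
{ clear s t. intros s Hs. apply (derive_zero_eq (fun u => kk c u * exp (- rr c u / 2))); [lra|..].
  - intros u Hu. pose proof (kk_cont u). pose proof (rr_cont u).
    apply (continuous_mult (kk c) (fun u => exp (- rr c u / 2))); [assumption|].
    apply (continuous_comp (fun u => - rr c u / 2) exp); [cont; lra|apply continuous_exp].
  - intros u Hu. pose proof (kk_der u ltac:(lra)) as Hd1. pose proof (rr_der u ltac:(lra)) as Hd2.
    auto_derive.
    + repeat split; eexists; eassumption.
    + derive_with Hd1. derive_with Hd2. field. }
intros Hs Ht. rewrite <- (H0 s Hs). now apply H0.
Qed.

Lemma kk_zero_all s t : 0 <= s <= len c -> 0 <= t <= len c -> kk c s = 0 -> kk c t = 0.
Proof.
intros Hs Ht Hk. assert (H := kk_exp_const s t Hs Ht). rewrite Hk, Rmult_0_l in H.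
assert (He := exp_pos (- rr c t / 2)). nra.
Qed.

Lemma kk_pos_all s t : 0 <= s <= len c -> 0 <= t <= len c -> 0 < kk c s -> 0 < kk c t.
Proof.
intros Hs Ht Hk. assert (H := kk_exp_const s t Hs Ht).
assert (He := exp_pos (- rr c t / 2)). assert (He' := exp_pos (- rr c s / 2)).
assert (0 < kk c t * exp (- rr c t / 2)) by nra. nra.
Qed.

Lemma straight s :
  0 <= s <= len c -> kk c 0 = 0 ->
  tx c s = tx c 0 /\ ty c s = ty c 0 /\ px c s = px c 0 + s * tx c 0 /\ py c s = py c 0 + s * ty c 0.
Proof.
intros Hs Hk.
assert (Hk0 : forall t, 0 <= t <= len c -> kk c t = 0).
{ intros t Ht. apply (kk_zero_all 0 t); [pose proof (len_pos c Hc); lra|exact Ht|exact Hk]. }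
assert (Htx : forall t, 0 <= t <= len c -> tx c 0 = tx c t).
{ intros t Ht. apply derive_zero_eq; [lra|intros; apply (tx_cont c Hc)|].
  intros u Hu. evar_last; [apply (tx_der c Hc); lra|]. rewrite Hk0 by lra. ring. }
assert (Hty : forall t, 0 <= t <= len c -> ty c 0 = ty c t).
{ intros t Ht. apply derive_zero_eq; [lra|intros; apply (ty_cont c Hc)|].
  intros u Hu. evar_last; [apply (ty_der c Hc); lra|]. rewrite Hk0 by lra. ring. }
split; [now rewrite <- Htx|]. split; [now rewrite <- Hty|]. split.
- assert (H : px c 0 - 0 * tx c 0 = px c s - s * tx c 0); [|lra].
  apply (derive_zero_eq (fun t => px c t - t * tx c 0)); [lra|..].
  + intros u Hu. pose proof (px_cont c Hc u). cont.
  + intros u Hu. pose proof (px_der c Hc u ltac:(lra)) as Hd. auto_derive; [eexists; eassumption|].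
    derive_with Hd. rewrite (Htx u) by lra. ring.
- assert (H : py c 0 - 0 * ty c 0 = py c s - s * ty c 0); [|lra].
  apply (derive_zero_eq (fun t => py c t - t * ty c 0)); [lra|..].
  + intros u Hu. pose proof (py_cont c Hc u). cont.
  + intros u Hu. pose proof (py_der c Hc u ltac:(lra)) as Hd. auto_derive; [eexists; eassumption|].
    derive_with Hd. rewrite (Hty u) by lra. ring.
Qed.

End one_curve.

(* The curve in polar coordinates, [sg] being the arclength as a function of the polar angle. *)
Record polar_arc (c : curve) (a b : R) (rho z sg : R -> R) : Prop := {
  polar_is_arc : arc a b rho z;
  polar_range : forall t, a <= t <= b -> 0 <= sg t <= len c;
  polar_x : forall t, a <= t <= b -> px c (sg t) = sqrt (rho t) * cos t;
  polar_y : forall t, a <= t <= b -> py c (sg t) = sqrt (rho t) * sin t;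
  polar_start : sg a = 0;
  polar_end : sg b = len c;
  polar_inj : forall t u, a <= t <= b -> a <= u <= b -> sg t = sg u -> t = u;
  polar_z_start : z a = gg c 0 / kk c 0;
  polar_z_end : z b = gg c (len c) / kk c (len c) }.

(** The polar angle is obtained by integrating k / |gamma|^2 from the prescribed initial value,
    which fixes a continuous branch. The arclength is then its inverse function. *)
Lemma polar_parametrization c a r0 :
  shrinker c -> 0 < kk c 0 -> 0 < r0 -> px c 0 = r0 * cos a -> py c 0 = r0 * sin a ->
  exists b rho z sg, polar_arc c a b rho z sg.
Proof.
intros Hc Hk0 Hr0 Hx0 Hy0. assert (Hl := len_pos c Hc).
assert (Hk : forall s, 0 <= s <= len c -> 0 < kk c s).
{ intros s Hs. apply (kk_pos_all c Hc 0 s); [lra|exact Hs|exact Hk0]. }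
assert (Hr : forall s, 0 <= s <= len c -> 0 < rr c s).
{ intros s Hs. specialize (Hk s Hs). rewrite (rr_eq c Hc) by exact Hs. nra. }
set (cl := clamp 0 (len c)).
assert (Hcl : forall s, 0 <= cl s <= len c) by (intros s; apply clamp_in; lra).
assert (Hclc : forall s, continuous cl s).
{ intros s. apply continuity_pt_filterlim. intros e He. exists e. split; [exact He|].
  intros y [_ Hy]. simpl in *. unfold R_dist in *. apply Rle_lt_trans with (2 := Hy). apply clamp_lip. }
set (h := fun s => kk c (cl s) / rr c (cl s)).
assert (Hhc : forall s, continuous h s).
{ intros s. apply (continuous_comp cl (fun s => kk c s / rr c s)); [apply Hclc|].
  pose proof (kk_cont c Hc (cl s)). pose proof (rr_cont c Hc (cl s)). specialize (Hr _ (Hcl s)). cont. lra. }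
assert (Hh : forall s, 0 < h s) by (intros s; apply Rdiv_lt_0_compat; [apply Hk|apply Hr]; apply Hcl).
assert (Hhs : forall s, 0 <= s <= len c -> h s = kk c s / rr c s) by (intros s Hs; unfold h, cl; now rewrite clamp_id).
set (f := fun s => a + RInt h 0 s).
assert (Hfd : forall s, is_derive f s (h s)).
{ intros s. unfold f. evar_last.
  - apply (is_derive_plus (fun _ => a) (RInt h 0)); [apply is_derive_const|].
    apply (is_derive_RInt h (RInt h 0) 0 s).
    + exists (mkposreal 1 Rlt_0_1). intros y _. apply (RInt_correct h), (ex_RInt_continuous h). intros t _. apply Hhc.
    + apply Hhc.
  - unfold plus, zero; simpl. ring. }
assert (Hfc : forall s, continuous f s).
{ intros s. apply (ex_derive_continuous (V := R_NormedModule)). eexists. apply Hfd. }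
assert (Hf0 : f 0 = a) by (unfold f; rewrite RInt_point; unfold zero; simpl; ring).
(* [C] and [D] are the components of the position along and across the direction [f s]. That [f] is
   the polar angle means [D = 0] and [C > 0]: the quotient [D ^ 2 / rr] is constant, and [C] cannot
   vanish together with [D]. *)
set (C := fun s => px c s * cos (f s) + py c s * sin (f s)).
set (D := fun s => - px c s * sin (f s) + py c s * cos (f s)).
assert (HCD : forall s, C s ^ 2 + D s ^ 2 = rr c s).
{ intros s. unfold C, D, rr.
  replace (px c s ^ 2 + py c s ^ 2) with ((px c s ^ 2 + py c s ^ 2) * (Rsqr (sin (f s)) + Rsqr (cos (f s)))).
  - unfold Rsqr. ring.
  - rewrite sin2_cos2. ring. }
assert (HCc : forall s, continuous C s).
{ intros s. unfold C. pose proof (px_cont c Hc s). pose proof (py_cont c Hc s). pose proof (Hfc s). cont. }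
assert (HD : forall s, 0 <= s <= len c -> D s = 0).
{ intros s Hs.
  assert (Heq : D 0 ^ 2 / rr c 0 = D s ^ 2 / rr c s).
  { apply (derive_zero_eq (fun s => D s ^ 2 / rr c s)); [lra|..].
    - intros u Hu. unfold D. pose proof (px_cont c Hc u). pose proof (py_cont c Hc u). pose proof (Hfc u).
      pose proof (rr_cont c Hc u). specialize (Hr u ltac:(lra)). cont. lra.
    - intros u Hu. specialize (Hr u ltac:(lra)). specialize (Hhs u ltac:(lra)).
      pose proof (px_der c Hc u ltac:(lra)) as Hdx. pose proof (py_der c Hc u ltac:(lra)) as Hdy.
      pose proof (rr_der c Hc u ltac:(lra)) as Hdr. pose proof (Hfd u) as Hdf.
      assert (HDd : is_derive D u (gg c u * D u / rr c u)).
      { unfold D at 1. auto_derive.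
        - repeat split; eexists; eassumption.
        - derive_with Hdx. derive_with Hdy. derive_with Hdf. rewrite Hhs.
          unfold D. unfold rr in *. unfold kk, gg. field. lra. }
      auto_derive.
      + repeat split; try (eexists; eassumption). lra.
      + derive_with HDd. derive_with Hdr. field. lra. }
  replace (D 0) with 0 in Heq by (unfold D; rewrite Hf0, Hx0, Hy0; ring).
  specialize (Hr s Hs).
  assert (D s ^ 2 = 0).
  { replace (D s ^ 2) with (D s ^ 2 / rr c s * rr c s) by (field; lra). rewrite <- Heq. unfold Rdiv. ring. }
  nra. }
assert (HC : forall s, 0 <= s <= len c -> 0 < C s).
{ intros s Hs. destruct (Rlt_or_le 0 (C s)) as [|Hle]; [assumption|exfalso].
  assert (HC0 : 0 < C 0).
  { unfold C. rewrite Hf0, Hx0, Hy0.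
    replace (r0 * cos a * cos a + r0 * sin a * sin a) with (r0 * (Rsqr (sin a) + Rsqr (cos a))) by (unfold Rsqr; ring).
    rewrite sin2_cos2. lra. }
  destruct (IVT_value C 0 0 s) as [t [Ht HCt]]; [lra|intros; apply HCc|lra|].
  assert (H := HCD t). rewrite HCt, (HD t) in H by lra. specialize (Hr t ltac:(lra)). lra. }
assert (HCr : forall s, 0 <= s <= len c -> C s = sqrt (rr c s)).
{ intros s Hs. rewrite <- HCD, (HD s Hs). replace (C s ^ 2 + 0 ^ 2) with (Rsqr (C s)) by (unfold Rsqr; ring).
  rewrite sqrt_Rsqr; [reflexivity|]. left. now apply HC. }
assert (Hpx : forall s, 0 <= s <= len c -> px c s = sqrt (rr c s) * cos (f s)).
{ intros s Hs. rewrite <- HCr by exact Hs.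
  transitivity (C s * cos (f s) - D s * sin (f s)); [|rewrite HD by exact Hs; ring].
  transitivity (px c s * (Rsqr (sin (f s)) + Rsqr (cos (f s)))); [rewrite sin2_cos2; ring|unfold C, D, Rsqr; ring]. }
assert (Hpy : forall s, 0 <= s <= len c -> py c s = sqrt (rr c s) * sin (f s)).
{ intros s Hs. rewrite <- HCr by exact Hs.
  transitivity (C s * sin (f s) + D s * cos (f s)); [|rewrite HD by exact Hs; ring].
  transitivity (py c s * (Rsqr (sin (f s)) + Rsqr (cos (f s)))); [rewrite sin2_cos2; ring|unfold C, D, Rsqr; ring]. }
destruct (inverse_function f h 0 (len c) Hl) as [g [Hgc [Hgab [Hfg [Hgf Hgd]]]]];
  [intros; apply Hfc|intros; apply Hfd|intros; apply Hh|].
rewrite Hf0 in Hfg, Hgd.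
assert (Hab : a < f (len c)).
{ rewrite <- Hf0. apply (derive_pos_lt f h); [exact Hl|intros; apply Hfc|intros; apply Hfd|intros; apply Hh]. }
assert (Hga : g a = 0) by (rewrite <- Hf0; apply Hgf; lra).
assert (Hgb : g (f (len c)) = len c) by (apply Hgf; lra).
assert (Hgin : forall t, a < t < f (len c) -> 0 < g t < len c).
{ intros t Ht. specialize (Hgab t). split.
  - destruct (proj1 Hgab) as [|He]; [assumption|]. specialize (Hfg t ltac:(lra)). rewrite <- He in Hfg. lra.
  - destruct (proj2 Hgab) as [|He]; [assumption|]. specialize (Hfg t ltac:(lra)). rewrite He in Hfg. lra. }
exists (f (len c)), (fun t => rr c (g t)), (fun t => gg c (g t) / kk c (g t)), g.
split.
- split.
  + exact Hab.
  + intros t. apply (continuous_comp g (rr c)); [apply Hgc|apply (rr_cont c Hc)].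
  + intros t. apply (continuous_comp g (fun s => gg c s / kk c s)); [apply Hgc|].
    pose proof (gg_cont c Hc (g t)). pose proof (kk_cont c Hc (g t)). specialize (Hk _ (Hgab t)). cont. lra.
  + intros t _. apply Hr, Hgab.
  + intros t Ht. specialize (Hgin t Ht). specialize (Hgd t Ht).
    specialize (Hk (g t) ltac:(lra)). specialize (Hr (g t) ltac:(lra)). rewrite Hhs in Hgd by lra.
    evar_last; [apply (is_derive_comp (rr c) g); [apply (rr_der c Hc); lra|exact Hgd]|].
    unfold scal; simpl. unfold mult; simpl. field. lra.
  + intros t Ht. specialize (Hgin t Ht). specialize (Hgd t Ht).
    specialize (Hk (g t) ltac:(lra)). specialize (Hr (g t) ltac:(lra)). rewrite Hhs in Hgd by lra.
    assert (Hz : is_derive (fun s => gg c s / kk c s) (g t) ((1 - rr c (g t)) / kk c (g t))).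
    { pose proof (gg_der c Hc (g t) ltac:(lra)) as Hdg. pose proof (kk_der c Hc (g t) ltac:(lra)) as Hdk.
      auto_derive; [repeat split; try (eexists; eassumption); lra|].
      derive_with Hdg. derive_with Hdk. rewrite (rr_eq c Hc) by lra. field. lra. }
    evar_last; [apply (is_derive_comp (fun s => gg c s / kk c s) g); [exact Hz|exact Hgd]|].
    unfold scal; simpl. unfold mult; simpl. rewrite (rr_eq c Hc) in Hr |- * by lra. field. lra.
- intros t _. apply Hgab.
- intros t Ht. rewrite Hpx by apply Hgab. now rewrite Hfg.
- intros t Ht. rewrite Hpy by apply Hgab. now rewrite Hfg.
- exact Hga.
- exact Hgb.
- intros t u Ht Hu He. rewrite <- (Hfg t Ht), <- (Hfg u Hu). now rewrite He.
- cbv beta. now rewrite Hga.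
- cbv beta. now rewrite Hgb.
Qed.

(** * Loops around the origin *)

Lemma same_direction x y : x < y -> cos x = cos y -> sin x = sin y ->
  exists n : nat, (1 <= n)%nat /\ y = x + 2 * PI * INR n.
Proof.
intros Hxy Hc Hs.
assert (H1 : cos (2 * ((y - x) / 2)) = 1).
{ replace (2 * ((y - x) / 2)) with (y - x) by field. rewrite cos_minus, <- Hc, <- Hs.
  rewrite <- (sin2_cos2 x). unfold Rsqr. ring. }
rewrite cos_2a_sin in H1.
assert (H0 : sin ((y - x) / 2) = 0) by nra.
apply sin_eq_0_0 in H0. destruct H0 as [k Hk].
pose proof PI_RGT_0.
assert (Hkp : (0 < k)%Z). { apply lt_IZR. nra. }
exists (Z.to_nat k). split; [lia|].
rewrite INR_IZR_INZ, Z2Nat.id by lia. lra.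
Qed.

Lemma polar_coordinates x y : 0 < x ^ 2 + y ^ 2 ->
  exists r a, 0 < r /\ x = r * cos a /\ y = r * sin a.
Proof.
intros H. set (r := sqrt (x ^ 2 + y ^ 2)).
assert (Hr : 0 < r) by (apply sqrt_lt_R0; exact H).
assert (Hrr : r * r = x ^ 2 + y ^ 2) by (apply sqrt_sqrt; lra).
assert (Hx : -1 <= x / r <= 1).
{ assert (Hq : x / r * (x / r) <= 1).
  { apply (Rmult_le_reg_r (r * r)); [nra|].
    replace (x / r * (x / r) * (r * r)) with (x ^ 2) by (field; lra). nra. }
  set (q := x / r) in *. split; nra. }
assert (Hs : sin (acos (x / r)) = Rabs y / r).
{ rewrite sin_acos by exact Hx. apply sqrt_lem_1.
  - assert ((x / r) ^ 2 <= 1) by nra. unfold Rsqr. nra.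
  - apply Rdiv_le_0_compat; [apply Rabs_pos|exact Hr].
  - unfold Rsqr. replace (Rabs y / r * (Rabs y / r)) with (Rabs y * Rabs y / (r * r)) by (field; lra).
    replace (Rabs y * Rabs y) with (y ^ 2) by (rewrite <- Rabs_mult, Rabs_pos_eq; nra).
    replace (x / r * (x / r)) with (x ^ 2 / (r * r)) by (field; lra).
    rewrite Hrr. field. lra. }
assert (Hc : cos (acos (x / r)) = x / r) by (apply cos_acos; exact Hx).
destruct (Rle_or_lt 0 y) as [Hy|Hy].
- exists r, (acos (x / r)). rewrite Hc, Hs, Rabs_pos_eq by exact Hy. repeat split; [exact Hr|field; lra|field; lra].
- exists r, (- acos (x / r)). rewrite cos_neg, sin_neg, Hc, Hs, Rabs_left by exact Hy.
  repeat split; [exact Hr|field; lra|field; lra].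
Qed.

Lemma polar_eq r1 r2 x y :
  0 < r1 -> 0 < r2 -> sqrt r1 * cos x = sqrt r2 * cos y -> sqrt r1 * sin x = sqrt r2 * sin y ->
  r1 = r2 /\ cos x = cos y /\ sin x = sin y.
Proof.
intros H1 H2 Hc Hs.
assert (E1 := sqrt_sqrt r1 ltac:(lra)). assert (E2 := sqrt_sqrt r2 ltac:(lra)).
assert (P1 : 0 < sqrt r1) by (apply sqrt_lt_R0; exact H1).
assert (P2 : 0 < sqrt r2) by (apply sqrt_lt_R0; exact H2).
assert (Hr : r1 = r2).
{ transitivity ((sqrt r1 * cos x) ^ 2 + (sqrt r1 * sin x) ^ 2).
  - transitivity (sqrt r1 * sqrt r1 * (Rsqr (sin x) + Rsqr (cos x))); [rewrite sin2_cos2; lra|unfold Rsqr; ring].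
  - rewrite Hc, Hs. transitivity (sqrt r2 * sqrt r2 * (Rsqr (sin y) + Rsqr (cos y))); [unfold Rsqr; ring|rewrite sin2_cos2; lra]. }
subst r2. split; [reflexivity|]. split; apply (Rmult_eq_reg_l (sqrt r1)); lra.
Qed.

Lemma continuous_Rmin_const b x : continuous (fun t => Rmin t b) x.
Proof.
apply continuity_pt_filterlim. intros e He. exists e. split; [exact He|].
intros y [_ Hy]. simpl in *. unfold R_dist in *. apply Rle_lt_trans with (2 := Hy).
unfold Rmin. repeat destruct Rle_dec; unfold Rabs; repeat destruct Rcase_abs; lra.
Qed.

Lemma continuous_Rmax_const b x : continuous (fun t => Rmax t b) x.
Proof.
apply continuity_pt_filterlim. intros e He. exists e. split; [exact He|].
intros y [_ Hy]. simpl in *. unfold R_dist in *. apply Rle_lt_trans with (2 := Hy).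
unfold Rmax. repeat destruct Rle_dec; unfold Rabs; repeat destruct Rcase_abs; lra.
Qed.

Definition same_point (c d : curve) (s t : R) := px c s = px d t /\ py c s = py d t.
Definition injective_curve (c : curve) :=
  forall s t, 0 <= s <= len c -> 0 <= t <= len c -> same_point c c s t -> s = t.

(** Used with [f] the radius or its opposite and [p] one turn: a loop whose radius grows at every
    turn cannot close up. *)
Lemma no_shift_increasing (f : R -> R) (a p : R) (n : nat) :
  0 < p -> (1 <= n)%nat ->
  (forall t, a <= t -> t + p <= a + p * INR n -> f t < f (t + p)) -> f a < f (a + p * INR n).
Proof.
intros Hp Hn H.
assert (Hk : forall k, (1 <= k)%nat -> (k <= n)%nat -> f a < f (a + p * INR k)).
{ induction k as [|k IH]; [lia|]. intros _ Hkn.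
  assert (Hle : INR (S k) <= INR n) by (apply le_INR; exact Hkn).
  rewrite S_INR in *. pose proof (pos_INR k).
  assert (Hs := H (a + p * INR k) ltac:(nra) ltac:(nra)).
  replace (a + p * INR k + p) with (a + p * (INR k + 1)) in Hs by ring.
  destruct k as [|k].
  - simpl in *. rewrite Rmult_0_r, Rplus_0_r in Hs. exact Hs.
  - specialize (IH ltac:(lia) ltac:(lia)). lra. }
apply Hk; [exact Hn|lia].
Qed.

(* Comparing the radius at [t] and at [t + 2 PI] shows that a simple closed curve
   along which the polar angle increases winds only once around the origin. *)
Lemma simple_loop_one_turn c1 c3 a b e rho1 z1 sg1 rho3 z3 sg3 :
  polar_arc c1 a b rho1 z1 sg1 -> polar_arc c3 b e rho3 z3 sg3 ->
  injective_curve c1 -> injective_curve c3 ->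
  same_point c1 c3 0 (len c3) -> same_point c1 c3 (len c1) 0 ->
  (forall s t, 0 <= s <= len c1 -> 0 <= t <= len c3 -> same_point c1 c3 s t ->
    (s = 0 /\ t = len c3) \/ (s = len c1 /\ t = 0)) ->
  e = a + 2 * PI.
Proof.
intros H1 H3 Hi1 Hi3 HA HB Hdis.
assert (G1 := polar_is_arc _ _ _ _ _ _ H1). assert (G3 := polar_is_arc _ _ _ _ _ _ H3).
assert (Hab := arc_lt _ _ _ _ G1). assert (Hbe := arc_lt _ _ _ _ G3). pose proof PI_RGT_0 as HPI.
assert (HeA : rho1 a = rho3 e /\ cos a = cos e /\ sin a = sin e).
{ apply polar_eq; [apply (arc_pos _ _ _ _ G1); lra|apply (arc_pos _ _ _ _ G3); lra|..].
  - rewrite <- (polar_x _ _ _ _ _ _ H1), <- (polar_x _ _ _ _ _ _ H3) by lra.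
    rewrite (polar_start _ _ _ _ _ _ H1), (polar_end _ _ _ _ _ _ H3). apply HA.
  - rewrite <- (polar_y _ _ _ _ _ _ H1), <- (polar_y _ _ _ _ _ _ H3) by lra.
    rewrite (polar_start _ _ _ _ _ _ H1), (polar_end _ _ _ _ _ _ H3). apply HA. }
assert (HeB : rho1 b = rho3 b).
{ apply (polar_eq (rho1 b) (rho3 b) b b); [apply (arc_pos _ _ _ _ G1); lra|apply (arc_pos _ _ _ _ G3); lra|..].
  - rewrite <- (polar_x _ _ _ _ _ _ H1), <- (polar_x _ _ _ _ _ _ H3) by lra.
    rewrite (polar_end _ _ _ _ _ _ H1), (polar_start _ _ _ _ _ _ H3). apply HB.
  - rewrite <- (polar_y _ _ _ _ _ _ H1), <- (polar_y _ _ _ _ _ _ H3) by lra.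
    rewrite (polar_end _ _ _ _ _ _ H1), (polar_start _ _ _ _ _ _ H3). apply HB. }
destruct HeA as [HeR [Hec Hes]].
destruct (same_direction a e ltac:(lra) Hec Hes) as [n [Hn He]].
destruct (Nat.eq_dec n 1) as [->|Hn1]; [simpl in He; lra|exfalso].
assert (Hn2 : 2 <= INR n). { replace 2 with (INR 2) by (simpl; ring). apply le_INR. lia. }
(* The radii of the two arcs are glued at [b], where they agree, into one continuous function. *)
set (R0 := fun t => rho1 (Rmin t b) + rho3 (Rmax t b) - rho3 b).
assert (R0l : forall t, t <= b -> R0 t = rho1 t).
{ intros t Ht. unfold R0. rewrite Rmin_left, Rmax_right by lra. lra. }
assert (R0r : forall t, b <= t -> R0 t = rho3 t).
{ intros t Ht. unfold R0. rewrite Rmin_right, Rmax_left by lra. lra. }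
assert (R0c : forall t, continuous R0 t).
{ intros t. unfold R0. apply (continuous_minus (fun t => rho1 (Rmin t b) + rho3 (Rmax t b)) (fun _ => rho3 b)); [|apply continuous_const].
  apply (continuous_plus (fun t => rho1 (Rmin t b)) (fun t => rho3 (Rmax t b))).
  - apply (continuous_comp (fun t => Rmin t b) rho1); [apply continuous_Rmin_const|apply (arc_crho _ _ _ _ G1)].
  - apply (continuous_comp (fun t => Rmax t b) rho3); [apply continuous_Rmax_const|apply (arc_crho _ _ _ _ G3)]. }
(* Equal radii at polar angles differing by [2 * PI] give a double point of the loop. The only
   permitted one, at its closing point, would need [t = a] and [t + 2 * PI = e], which fails for two
   or more turns. *)
assert (Hnz : forall t, a <= t -> t + 2 * PI <= e -> R0 (t + 2 * PI) <> R0 t).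
{ intros t Hta Hte Heq.
  assert (Hcos : cos (t + 2 * PI) = cos t) by (rewrite cos_plus, cos_2PI, sin_2PI; ring).
  assert (Hsin : sin (t + 2 * PI) = sin t) by (rewrite sin_plus, cos_2PI, sin_2PI; ring).
  destruct (Rle_or_lt (t + 2 * PI) b) as [Hc|Hc]; [|destruct (Rle_or_lt t b) as [Hc'|Hc']].
  - rewrite !R0l in Heq by lra.
    enough (t = t + 2 * PI) by lra.
    apply (polar_inj _ _ _ _ _ _ H1); [lra|lra|].
    apply Hi1; [apply (polar_range _ _ _ _ _ _ H1); lra|apply (polar_range _ _ _ _ _ _ H1); lra|].
    split.
    + rewrite !(polar_x _ _ _ _ _ _ H1) by lra. now rewrite Heq, Hcos.
    + rewrite !(polar_y _ _ _ _ _ _ H1) by lra. now rewrite Heq, Hsin.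
  - rewrite R0r, R0l in Heq by lra.
    destruct (Hdis (sg1 t) (sg3 (t + 2 * PI))) as [[Hs1 Hs2]|[Hs1 Hs2]].
    + apply (polar_range _ _ _ _ _ _ H1). lra.
    + apply (polar_range _ _ _ _ _ _ H3). lra.
    + split.
      * rewrite (polar_x _ _ _ _ _ _ H1), (polar_x _ _ _ _ _ _ H3) by lra. now rewrite Heq, Hcos.
      * rewrite (polar_y _ _ _ _ _ _ H1), (polar_y _ _ _ _ _ _ H3) by lra. now rewrite Heq, Hsin.
    + assert (t = a).
      { apply (polar_inj _ _ _ _ _ _ H1); [lra|lra|]. now rewrite (polar_start _ _ _ _ _ _ H1). }
      assert (t + 2 * PI = e).
      { apply (polar_inj _ _ _ _ _ _ H3); [lra|lra|]. now rewrite (polar_end _ _ _ _ _ _ H3). }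
      nra.
    + assert (t + 2 * PI = b).
      { apply (polar_inj _ _ _ _ _ _ H3); [lra|lra|]. now rewrite (polar_start _ _ _ _ _ _ H3). }
      lra.
  - rewrite !R0r in Heq by lra.
    enough (t = t + 2 * PI) by lra.
    apply (polar_inj _ _ _ _ _ _ H3); [lra|lra|].
    apply Hi3; [apply (polar_range _ _ _ _ _ _ H3); lra|apply (polar_range _ _ _ _ _ _ H3); lra|].
    split.
    + rewrite !(polar_x _ _ _ _ _ _ H3) by lra. now rewrite Heq, Hcos.
    + rewrite !(polar_y _ _ _ _ _ _ H3) by lra. now rewrite Heq, Hsin. }
set (g := fun t => R0 (t + 2 * PI) - R0 t).
assert (Hgc : forall t, continuous g t).
{ intros t. unfold g. apply (continuous_minus (fun t => R0 (t + 2 * PI)) R0); [|apply R0c].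
  apply (continuous_comp (fun t => t + 2 * PI) R0); [cont|apply R0c]. }
assert (Hend : R0 a = R0 e) by (rewrite R0l, R0r by lra; exact HeR).
assert (Hae : a + 2 * PI <= e) by nra.
assert (Hsame : forall t, a <= t -> t + 2 * PI <= e -> 0 < g a * g t).
{ intros t Ht Hte. destruct (Rlt_or_le 0 (g a * g t)) as [|Hle]; [assumption|exfalso].
  destruct (IVT_value g 0 a t) as [w [Hw Hgw]]; [exact Ht|intros; apply Hgc| |].
  - destruct (Rle_or_lt (g a) 0); destruct (Rle_or_lt (g t) 0); try (left; lra); try (right; lra).
    + assert (Hga : g a <> 0) by (unfold g; intros Hz; apply (Hnz a); lra).
      assert (Hgt : g t <> 0) by (unfold g; intros Hz; apply (Hnz t); lra). exfalso. assert (g a < 0) by lra. assert (g t < 0) by lra. nra.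
    + exfalso. nra.
  - apply (Hnz w); [lra|lra|]. unfold g in Hgw. lra. }
destruct (Rlt_or_le 0 (g a)) as [Hga|Hga].
- assert (Hi := no_shift_increasing R0 a (2 * PI) n ltac:(lra) Hn).
  rewrite <- He in Hi. enough (R0 a < R0 e) by lra. apply Hi.
  intros t Ht Hte. specialize (Hsame t Ht Hte). unfold g in *. nra.
- assert (Hi := no_shift_increasing (fun t => - R0 t) a (2 * PI) n ltac:(lra) Hn).
  rewrite <- He in Hi. simpl in Hi. enough (- R0 a < - R0 e) by lra. apply Hi.
  intros t Ht Hte. specialize (Hsame t Ht Hte). unfold g in *. nra.
Qed.

(** [ln rho2 - ln rho1] has derivative [2 * (z2 - z1)] and vanishes at both ends. It becomes
    positive right after [a], has no zero inside, and so cannot be increasing just before [b]. *)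
Lemma nested_arcs a b rho1 z1 rho2 z2 :
  arc a b rho1 z1 -> arc a b rho2 z2 ->
  rho1 a = rho2 a -> rho1 b = rho2 b -> z1 a < z2 a ->
  (forall t, a < t < b -> rho1 t <> rho2 t) ->
  (forall t, a < t < b -> rho1 t < rho2 t) /\ z2 b <= z1 b.
Proof.
intros H1 H2 Ha Hb Hz Hne. assert (Hab := arc_lt _ _ _ _ H1).
assert (Hp1 := arc_pos _ _ _ _ H1). assert (Hp2 := arc_pos _ _ _ _ H2).
set (D := fun t => ln (rho2 t) - ln (rho1 t)).
assert (HDc : forall t, a <= t <= b -> continuous D t).
{ intros t Ht. unfold D. pose proof (arc_crho _ _ _ _ H1 t). pose proof (arc_crho _ _ _ _ H2 t).
  specialize (Hp1 t Ht). specialize (Hp2 t Ht). cont. }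
assert (HDd : forall t, a < t < b -> is_derive D t (2 * (z2 t - z1 t))).
{ intros t Ht. unfold D. pose proof (arc_drho _ _ _ _ H1 t Ht) as Hd1. pose proof (arc_drho _ _ _ _ H2 t Ht) as Hd2.
  specialize (Hp1 t ltac:(lra)). specialize (Hp2 t ltac:(lra)).
  auto_derive; [repeat split; try (eexists; eassumption); lra|].
  derive_with Hd1. derive_with Hd2. field. lra. }
assert (HD0 : forall t, a <= t <= b -> D t = 0 -> rho1 t = rho2 t).
{ intros t Ht HDt. symmetry. apply ln_inv; [now apply Hp2|now apply Hp1|unfold D in HDt; lra]. }
assert (HDab : D a = 0 /\ D b = 0) by (unfold D; rewrite Ha, Hb; split; ring).
assert (Hzc : forall t, continuous (fun t => z2 t - z1 t) t).
{ intros t. pose proof (arc_cz _ _ _ _ H1 t). pose proof (arc_cz _ _ _ _ H2 t). cont. }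
assert (Hpos : forall t, a < t < b -> 0 < D t).
{ intros t Ht.
  destruct (continuous_pos_near (fun t => z2 t - z1 t) a (Hzc a) ltac:(lra)) as [d [Hd Hn]].
  set (s := Rmin t (a + d / 2)).
  assert (Hs : a < s <= t) by (unfold s; split; [apply Rmin_glb_lt; lra|apply Rmin_l]).
  assert (Hsd : s <= a + d / 2) by apply Rmin_r.
  assert (HDs : D a < D s).
  { apply (derive_pos_lt D (fun t => 2 * (z2 t - z1 t))); [lra|intros; apply HDc; lra|intros; apply HDd; lra|].
    intros x Hx. specialize (Hn x). rewrite Rabs_pos_eq in Hn by lra. specialize (Hn ltac:(lra)). lra. }
  destruct (Rlt_or_le 0 (D t)) as [|Hle]; [assumption|exfalso].
  destruct (IVT_value D 0 s t) as [w [Hw HDw]]; [lra|intros; apply HDc; lra|lra|].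
  apply (Hne w); [lra|]. apply HD0; lra. }
split.
- intros t Ht. specialize (Hpos t Ht). unfold D in Hpos. apply ln_lt_inv; [apply Hp1; lra|apply Hp2; lra|lra].
- destruct (Rle_or_lt (z2 b) (z1 b)) as [|Hlt]; [assumption|exfalso].
  destruct (continuous_pos_near (fun t => z2 t - z1 t) b (Hzc b) ltac:(lra)) as [d [Hd Hn]].
  set (s := Rmax ((a + b) / 2) (b - d / 2)).
  assert (Hs : (a + b) / 2 <= s < b) by (unfold s; split; [apply Rmax_l|apply Rmax_lub_lt; lra]).
  assert (Hsd : b - d / 2 <= s) by apply Rmax_r.
  assert (HDs : D s < D b).
  { apply (derive_pos_lt D (fun t => 2 * (z2 t - z1 t))); [lra|intros; apply HDc; lra|intros; apply HDd; lra|].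
    intros x Hx. specialize (Hn x). rewrite Rabs_left in Hn by lra. specialize (Hn ltac:(lra)). lra. }
  specialize (Hpos s ltac:(lra)). lra.
Qed.

Lemma atan_cos_sin k g r : 0 < k -> 0 < r -> k ^ 2 + g ^ 2 = r ^ 2 ->
  cos (atan (g / k)) = k / r /\ sin (atan (g / k)) = g / r.
Proof.
intros Hk Hr He.
assert (Hs : sqrt (1 + Rsqr (g / k)) = r / k).
{ apply sqrt_lem_1.
  - unfold Rsqr. nra.
  - apply Rdiv_le_0_compat; lra.
  - unfold Rsqr. replace (r / k * (r / k)) with (r ^ 2 / k ^ 2) by (field; lra). rewrite <- He. field. lra. }
rewrite cos_atan, sin_atan, Hs. split; field; lra.
Qed.

(** [g / r] and [k / r] are the components of the unit tangent along and across the radius, so the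
    difference of the arctangents is the angle between the tangents. Positivity of [k1] and [k2]
    keeps it below [PI], where the cosine determines it. *)
Lemma atan_gap k1 g1 k2 g2 r :
  0 < k1 -> 0 < k2 -> 0 < r -> k1 ^ 2 + g1 ^ 2 = r ^ 2 -> k2 ^ 2 + g2 ^ 2 = r ^ 2 ->
  k1 * k2 + g1 * g2 = - (r ^ 2 / 2) -> g1 / k1 <= g2 / k2 ->
  atan (g2 / k2) - atan (g1 / k1) = 2 * PI / 3.
Proof.
intros Hk1 Hk2 Hr H1 H2 Hd Hle. pose proof PI_RGT_0 as HPI.
destruct (atan_cos_sin k1 g1 r Hk1 Hr H1) as [C1 S1].
destruct (atan_cos_sin k2 g2 r Hk2 Hr H2) as [C2 S2].
assert (B1 := atan_bound (g1 / k1)). assert (B2 := atan_bound (g2 / k2)).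
assert (Hm : atan (g1 / k1) <= atan (g2 / k2)).
{ destruct Hle as [Hlt|He]; [left; now apply atan_increasing|rewrite He; lra]. }
apply cos_inj; [lra|lra|].
rewrite cos_minus, C1, S1, C2, S2.
replace (2 * PI / 3) with (2 * (PI / 3)) by field. rewrite cos_2PI3.
replace (k2 / r * (k1 / r) + g2 / r * (g1 / r)) with ((k1 * k2 + g1 * g2) / r ^ 2) by (field; lra).
rewrite Hd. field. lra.
Qed.

Lemma atan_neg_iff x : atan x < 0 -> x < 0.
Proof.
intros H. destruct (Rlt_or_le x 0) as [|Hge]; [assumption|exfalso].
destruct Hge as [Hlt|<-].
- apply atan_increasing in Hlt. rewrite atan_0 in Hlt. lra.
- rewrite atan_0 in H. lra.
Qed.

Lemma atan_pos_iff x : 0 < atan x -> 0 < x.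
Proof.
intros H. apply Ropp_lt_cancel. rewrite Ropp_0. apply atan_neg_iff. rewrite atan_opp. lra.
Qed.

(** * Nets of three curves and their exclusion *)

(* A Theta-shrinker all of whose curves run from A to B. *)
Record theta_net (A B : R * R) (c : index -> curve) : Prop := {
  net_shrinker : forall i, shrinker (c i);
  net_start : forall i, px (c i) 0 = fst A /\ py (c i) 0 = snd A;
  net_end : forall i, px (c i) (len (c i)) = fst B /\ py (c i) (len (c i)) = snd B;
  net_inj : forall i, injective_curve (c i);
  net_disjoint : forall i j s t, i <> j -> 0 <= s <= len (c i) -> 0 <= t <= len (c j) ->
    same_point (c i) (c j) s t -> (s = 0 /\ t = 0) \/ (s = len (c i) /\ t = len (c j));
  net_angle_start : forall i j, i <> j ->
    tx (c i) 0 * tx (c j) 0 + ty (c i) 0 * ty (c j) 0 = - (1 / 2);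
  net_angle_end : forall i j, i <> j ->
    tx (c i) (len (c i)) * tx (c j) (len (c j)) + ty (c i) (len (c i)) * ty (c j) (len (c j)) = - (1 / 2) }.

Lemma same_point_rev c d s t :
  same_point (rev c) (rev d) s t <-> same_point c d (len c - s) (len d - t).
Proof. reflexivity. Qed.

Lemma injective_curve_rev c : injective_curve c -> injective_curve (rev c).
Proof.
intros H s t Hs Ht He. simpl in Hs, Ht. apply same_point_rev in He.
apply H in He; lra.
Qed.

Lemma theta_net_rev A B c : theta_net A B c -> theta_net B A (fun i => rev (c i)).
Proof.
intros [H1 H2 H3 H4 H5 H6 H7]. split; simpl.
- intros i. now apply shrinker_rev.
- intros i. rewrite Rminus_0_r. apply H3.
- intros i. rewrite Rminus_diag. apply H2.
- intros i. now apply injective_curve_rev.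
- intros i j s t Hij Hs Ht He. apply same_point_rev in He.
  destruct (H5 i j (len (c i) - s) (len (c j) - t) Hij ltac:(lra) ltac:(lra) He) as [H|H]; [right|left]; lra.
- intros i j Hij. rewrite !Rminus_0_r. specialize (H7 i j Hij). lra.
- intros i j Hij. rewrite !Rminus_diag. specialize (H6 i j Hij). lra.
Qed.

Section net.
Variables (A B : R * R) (c : index -> curve).
Hypothesis Hnet : theta_net A B c.

(** Lagrange's identity: [gg] and [kk] are the dot and cross products of the tangents with the same
    vector A. *)
Lemma net_dot i j : kk (c i) 0 * kk (c j) 0 + gg (c i) 0 * gg (c j) 0 =
  (fst A ^ 2 + snd A ^ 2) * (tx (c i) 0 * tx (c j) 0 + ty (c i) 0 * ty (c j) 0).
Proof.
destruct (net_start _ _ _ Hnet i) as [X1 Y1]. destruct (net_start _ _ _ Hnet j) as [X2 Y2].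
unfold kk, gg. rewrite X1, X2, Y1, Y2. ring.
Qed.

Lemma net_dot_end i j :
  kk (c i) (len (c i)) * kk (c j) (len (c j)) + gg (c i) (len (c i)) * gg (c j) (len (c j)) =
  (fst B ^ 2 + snd B ^ 2) *
  (tx (c i) (len (c i)) * tx (c j) (len (c j)) + ty (c i) (len (c i)) * ty (c j) (len (c j))).
Proof.
destruct (net_end _ _ _ Hnet i) as [X1 Y1]. destruct (net_end _ _ _ Hnet j) as [X2 Y2].
unfold kk, gg. rewrite X1, X2, Y1, Y2. ring.
Qed.

Lemma net_len i : 0 < len (c i).
Proof. apply (len_pos _ (net_shrinker _ _ _ Hnet i)). Qed.

(** With A at the origin every curvature vanishes and the curves are straight. Then B is a positive
    multiple of two unit vectors whose dot product is negative. *)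
Lemma origin_not_junction : 0 < fst A ^ 2 + snd A ^ 2.
Proof.
destruct (Rlt_or_le 0 (fst A ^ 2 + snd A ^ 2)) as [|Hle]; [assumption|exfalso].
assert (HA : fst A = 0 /\ snd A = 0) by nra.
assert (Hs : forall i, fst B = len (c i) * tx (c i) 0 /\ snd B = len (c i) * ty (c i) 0).
{ intros i. assert (Hl := net_len i).
  destruct (net_start _ _ _ Hnet i) as [X1 Y1]. destruct (net_end _ _ _ Hnet i) as [X2 Y2].
  destruct (straight (c i) (net_shrinker _ _ _ Hnet i) (len (c i))) as [_ [_ [X Y]]]; [lra| |].
  - unfold kk. rewrite X1, Y1. destruct HA as [-> ->]. ring.
  - lra. }
destruct (Hs i1) as [X1 Y1]. destruct (Hs i2) as [X2 Y2].
assert (Ha := net_angle_start _ _ _ Hnet i1 i2 ltac:(discriminate)).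
assert (L1 := net_len i1). assert (L2 := net_len i2).
assert (HBB : fst B * fst B + snd B * snd B = len (c i1) * len (c i2) * - (1 / 2)).
{ rewrite <- Ha. rewrite X1 at 1. rewrite X2 at 1. rewrite Y1 at 1. rewrite Y2 at 1. ring. }
assert (0 < len (c i1) * len (c i2)) by nra. nra.
Qed.

(* Two curves leaving A on opposite sides form a loop around the origin. *)
Lemma opposite_curves i m a r :
  i <> m -> 0 < kk (c i) 0 -> kk (c m) 0 < 0 -> 0 < r -> fst A = r * cos a -> snd A = r * sin a ->
  exists b rho z sg, polar_arc (c i) a b rho z sg /\ b < a + 2 * PI.
Proof.
intros Him Hi Hm Hr HAx HAy.
assert (Si := net_shrinker _ _ _ Hnet i). assert (Sm := net_shrinker _ _ _ Hnet m).
destruct (net_start _ _ _ Hnet i) as [X1 Y1]. destruct (net_end _ _ _ Hnet i) as [X2 Y2].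
destruct (net_start _ _ _ Hnet m) as [X3 Y3]. destruct (net_end _ _ _ Hnet m) as [X4 Y4].
assert (Lm := net_len m). assert (Li := net_len i).
destruct (polar_parametrization (c i) a r Si Hi Hr) as [b [rho [z [sg Hp]]]]; [lra|lra|].
assert (Ga := polar_is_arc _ _ _ _ _ _ Hp). assert (Hab := arc_lt _ _ _ _ Ga).
assert (HBx : fst B = sqrt (rho b) * cos b).
{ rewrite <- X2, <- (polar_end _ _ _ _ _ _ Hp). apply (polar_x _ _ _ _ _ _ Hp). lra. }
assert (HBy : snd B = sqrt (rho b) * sin b).
{ rewrite <- Y2, <- (polar_end _ _ _ _ _ _ Hp). apply (polar_y _ _ _ _ _ _ Hp). lra. }
(* Run backwards, curve [m] has positive curvature, so the polar angle keeps increasing along the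
   loop from A through [i] to B and back to A. *)
assert (Hkm : 0 < kk (rev (c m)) 0).
{ rewrite kk_rev, Rminus_0_r.
  destruct (Rtotal_order (kk (c m) (len (c m))) 0) as [Hlt|[He|Hgt]]; [lra|exfalso|exfalso].
  - assert (kk (c m) 0 = 0) by (apply (kk_zero_all _ Sm (len (c m)) 0); lra). lra.
  - assert (0 < kk (c m) 0) by (apply (kk_pos_all _ Sm (len (c m)) 0); lra). lra. }
destruct (polar_parametrization (rev (c m)) b (sqrt (rho b)) (shrinker_rev _ Sm) Hkm) as [e [rho3 [z3 [sg3 Hp3]]]].
- apply sqrt_lt_R0, (arc_pos _ _ _ _ Ga). lra.
- simpl. rewrite Rminus_0_r. lra.
- simpl. rewrite Rminus_0_r. lra.
- exists b, rho, z, sg. split; [exact Hp|].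
  assert (Hbe := arc_lt _ _ _ _ (polar_is_arc _ _ _ _ _ _ Hp3)).
  enough (e = a + 2 * PI) by lra.
  apply (simple_loop_one_turn _ _ _ _ _ _ _ _ _ _ _ Hp Hp3).
  + apply (net_inj _ _ _ Hnet).
  + apply injective_curve_rev, (net_inj _ _ _ Hnet).
  + unfold same_point. simpl. rewrite Rminus_diag. split; lra.
  + unfold same_point. simpl. rewrite Rminus_0_r. split; lra.
  + intros s t Hs Ht [Ex Ey]. simpl in *.
    destruct (net_disjoint _ _ _ Hnet i m s (len (c m) - t) Him Hs ltac:(lra) (conj Ex Ey)); [left|right]; lra.
Qed.

Lemma unit_sq i : kk (c i) 0 ^ 2 + gg (c i) 0 ^ 2 = fst A ^ 2 + snd A ^ 2.
Proof.
destruct (net_start _ _ _ Hnet i) as [X1 Y1]. assert (L := net_len i).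
rewrite <- (rr_eq _ (net_shrinker _ _ _ Hnet i)) by lra. unfold rr. now rewrite X1, Y1.
Qed.

Lemma unit_sq_end i : kk (c i) (len (c i)) ^ 2 + gg (c i) (len (c i)) ^ 2 = fst B ^ 2 + snd B ^ 2.
Proof.
destruct (net_end _ _ _ Hnet i) as [X1 Y1]. assert (L := net_len i).
rewrite <- (rr_eq _ (net_shrinker _ _ _ Hnet i)) by lra. unfold rr. now rewrite X1, Y1.
Qed.

Lemma no_curved_net_ordered i j m :
  i <> j -> i <> m -> j <> m -> 0 < kk (c i) 0 -> 0 < kk (c j) 0 -> kk (c m) 0 < 0 ->
  gg (c i) 0 / kk (c i) 0 <= gg (c j) 0 / kk (c j) 0 -> False.
Proof.
intros Hij Him Hjm Ki Kj Km Hz. pose proof PI_RGT_0 as HPI.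
destruct (polar_coordinates _ _ origin_not_junction) as [r [a [Hr [HAx HAy]]]].
assert (HAr : fst A ^ 2 + snd A ^ 2 = r ^ 2).
{ rewrite HAx, HAy. transitivity (r ^ 2 * (Rsqr (sin a) + Rsqr (cos a))); [unfold Rsqr; ring|rewrite sin2_cos2; ring]. }
destruct (opposite_curves i m a r Him Ki Km Hr HAx HAy) as [b [rho1 [z1 [sg1 [P1 Hb1]]]]].
destruct (opposite_curves j m a r Hjm Kj Km Hr HAx HAy) as [b' [rho2 [z2 [sg2 [P2 Hb2]]]]].
assert (G1 := polar_is_arc _ _ _ _ _ _ P1). assert (G2 := polar_is_arc _ _ _ _ _ _ P2).
assert (Hab := arc_lt _ _ _ _ G1). assert (Hab' := arc_lt _ _ _ _ G2).
destruct (net_start _ _ _ Hnet i) as [Xi Yi]. destruct (net_end _ _ _ Hnet i) as [Xi' Yi'].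
destruct (net_start _ _ _ Hnet j) as [Xj Yj]. destruct (net_end _ _ _ Hnet j) as [Xj' Yj'].
assert (HB : rho1 b = rho2 b' /\ cos b = cos b' /\ sin b = sin b').
{ apply polar_eq; [apply (arc_pos _ _ _ _ G1); lra|apply (arc_pos _ _ _ _ G2); lra|..].
  - rewrite <- (polar_x _ _ _ _ _ _ P1), <- (polar_x _ _ _ _ _ _ P2) by lra.
    rewrite (polar_end _ _ _ _ _ _ P1), (polar_end _ _ _ _ _ _ P2). lra.
  - rewrite <- (polar_y _ _ _ _ _ _ P1), <- (polar_y _ _ _ _ _ _ P2) by lra.
    rewrite (polar_end _ _ _ _ _ _ P1), (polar_end _ _ _ _ _ _ P2). lra. }
destruct HB as [HrB [HcB HsB]].
(* Both are polar angles of B between [a] and [a + 2 * PI], too close together to differ by a full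
   turn. *)
assert (Hbb : b' = b).
{ destruct (Rtotal_order b b') as [Hlt|[He|Hgt]]; [exfalso|lra|exfalso].
  - destruct (same_direction b b' Hlt HcB HsB) as [n [Hn He]]. apply le_INR in Hn. simpl in Hn. nra.
  - destruct (same_direction b' b Hgt (eq_sym HcB) (eq_sym HsB)) as [n [Hn He]]. apply le_INR in Hn. simpl in Hn. nra. }
subst b'.
assert (HrA : rho1 a = rho2 a).
{ apply (polar_eq (rho1 a) (rho2 a) a a); [apply (arc_pos _ _ _ _ G1); lra|apply (arc_pos _ _ _ _ G2); lra|..].
  - rewrite <- (polar_x _ _ _ _ _ _ P1), <- (polar_x _ _ _ _ _ _ P2) by lra.
    rewrite (polar_start _ _ _ _ _ _ P1), (polar_start _ _ _ _ _ _ P2). lra.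
  - rewrite <- (polar_y _ _ _ _ _ _ P1), <- (polar_y _ _ _ _ _ _ P2) by lra.
    rewrite (polar_start _ _ _ _ _ _ P1), (polar_start _ _ _ _ _ _ P2). lra. }
assert (HB2 : fst B ^ 2 + snd B ^ 2 = sqrt (rho1 b) ^ 2).
{ rewrite <- Xi', <- Yi', <- (polar_end _ _ _ _ _ _ P1), (polar_x _ _ _ _ _ _ P1), (polar_y _ _ _ _ _ _ P1) by lra.
  transitivity (sqrt (rho1 b) ^ 2 * (Rsqr (sin b) + Rsqr (cos b))); [unfold Rsqr; ring|rewrite sin2_cos2; ring]. }
assert (HrbP : 0 < sqrt (rho1 b)) by (apply sqrt_lt_R0, (arc_pos _ _ _ _ G1); lra).
assert (Li := net_len i). assert (Lj := net_len j).
assert (Ki' : 0 < kk (c i) (len (c i))) by (apply (kk_pos_all _ (net_shrinker _ _ _ Hnet i) 0); lra).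
assert (Kj' : 0 < kk (c j) (len (c j))) by (apply (kk_pos_all _ (net_shrinker _ _ _ Hnet j) 0); lra).
assert (gapA : atan (z2 a) - atan (z1 a) = 2 * PI / 3).
{ rewrite (polar_z_start _ _ _ _ _ _ P1), (polar_z_start _ _ _ _ _ _ P2).
  apply (atan_gap _ _ _ _ r); try assumption.
  - now rewrite unit_sq.
  - now rewrite unit_sq.
  - rewrite net_dot, (net_angle_start _ _ _ Hnet i j Hij), HAr. field. }
destruct (nested_arcs a b rho1 z1 rho2 z2 G1 G2 HrA HrB) as [Hnest Hzb].
{ destruct (Rlt_or_le (z1 a) (z2 a)) as [|[Hgt|He]]; [assumption|exfalso|exfalso].
  - apply atan_increasing in Hgt. lra.
  - rewrite He in gapA. lra. }
{ intros t Ht He.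
  assert (R1 := polar_range _ _ _ _ _ _ P1 t ltac:(lra)). assert (R2 := polar_range _ _ _ _ _ _ P2 t ltac:(lra)).
  destruct (net_disjoint _ _ _ Hnet i j (sg1 t) (sg2 t) Hij R1 R2) as [[H0 _]|[H0 _]].
  - split.
    + rewrite (polar_x _ _ _ _ _ _ P1), (polar_x _ _ _ _ _ _ P2), He by lra. reflexivity.
    + rewrite (polar_y _ _ _ _ _ _ P1), (polar_y _ _ _ _ _ _ P2), He by lra. reflexivity.
  - assert (t = a); [|lra]. apply (polar_inj _ _ _ _ _ _ P1); [lra|lra|]. now rewrite (polar_start _ _ _ _ _ _ P1).
  - assert (t = b); [|lra]. apply (polar_inj _ _ _ _ _ _ P1); [lra|lra|]. now rewrite (polar_end _ _ _ _ _ _ P1). }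
assert (gapB : atan (z1 b) - atan (z2 b) = 2 * PI / 3).
{ rewrite (polar_z_end _ _ _ _ _ _ P1), (polar_z_end _ _ _ _ _ _ P2) in Hzb |- *.
  apply (atan_gap _ _ _ _ (sqrt (rho1 b))); try assumption.
  - now rewrite unit_sq_end.
  - now rewrite unit_sq_end.
  - rewrite net_dot_end, (net_angle_end _ _ _ Hnet j i), HB2 by congruence. field. }
(* As arctangents lie strictly between -PI/2 and PI/2, a gap of 2 PI / 3 puts the larger one above
   PI/6 and the smaller one below -PI/6. The two gaps together also give theta-length(2) =
   theta-length(1) + 4 PI / 3. *)
assert (B1 := atan_bound (z1 a)). assert (B2 := atan_bound (z2 a)).
assert (B3 := atan_bound (z1 b)). assert (B4 := atan_bound (z2 b)).
assert (Hth := theta_lt a b rho1 z1 a b G1 ltac:(lra) Hab ltac:(lra)).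
apply (no_nested_arcs a b rho1 z1 rho2 z2 G1 G2 Hnest).
- apply atan_neg_iff. lra.
- apply atan_pos_iff. lra.
- lra.
- lra.
- unfold theta in *. lra.
Qed.

Lemma no_curved_net i j m :
  i <> j -> i <> m -> j <> m -> 0 < kk (c i) 0 -> 0 < kk (c j) 0 -> kk (c m) 0 < 0 -> False.
Proof.
intros Hij Him Hjm Ki Kj Km.
destruct (Rle_or_lt (gg (c i) 0 / kk (c i) 0) (gg (c j) 0 / kk (c j) 0)).
- now apply (no_curved_net_ordered i j m).
- apply (no_curved_net_ordered j i m); try assumption; [congruence|lra].
Qed.

(** The segment passes through the origin and leaves A along the inward radius, so the 120 degree
    condition puts the tangent of [j] at 60 degrees to the outward radius: [gg] is half the radius
    at A, and minus half of it at B. *)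
Lemma no_net_with_segment i j m :
  i <> j -> i <> m -> j <> m -> kk (c i) 0 = 0 -> 0 < kk (c j) 0 -> kk (c m) 0 < 0 -> False.
Proof.
intros Hij Him Hjm Ki Kj Km. pose proof PI_RGT_0 as HPI.
destruct (polar_coordinates _ _ origin_not_junction) as [r [a [Hr [HAx HAy]]]].
assert (HAr : fst A ^ 2 + snd A ^ 2 = r ^ 2).
{ rewrite HAx, HAy. transitivity (r ^ 2 * (Rsqr (sin a) + Rsqr (cos a))); [unfold Rsqr; ring|rewrite sin2_cos2; ring]. }
destruct (opposite_curves j m a r Hjm Kj Km Hr HAx HAy) as [b [rho [z [sg [P Hb]]]]].
assert (G := polar_is_arc _ _ _ _ _ _ P). assert (Hab := arc_lt _ _ _ _ G).
destruct (net_start _ _ _ Hnet i) as [Xi Yi]. destruct (net_end _ _ _ Hnet i) as [Xi' Yi'].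
destruct (net_end _ _ _ Hnet j) as [Xj' Yj'].
assert (Li := net_len i). assert (Lj := net_len j).
set (rb := sqrt (rho b)).
assert (HrbP : 0 < rb) by (apply sqrt_lt_R0, (arc_pos _ _ _ _ G); lra).
assert (HBx : fst B = rb * cos b).
{ rewrite <- Xj', <- (polar_end _ _ _ _ _ _ P). apply (polar_x _ _ _ _ _ _ P). lra. }
assert (HBy : snd B = rb * sin b).
{ rewrite <- Yj', <- (polar_end _ _ _ _ _ _ P). apply (polar_y _ _ _ _ _ _ P). lra. }
destruct (straight (c i) (net_shrinker _ _ _ Hnet i) (len (c i))) as [U [V [X Y]]]; [lra|exact Ki|].
assert (Hcross : sin (b - a) = 0).
{ unfold kk in Ki. rewrite Xi, Yi in Ki.
  assert (Hc : fst A * snd B - snd A * fst B = 0).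
  { rewrite <- Xi', <- Yi', X, Y, Xi, Yi.
    replace (fst A * (snd A + len (c i) * ty (c i) 0) - snd A * (fst A + len (c i) * tx (c i) 0))
      with (len (c i) * (fst A * ty (c i) 0 - snd A * tx (c i) 0)) by ring. rewrite Ki. ring. }
  rewrite sin_minus. rewrite HAx, HAy, HBx, HBy in Hc.
  apply (Rmult_eq_reg_l (r * rb)); [|nra]. rewrite Rmult_0_r. lra. }
(* Of the zeros of the sine, only [PI] lies strictly between 0 and [2 * PI]. *)
assert (Hba : b = a + PI).
{ destruct (sin_eq_O_2PI_0 (b - a) ltac:(lra) ltac:(lra) Hcross) as [H|[H|H]]; lra. }
assert (Hcb : cos b = - cos a) by (rewrite Hba; apply neg_cos).
assert (Hsb : sin b = - sin a) by (rewrite Hba; apply neg_sin).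
assert (Hsc := sin2_cos2 a). unfold Rsqr in Hsc.
assert (Htl : len (c i) * tx (c i) 0 = - (r + rb) * cos a /\ len (c i) * ty (c i) 0 = - (r + rb) * sin a).
{ rewrite Hcb in HBx. rewrite Hsb in HBy. split; lra. }
assert (Hlr : len (c i) = r + rb).
{ assert (Hu := t_unit _ (net_shrinker _ _ _ Hnet i) 0 ltac:(lra)).
  assert (len (c i) ^ 2 = (r + rb) ^ 2).
  { transitivity ((len (c i) * tx (c i) 0) ^ 2 + (len (c i) * ty (c i) 0) ^ 2).
    - transitivity (len (c i) ^ 2 * (tx (c i) 0 ^ 2 + ty (c i) 0 ^ 2)); [rewrite Hu; ring|ring].
    - destruct Htl as [-> ->]. transitivity ((r + rb) ^ 2 * (sin a * sin a + cos a * cos a)); [ring|rewrite Hsc; ring]. }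
  nra. }
assert (Htx : tx (c i) 0 = - cos a).
{ destruct Htl as [Htl _]. rewrite Hlr in Htl. apply (Rmult_eq_reg_l (r + rb)); lra. }
assert (Hty : ty (c i) 0 = - sin a).
{ destruct Htl as [_ Htl]. rewrite Hlr in Htl. apply (Rmult_eq_reg_l (r + rb)); lra. }
assert (HB2 : fst B ^ 2 + snd B ^ 2 = rb ^ 2).
{ rewrite HBx, HBy, Hcb, Hsb. transitivity (rb ^ 2 * (sin a * sin a + cos a * cos a)); [ring|rewrite Hsc; ring]. }
assert (Kj' : 0 < kk (c j) (len (c j))) by (apply (kk_pos_all _ (net_shrinker _ _ _ Hnet j) 0); lra).
assert (Hgj : gg (c j) 0 = r / 2).
{ assert (Hd := net_dot i j). rewrite Ki, (net_angle_start _ _ _ Hnet i j Hij), HAr in Hd.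
  assert (Hgi : gg (c i) 0 = - r).
  { unfold gg. rewrite Xi, Yi, HAx, HAy, Htx, Hty. transitivity (- r * (sin a * sin a + cos a * cos a)); [ring|rewrite Hsc; ring]. }
  rewrite Hgi in Hd. apply (Rmult_eq_reg_l r); lra. }
assert (Hgj' : gg (c j) (len (c j)) = - (rb / 2)).
{ assert (Hd := net_dot_end i j).
  assert (Ki' : kk (c i) (len (c i)) = 0) by (apply (kk_zero_all _ (net_shrinker _ _ _ Hnet i) 0); lra).
  rewrite Ki', (net_angle_end _ _ _ Hnet i j Hij), HB2 in Hd.
  assert (Hgi : gg (c i) (len (c i)) = rb).
  { unfold gg. rewrite Xi', Yi', U, V, HBx, HBy, Hcb, Hsb, Htx, Hty.
    transitivity (rb * (sin a * sin a + cos a * cos a)); [ring|rewrite Hsc; ring]. }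
  rewrite Hgi in Hd. apply (Rmult_eq_reg_l rb); lra. }
destruct (atan_cos_sin (kk (c j) 0) (gg (c j) 0) r Kj Hr) as [_ S1]; [now rewrite unit_sq|].
destruct (atan_cos_sin (kk (c j) (len (c j))) (gg (c j) (len (c j))) rb Kj' HrbP) as [_ S2]; [now rewrite unit_sq_end|].
rewrite <- (polar_z_start _ _ _ _ _ _ P), Hgj in S1. rewrite <- (polar_z_end _ _ _ _ _ _ P), Hgj' in S2.
assert (B1 := atan_bound (z a)). assert (B2 := atan_bound (z b)).
rewrite Hba in *.
apply (no_arc_across_segment a rho z G).
- apply sin_inj; [lra|lra|]. rewrite S1, sin_PI6. field. lra.
- apply sin_inj; [lra|lra|]. rewrite S2, sin_neg, sin_PI6. field. lra.
Qed.

End net.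

(** Three unit vectors at 120 degrees add up to 0, hence so do the curvatures at A, which are linear
    in the tangents. Reversing all curves changes the signs and reduces two negative curvatures to
    two positive ones. *)
Lemma no_theta_net A B c : ~ theta_net A B c.
Proof.
intros Hnet.
assert (HA := origin_not_junction A B c Hnet).
assert (Hsum : kk (c i1) 0 + kk (c i2) 0 + kk (c i3) 0 = 0).
{ assert (U : forall i, tx (c i) 0 ^ 2 + ty (c i) 0 ^ 2 = 1).
  { intros i. apply (t_unit _ (net_shrinker _ _ _ Hnet i)). assert (L := net_len A B c Hnet i). lra. }
  assert (U1 := U i1). assert (U2 := U i2). assert (U3 := U i3).
  assert (A12 := net_angle_start _ _ _ Hnet i1 i2 ltac:(discriminate)).
  assert (A13 := net_angle_start _ _ _ Hnet i1 i3 ltac:(discriminate)).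
  assert (A23 := net_angle_start _ _ _ Hnet i2 i3 ltac:(discriminate)).
  assert (Hs : (tx (c i1) 0 + tx (c i2) 0 + tx (c i3) 0) ^ 2 + (ty (c i1) 0 + ty (c i2) 0 + ty (c i3) 0) ^ 2 = 0) by nra.
  rewrite <- !Rsqr_pow2 in Hs.
  destruct (Rplus_sqr_eq_0 _ _ Hs) as [Hsx Hsy].
  unfold kk. destruct (net_start _ _ _ Hnet i1) as [-> ->]. destruct (net_start _ _ _ Hnet i2) as [-> ->].
  destruct (net_start _ _ _ Hnet i3) as [-> ->].
  transitivity (fst A * (ty (c i1) 0 + ty (c i2) 0 + ty (c i3) 0) - snd A * (tx (c i1) 0 + tx (c i2) 0 + tx (c i3) 0)); [ring|].
  rewrite Hsx, Hsy. ring. }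
(* Two vanishing curvatures would make both tangents parallel to A, at an angle 0 or PI. *)
assert (Htwo : forall i j, i <> j -> kk (c i) 0 = 0 -> kk (c j) 0 = 0 -> False).
{ intros i j Hij Ki Kj.
  assert (D := net_dot A B c Hnet i j). rewrite Ki, Kj, (net_angle_start _ _ _ Hnet i j Hij) in D.
  assert (Si := unit_sq A B c Hnet i). assert (Sj := unit_sq A B c Hnet j). rewrite Ki in Si. rewrite Kj in Sj.
  set (R2 := fst A ^ 2 + snd A ^ 2) in *. set (gi := gg (c i) 0) in *. set (gj := gg (c j) 0) in *.
  assert ((gi * gj) ^ 2 = R2 ^ 2) by (replace ((gi * gj) ^ 2) with (gi ^ 2 * gj ^ 2) by ring; nra).
  replace (gi * gj) with (- (R2 / 2)) in H by lra. nra. }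
assert (Hrev : forall i, kk (c i) 0 < 0 -> 0 < kk (rev (c i)) 0).
{ intros i Ki. rewrite kk_rev, Rminus_0_r. assert (L := net_len A B c Hnet i). assert (S := net_shrinker _ _ _ Hnet i).
  destruct (Rtotal_order (kk (c i) (len (c i))) 0) as [Hlt|[He|Hgt]]; [lra|exfalso|exfalso].
  - assert (kk (c i) 0 = 0) by (apply (kk_zero_all _ S (len (c i)) 0); lra). lra.
  - assert (0 < kk (c i) 0) by (apply (kk_pos_all _ S (len (c i)) 0); lra). lra. }
assert (Hrev' : forall i, 0 < kk (c i) 0 -> kk (rev (c i)) 0 < 0).
{ intros i Ki. rewrite kk_rev, Rminus_0_r. assert (L := net_len A B c Hnet i). assert (S := net_shrinker _ _ _ Hnet i).
  assert (0 < kk (c i) (len (c i))) by (apply (kk_pos_all _ S 0); lra). lra. }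
assert (Hzero : forall i j m, i <> j -> i <> m -> j <> m -> kk (c i) 0 + kk (c j) 0 + kk (c m) 0 = 0 -> kk (c i) 0 = 0 -> False).
{ intros i j m Hij Him Hjm Hs Ki.
  destruct (Rtotal_order (kk (c j) 0) 0) as [Hlt|[He|Hgt]].
  - apply (no_net_with_segment A B c Hnet i m j); congruence || lra.
  - apply (Htwo i j); assumption.
  - apply (no_net_with_segment A B c Hnet i j m); congruence || lra. }
assert (Hpos : forall i j m, i <> j -> i <> m -> j <> m -> kk (c i) 0 + kk (c j) 0 + kk (c m) 0 = 0 ->
  0 < kk (c i) 0 -> 0 < kk (c j) 0 -> False).
{ intros i j m Hij Him Hjm Hs Ki Kj. apply (no_curved_net A B c Hnet i j m); congruence || lra. }
assert (Hneg : forall i j m, i <> j -> i <> m -> j <> m -> kk (c i) 0 + kk (c j) 0 + kk (c m) 0 = 0 ->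
  kk (c i) 0 < 0 -> kk (c j) 0 < 0 -> False).
{ intros i j m Hij Him Hjm Hs Ki Kj.
  apply (no_curved_net B A (fun i => rev (c i)) (theta_net_rev A B c Hnet) i j m); try congruence.
  - now apply Hrev.
  - now apply Hrev.
  - apply Hrev'. lra. }
destruct (Rtotal_order (kk (c i1) 0) 0) as [H1|[H1|H1]].
- destruct (Rtotal_order (kk (c i2) 0) 0) as [H2|[H2|H2]].
  + apply (Hneg i1 i2 i3); congruence || lra.
  + apply (Hzero i2 i1 i3); congruence || lra.
  + destruct (Rtotal_order (kk (c i3) 0) 0) as [H3|[H3|H3]].
    * apply (Hneg i1 i3 i2); congruence || lra.
    * apply (Hzero i3 i1 i2); congruence || lra.
    * apply (Hpos i2 i3 i1); congruence || lra.
- apply (Hzero i1 i2 i3); congruence || lra.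
- destruct (Rtotal_order (kk (c i2) 0) 0) as [H2|[H2|H2]].
  + destruct (Rtotal_order (kk (c i3) 0) 0) as [H3|[H3|H3]].
    * apply (Hneg i2 i3 i1); congruence || lra.
    * apply (Hzero i3 i1 i2); congruence || lra.
    * apply (Hpos i1 i3 i2); congruence || lra.
  + apply (Hzero i2 i1 i3); congruence || lra.
  + apply (Hpos i1 i2 i3); congruence || lra.
Qed.

(** * From the definition to normalized curves *)

Lemma continuous_clamp_comp (F : R -> R) (a b : R) :
  a <= b -> (forall s, segment a b s -> continue_in F (segment a b) s) ->
  forall x, continuous (fun t => F (clamp a b t)) x.
Proof.
intros Hab H x. apply continuity_pt_filterlim. intros e He.
destruct (H (clamp a b x) (clamp_in a b x Hab) e He) as [d [Hd Hn]].
exists d. split; [exact Hd|]. intros y [_ Hy]. simpl in *. unfold R_dist in *.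
destruct (Req_dec (clamp a b x) (clamp a b y)) as [->|Hne].
- rewrite Rminus_diag, Rabs_R0. exact He.
- apply Hn. split; [split; [apply clamp_in, Hab|exact Hne]|].
  apply Rle_lt_trans with (2 := Hy). apply clamp_lip.
Qed.

Lemma is_derive_clamp_comp (F d : R -> R) (a b x : R) :
  a < x < b -> D_in F d (segment a b) x -> is_derive (fun t => F (clamp a b t)) x (d x).
Proof.
intros Hx H. apply is_derive_Reals. intros e He.
destruct (H e He) as [al [Hal Hn]].
assert (Hd : 0 < Rmin al (Rmin (x - a) (b - x))) by (repeat apply Rmin_glb_lt; lra).
exists (mkposreal _ Hd). intros h Hh Hlt. simpl in Hlt.
assert (M1 := Rmin_l al (Rmin (x - a) (b - x))). assert (M2 := Rmin_r al (Rmin (x - a) (b - x))).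
assert (M3 := Rmin_l (x - a) (b - x)). assert (M4 := Rmin_r (x - a) (b - x)).
assert (Hlt' := Rabs_def2 _ _ Hlt).
rewrite !clamp_id by lra.
specialize (Hn (x + h)). simpl in Hn. unfold R_dist in Hn.
replace (x + h - x) with h in Hn by ring. apply Hn. split; [|lra].
split; [unfold segment; lra|lra].
Qed.

(** Every point of a nondegenerate segment, endpoints included, is a limit of other points of it.
    This identifies the vectors given at a junction with the unit tangents of the curves. *)
Lemma derivative_within_unique (a b : R) (f : R -> R * R) (s : R) (v w : R * R) :
  a < b -> segment a b s ->
  derivative_within (segment a b) f s v -> derivative_within (segment a b) f s w -> v = w.
Proof.
intros Hab Hs [V1 V2] [W1 W2]. unfold segment in Hs.
assert (Hadh : adhDa (D_x (segment a b) s) s).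
{ intros al Hal. unfold segment, D_x.
  destruct (Req_dec s b) as [->|Hne].
  - exists (Rmax a (b - al / 2)).
    assert (M1 := Rmax_l a (b - al / 2)). assert (M2 := Rmax_r a (b - al / 2)).
    assert (M3 : Rmax a (b - al / 2) < b) by (apply Rmax_lub_lt; lra).
    split; [split; lra|]. unfold R_dist. rewrite Rabs_left; lra.
  - exists (Rmin b (s + al / 2)).
    assert (M1 := Rmin_l b (s + al / 2)). assert (M2 := Rmin_r b (s + al / 2)).
    assert (M3 : s < Rmin b (s + al / 2)) by (apply Rmin_glb_lt; lra).
    split; [split; lra|]. unfold R_dist. rewrite Rabs_pos_eq; lra. }
rewrite (surjective_pairing v), (surjective_pairing w). f_equal.
- exact (single_limit _ _ _ _ _ Hadh V1 W1).
- exact (single_limit _ _ _ _ _ Hadh V2 W2).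
Qed.

Lemma norm_1_dot u : norm u = 1 -> fst u ^ 2 + snd u ^ 2 = 1.
Proof.
unfold norm, dot. intros H. assert (Hs := sqrt_sqrt (fst u * fst u + snd u * snd u) ltac:(nra)).
rewrite H in Hs. lra.
Qed.

(** Undoing [acos] needs an argument in [-1, 1], which is supplied by the identity behind
    Cauchy-Schwarz. *)
Lemma angle_120_dot u v : norm u = 1 -> norm v = 1 -> angle u v = 2 * PI / 3 -> dot u v = - (1 / 2).
Proof.
intros Hu Hv Ha. unfold angle in Ha. rewrite Hu, Hv in Ha.
apply norm_1_dot in Hu. apply norm_1_dot in Hv.
replace (dot u v / (1 * 1)) with (dot u v) in Ha by field.
assert (Hd : -1 <= dot u v <= 1).
{ assert (dot u v ^ 2 + (fst u * snd v - snd u * fst v) ^ 2 = 1).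
  { transitivity ((fst u ^ 2 + snd u ^ 2) * (fst v ^ 2 + snd v ^ 2)); [unfold dot; ring|rewrite Hu, Hv; ring]. }
  assert (Hp := pow2_ge_0 (fst u * snd v - snd u * fst v)).
  generalize dependent (dot u v). intros d _ Hd. split; nra. }
rewrite <- (cos_acos _ Hd), Ha. replace (2 * PI / 3) with (2 * (PI / 3)) by field.
rewrite cos_2PI3. field.
Qed.

(* [c] is the given curve, parametrized from its endpoint A to its endpoint B. *)
Record runs_from_to (A B v w : R * R) (a b : R) (gamma : R -> R * R) (c : curve) : Prop := {
  run_shrinker : shrinker c;
  run_start : px c 0 = fst A /\ py c 0 = snd A;
  run_end : px c (len c) = fst B /\ py c (len c) = snd B;
  run_tangent_start : tx c 0 = fst v /\ ty c 0 = snd v;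
  run_tangent_end : tx c (len c) = - fst w /\ ty c (len c) = - snd w;
  run_norm : norm v = 1 /\ norm w = 1;
  run_param : exists u : R -> R, (forall s t, u s = u t -> s = t) /\
    forall s, 0 <= s <= len c -> segment a b (u s) /\ gamma (u s) = (px c s, py c s) }.

Lemma runs_forward A B v w a b gamma :
  a < b -> shrinking_curve (segment a b) gamma ->
  gamma a = A -> gamma b = B ->
  derivative_within (segment a b) gamma a v -> derivative_within (segment a b) gamma b (vopp w) ->
  exists c, runs_from_to A B v w a b gamma c.
Proof.
intros Hab [tau [gss [k [HC2 Heq]]]] HA HB Hv Hw.
assert (Sa : segment a b a) by (unfold segment; lra). assert (Sb : segment a b b) by (unfold segment; lra).
assert (Ta : v = tau a) by (apply (derivative_within_unique a b gamma a); try assumption; apply HC2, Sa).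
assert (Tb : vopp w = tau b) by (apply (derivative_within_unique a b gamma b); try assumption; apply HC2, Sb).
assert (Hneg : forall u : R * R, norm (vopp u) = norm u).
{ intros u. unfold norm, dot, vopp. simpl. f_equal. ring. }
assert (Hcl : forall s, 0 <= s <= b - a -> clamp a b (a + s) = a + s) by (intros s Hs; apply clamp_id; lra).
assert (Hshift : forall (F : R -> R), (forall x, continuous F x) -> forall x, continuous (fun s => F (a + s)) x).
{ intros F HF x. apply (continuous_comp (fun s => a + s) F); [cont|apply HF]. }
assert (Hshiftd : forall (F : R -> R) x d, is_derive F (a + x) d -> is_derive (fun s => F (a + s)) x d).
{ intros F x d HF. evar_last.
  - apply (is_derive_comp F (fun s => a + s)); [exact HF|].
    apply (is_derive_plus (fun _ => a) (fun s => s)); [apply is_derive_const|apply is_derive_id].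
  - unfold scal, plus, zero, one; simpl. unfold mult; simpl. ring. }
set (c := Curve (b - a) (fun s => fst (gamma (clamp a b (a + s)))) (fun s => snd (gamma (clamp a b (a + s))))
  (fun s => fst (tau (clamp a b (a + s)))) (fun s => snd (tau (clamp a b (a + s))))).
assert (Hkk : forall s, 0 < s < b - a -> kk c s = k (a + s)).
{ intros s Hs. unfold kk, c. simpl. rewrite Hcl by lra.
  destruct (Heq (a + s)) as [_ [_ Hk]]; [unfold segment; lra|].
  unfold dot, rot in Hk. simpl in Hk. lra. }
exists c. split.
- split; unfold c; simpl.
  + lra.
  + apply (Hshift (fun t => fst (gamma (clamp a b t)))), (continuous_clamp_comp (fun t => fst (gamma t))); [lra|].
    intros s Hs. eapply cont_deriv. apply (HC2 s Hs).
  + apply (Hshift (fun t => snd (gamma (clamp a b t)))), (continuous_clamp_comp (fun t => snd (gamma t))); [lra|].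
    intros s Hs. eapply cont_deriv. apply (HC2 s Hs).
  + apply (Hshift (fun t => fst (tau (clamp a b t)))), (continuous_clamp_comp (fun t => fst (tau t))); [lra|].
    intros s Hs. eapply cont_deriv. apply (HC2 s Hs).
  + apply (Hshift (fun t => snd (tau (clamp a b t)))), (continuous_clamp_comp (fun t => snd (tau t))); [lra|].
    intros s Hs. eapply cont_deriv. apply (HC2 s Hs).
  + intros s Hs. rewrite Hcl by lra. apply (Hshiftd (fun t => fst (gamma (clamp a b t)))).
    apply (is_derive_clamp_comp (fun t => fst (gamma t)) (fun _ => fst (tau (a + s)))); [lra|].
    apply (HC2 (a + s)). unfold segment; lra.
  + intros s Hs. rewrite Hcl by lra. apply (Hshiftd (fun t => snd (gamma (clamp a b t)))).
    apply (is_derive_clamp_comp (fun t => snd (gamma t)) (fun _ => snd (tau (a + s)))); [lra|].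
    apply (HC2 (a + s)). unfold segment; lra.
  + intros s Hs. fold c. rewrite Hkk, Hcl by lra. apply (Hshiftd (fun t => fst (tau (clamp a b t)))).
    destruct (Heq (a + s)) as [_ [Hg _]]; [unfold segment; lra|].
    replace (- k (a + s) * snd (tau (a + s))) with (fst (gss (a + s))) by (rewrite Hg; unfold vscale, rot; simpl; ring).
    apply (is_derive_clamp_comp (fun t => fst (tau t)) (fun _ => fst (gss (a + s)))); [lra|].
    apply (HC2 (a + s)). unfold segment; lra.
  + intros s Hs. fold c. rewrite Hkk, Hcl by lra. apply (Hshiftd (fun t => snd (tau (clamp a b t)))).
    destruct (Heq (a + s)) as [_ [Hg _]]; [unfold segment; lra|].
    replace (k (a + s) * fst (tau (a + s))) with (snd (gss (a + s))) by (rewrite Hg; unfold vscale, rot; simpl; ring).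
    apply (is_derive_clamp_comp (fun t => snd (tau t)) (fun _ => snd (gss (a + s)))); [lra|].
    apply (HC2 (a + s)). unfold segment; lra.
  + intros s Hs. rewrite Hcl by lra. apply norm_1_dot, Heq. unfold segment; lra.
- simpl. rewrite Hcl, Rplus_0_r, HA by lra. split; reflexivity.
- simpl. rewrite Hcl by lra. replace (a + (b - a)) with b by ring. rewrite HB. split; reflexivity.
- simpl. rewrite Hcl, Rplus_0_r, Ta by lra. split; reflexivity.
- simpl. rewrite Hcl by lra. replace (a + (b - a)) with b by ring. rewrite <- Tb. split; reflexivity.
- split; [rewrite Ta; apply Heq, Sa|rewrite <- Hneg, Tb; apply Heq, Sb].
- exists (fun s => a + s). split; [intros; lra|]. simpl. intros s Hs. split; [unfold segment; lra|].
  rewrite Hcl by lra. apply surjective_pairing.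
Qed.

Lemma runs_rev A B v w a b gamma c :
  runs_from_to A B v w a b gamma c -> runs_from_to B A w v a b gamma (rev c).
Proof.
intros [H1 H2 H3 H4 H5 H6 [u [Hu1 Hu2]]]. split; simpl.
- now apply shrinker_rev.
- now rewrite Rminus_0_r.
- now rewrite Rminus_diag.
- rewrite Rminus_0_r. lra.
- rewrite Rminus_diag. lra.
- tauto.
- exists (fun s => u (len c - s)). split.
  + intros s t He. apply Hu1 in He. lra.
  + intros s Hs. apply Hu2. lra.
Qed.

(** [A <> B] discards the alternatives of [inward_tangent] at the wrong endpoint; a curve given from
    B to A is reversed. *)
Lemma runs_exists A B v w a b gamma :
  a < b -> shrinking_curve (segment a b) gamma ->
  A <> B -> (gamma a = A /\ gamma b = B) \/ (gamma a = B /\ gamma b = A) ->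
  inward_tangent a b gamma A v -> inward_tangent a b gamma B w ->
  exists c, runs_from_to A B v w a b gamma c.
Proof.
intros Hab Hs HAB [[HA HB]|[HB HA]] Hv Hw.
- destruct Hv as [[_ Hv]|[Hv _]]; [|congruence]. destruct Hw as [[Hw _]|[_ Hw]]; [congruence|].
  now apply runs_forward.
- destruct Hv as [[Hv _]|[_ Hv]]; [congruence|]. destruct Hw as [[_ Hw]|[Hw _]]; [|congruence].
  destruct (runs_forward B A w v a b gamma Hab Hs HB HA Hw Hv) as [c Hc].
  exists (rev c). now apply runs_rev.
Qed.

Lemma theta_net_of_shrinker A B a b gamma :
  A <> B -> regular_Theta_shrinker A B a b gamma -> exists c, theta_net A B c.
Proof.
intros HAB [Hlt Hshr Hinj Hends Hint [v [Hv Hva]] [w [Hw Hwa]]].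
assert (Hex : forall i, exists c, runs_from_to A B (v i) (w i) (a i) (b i) (gamma i) c).
{ intros i. apply runs_exists; auto. }
destruct (functional_choice _ Hex) as [c Hc]. exists c.
assert (HI : forall i, injective_curve (c i)).
{ intros i s t Hs Ht [Ex Ey]. destruct (run_param _ _ _ _ _ _ _ _ (Hc i)) as [u [Hu1 Hu2]].
  destruct (Hu2 s Hs) as [S1 G1]. destruct (Hu2 t Ht) as [S2 G2].
  apply Hu1, (Hinj i); [exact S1|exact S2|]. now rewrite G1, G2, Ex, Ey. }
split.
- intros i. apply (run_shrinker _ _ _ _ _ _ _ _ (Hc i)).
- intros i. apply (run_start _ _ _ _ _ _ _ _ (Hc i)).
- intros i. apply (run_end _ _ _ _ _ _ _ _ (Hc i)).
- exact HI.
- intros i j s t Hij Hs Ht [Ex Ey].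
  destruct (run_param _ _ _ _ _ _ _ _ (Hc i)) as [u [_ Hu]]. destruct (run_param _ _ _ _ _ _ _ _ (Hc j)) as [u' [_ Hu']].
  destruct (Hu s Hs) as [S1 G1]. destruct (Hu' t Ht) as [S2 G2].
  assert (Li := len_pos _ (run_shrinker _ _ _ _ _ _ _ _ (Hc i))). assert (Lj := len_pos _ (run_shrinker _ _ _ _ _ _ _ _ (Hc j))).
  destruct (run_start _ _ _ _ _ _ _ _ (Hc i)) as [Xi Yi]. destruct (run_start _ _ _ _ _ _ _ _ (Hc j)) as [Xj Yj].
  destruct (run_end _ _ _ _ _ _ _ _ (Hc i)) as [Xi' Yi']. destruct (run_end _ _ _ _ _ _ _ _ (Hc j)) as [Xj' Yj'].
  (* The common point is a junction, and injectivity of each curve then identifies both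
     parameters. *)
  destruct (Hint i j (u s) (u' t) Hij S1 S2) as [HP|HP]; [rewrite G1, G2, Ex, Ey; reflexivity|left|right];
    rewrite G1 in HP; assert (HPx := f_equal fst HP); assert (HPy := f_equal snd HP); simpl in HPx, HPy.
  + split; [apply (HI i)|apply (HI j)]; try lra; split; lra.
  + split; [apply (HI i)|apply (HI j)]; try lra; split; lra.
- intros i j Hij. destruct (run_tangent_start _ _ _ _ _ _ _ _ (Hc i)) as [-> ->].
  destruct (run_tangent_start _ _ _ _ _ _ _ _ (Hc j)) as [-> ->].
  apply angle_120_dot; [apply (run_norm _ _ _ _ _ _ _ _ (Hc i))|apply (run_norm _ _ _ _ _ _ _ _ (Hc j))|now apply Hva].
- intros i j Hij. destruct (run_tangent_end _ _ _ _ _ _ _ _ (Hc i)) as [-> ->].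
  destruct (run_tangent_end _ _ _ _ _ _ _ _ (Hc j)) as [-> ->].
  transitivity (dot (w i) (w j)); [unfold dot; ring|].
  apply angle_120_dot; [apply (run_norm _ _ _ _ _ _ _ _ (Hc i))|apply (run_norm _ _ _ _ _ _ _ _ (Hc j))|now apply Hwa].
Qed.

Theorem theorem1p1 :
  ~ exists (A B : R * R) (a b : index -> R) (gamma : index -> R -> R * R),
      A <> B /\ regular_Theta_shrinker A B a b gamma.
Proof.
intros [A [B [a [b [gamma [HAB H]]]]]].
destruct (theta_net_of_shrinker A B a b gamma HAB H) as [c Hc].
exact (no_theta_net A B c Hc).
Qed.
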